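(* Let $n,p$ be integers with $n\ge3$ and $2\le p\le n-1$, and fix $\sigma>0$. There is a constant $C=C(n,p,\sigma)$, depending only on $n,p,\sigma$, with the following property. Let $\Omega\subset\mathbb{R}^n$ be a bounded smooth domain and let $u\in C^4(\Omega)\cap C^2(\overline\Omega)$ be positive on $\overline\Omega$ and admissible. If its graph $\Sigma$ satisfies $f(\kappa[\Sigma])=\sigma$ and $\nu^{n+1}\ge\sigma$ on $\Sigma$, then $$\sup_{X\in\Sigma,\ 1\le i\le n}|\kappa_i(X)|\le C\Big(1+\max_{X\in\partial\Sigma,\ 1\le i\le n}|\kappa_i(X)|\Big).$$ In particular $C$ is independent of $u$, of $\Omega$, and of the positive boundary height.
   Context: $\mathbb{H}^{n+1}=\{(x,x_{n+1})\in\mathbb{R}^{n+1}:x_{n+1}>0\}$ is the upper half-space model with metric $x_{n+1}^{-2}\sum_{i=1}^{n+1}dx_i^2$. A domain is a nonempty connected open set. For a positive function $u$ with graph $\Sigma=\{(x,u(x))\}$, put $w=\sqrt{1+|Du|^2}$, $\gamma^{ij}=\delta_{ij}-\frac{u_iu_j}{w(1+w)}$ with $u_i=D_iu$ (Euclidean derivatives), $\gamma=(\gamma^{ij})$, and $$A[u]=\frac1w\big(I_n+u\,\gamma\,D^2u\,\gamma\big).$$ The eigenvalues $\kappa=\kappa[\Sigma]=\kappa[u]=(\kappa_1,\dots,\kappa_n)$ of this symmetric matrix are the hyperbolic principal curvatures of $\Sigma$ (with respect to the upward unit normal, with the sign convention that horizontal horospheres have principal curvatures $1$). The vertical component of the upward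 Euclidean unit normal is $\nu^{n+1}=(1+|Du|^2)^{-1/2}$. $\partial\Sigma=\{(x,u(x)):x\in\partial\Omega\}$ is the finite boundary of the positive graph (not an asymptotic boundary); the curvatures there are computed from the continuous extensions of $u,Du,D^2u$ to $\overline\Omega$. Let $N=\binom np$, $\mathcal I_p=\{I\subset\{1,\dots,n\}:|I|=p\}$, and for $\kappa\in\mathbb{R}^n$ let $\lambda_I=\sum_{i\in I}\kappa_i$. Set $\mathcal P_p=\{\kappa\in\mathbb{R}^n:\lambda_I>0\text{ for all }I\in\mathcal I_p\}$ and, on $\mathcal P_p$, $$f(\kappa)=\frac1p\Big(\prod_{I\in\mathcal I_p}\lambda_I\Big)^{1/N}.$$ A positive function $u$ is admissible if the principal curvature vector of its graph belongs to $\mathcal P_p$ at every point. *)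

(* Defs.v *)
From HB Require Import structures.
From mathcomp Require Import all_boot all_order all_algebra.
From mathcomp Require Import all_classical all_reals all_analysis.
From mathcomp Require spectral complex.

Set Implicit Arguments.
Unset Strict Implicit.
Unset Printing Implicit Defensive.

Import Order.TTheory GRing.Theory Num.Theory.
Import numFieldNormedType.Exports.

Local Open Scope classical_set_scope.
Local Open Scope ring_scope.

Section Calculus.
Variables (R : realType) (n : nat).
Implicit Types (O : set 'rV[R]_n) (u : 'rV[R]_n -> R).

Definition pderiv (i : 'I_n) u : 'rV[R]_n -> R :=
  fun x => 'D_(delta_mx 0 i) u x.

Definition pderivs (s : seq 'I_n) u : 'rV[R]_n -> R := foldr pderiv u s.

(* u is of class C^k on the open set O *)
Definition Ck (k : nat) O u : Prop :=
  (forall (s : seq 'I_n) (i : 'I_n) x, (size s < k)%N -> O x ->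
     derivable (pderivs s u) x (delta_mx 0 i)) /\
  (forall s : seq 'I_n, (size s <= k)%N ->
     forall x, O x -> {for x, continuous (pderivs s u)}).

(* u is of class C^k up to the boundary: the partial derivatives in O up to
   order k extend continuously to the closure, u being its own extension *)
Definition Ck_closure (k : nat) O u : Prop :=
  [/\ Ck k O u, {within closure O, continuous u} &
      forall s : seq 'I_n, (size s <= k)%N ->
        exists g : 'rV[R]_n -> R, {within closure O, continuous g} /\
          forall x, O x -> g x = pderivs s u x].

Definition grad u (x : 'rV[R]_n) : 'rV[R]_n := \row_i pderiv i u x.

Definition hess u (x : 'rV[R]_n) : 'M[R]_n :=
  \matrix_(i, j) pderiv i (pderiv j u) x.

Definition boundary O : set 'rV[R]_n := closure O `\` O°.

Definition domain O : Prop := [/\ O !=set0, open O & connected O].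

(* near each boundary point, O is a sublevel set of a smooth function without
   critical points; in particular O lies on one side of its boundary *)
Definition smooth_boundary O : Prop :=
  forall x0, boundary O x0 ->
    exists (U : set 'rV[R]_n) (rho : 'rV[R]_n -> R),
      [/\ open U, U x0, forall k, Ck k U rho,
          forall x, U x -> grad rho x != 0 &
          O `&` U = [set x | U x /\ rho x < 0]].

Definition bounded_smooth_domain O : Prop :=
  [/\ domain O, bounded_set O & smooth_boundary O].

(* value at x of the continuous extension of h : O -> T to the closure of O *)
Definition extend {p q : nat} O (h : 'rV[R]_n -> 'M[R]_(p, q))
  (x : 'rV[R]_n) : 'M[R]_(p, q) := lim (h @ within O (nbhs x)).

End Calculus.

Section Eigenvalues.
Variables (R : realType) (n : nat).

Definition is_eigenvalues (A : 'M[R]_n) (k : 'rV[R]_n) : Prop :=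
  char_poly A = \prod_(i < n) ('X - (k 0 i)%:P).

(* vector of the eigenvalues of A with multiplicity, in an unspecified order;
   meaningful when A is symmetric (see [eigenvaluesP]) *)
Definition eigenvalues (A : 'M[R]_n) : 'rV[R]_n :=
  xget 0 [set k | is_eigenvalues A k].

End Eigenvalues.

Section Curvature.
Variables (R : realType) (n : nat).
Implicit Types (O : set 'rV[R]_n) (u : 'rV[R]_n -> R).

Definition wfun (q : 'rV[R]_n) : R := Num.sqrt (1 + \sum_(i < n) q 0 i ^+ 2).

Definition gamma (q : 'rV[R]_n) : 'M[R]_n :=
  \matrix_(i, j) ((i == j)%:R - q 0 i * q 0 j / (wfun q * (1 + wfun q))).

(* the matrix A[u] as a function of the values z, q, H of u, Du, D^2 u *)
Definition Amat (z : R) (q : 'rV[R]_n) (H : 'M[R]_n) : 'M[R]_n :=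
  (wfun q)^-1 *: (1%:M + z *: (gamma q *m H *m gamma q)).

Definition kappa u (x : 'rV[R]_n) : 'rV[R]_n :=
  eigenvalues (Amat (u x) (grad u x) (hess u x)).

Definition kappa_boundary O u (x : 'rV[R]_n) : 'rV[R]_n :=
  eigenvalues (Amat (u x) (extend O (grad u) x) (extend O (hess u) x)).

Definition nu_vertical u (x : 'rV[R]_n) : R := (wfun (grad u x))^-1.

Definition lambda (k : 'rV[R]_n) (I : {set 'I_n}) : R := \sum_(i in I) k 0 i.

Definition Pcone (p : nat) : set 'rV[R]_n :=
  [set k | forall I : {set 'I_n}, #|I| = p -> 0 < lambda k I].

Definition fcurv (p : nat) (k : 'rV[R]_n) : R :=
  p%:R^-1 *
  (\prod_(I : {set 'I_n} | #|I| == p) lambda k I) `^ ('C(n, p)%:R^-1).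

Definition admissible (p : nat) O u : Prop :=
  forall x, O x -> Pcone p (kappa u x).

End Curvature.

Section SpectralTheorem.
Import complex.
Variable R : realType.

Local Notation toC := (real_complex R).

Lemma eigenvalues_exist n (A : 'M[R]_n) :
  A^T = A -> exists k, is_eigenvalues A k.
Proof.
move=> symA; pose AC := map_mx toC A.
have herAC : (AC : 'M[complex R]_n) \is hermitianmx _ false Num.conj.
  apply: spectral.realsym_hermsym.
    apply/is_hermitianmxP; rewrite expr0 scale1r map_mx_id//.
    by rewrite /AC map_trmx symA.
  by apply/mxOverP => i j; rewrite mxE complex_real.
have /spectral.orthomx_spectralP := spectral.hermitian_normalmx herAC.
have /mxOverP := spectral.hermitian_spectral_diag_real herAC.
have := spectral.spectral_unit AC.
set P := spectral.spectralmx AC; set d := spectral.spectral_diag AC.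
move=> Punit dreal ACE.
have /choice[k kE] : forall i, exists k : R, d 0 i = toC k.
  by move=> i; apply/complex_realP/dreal.
exists (\row_i k i); rewrite /is_eigenvalues.
apply: (map_inj_poly (@complexI R) (rmorph0 _)).
rewrite map_char_poly -/AC.
have -> : char_poly AC = char_poly (diag_mx d).
  rewrite ACE /char_poly.
  have -> : char_poly_mx (invmx P *m diag_mx d *m P) =
      map_mx polyC (invmx P) *m char_poly_mx (diag_mx d) *m map_mx polyC P.
    rewrite /char_poly_mx mulmxBr mulmxBl -!map_mxM; congr (_ - _).
    by rewrite mul_mx_scalar -scalemxAl -map_mxM mulVmx// map_mx1 scalemx1.
  rewrite !det_mulmx mulrAC -det_mulmx -map_mxM mulVmx// map_mx1 det1.
  by rewrite mul1r.
rewrite char_poly_trig; last exact/diag_mx_is_trig.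
rewrite rmorph_prod; apply: eq_bigr => i _ /=.
by rewrite rmorphB /= map_polyX map_polyC /= !mxE eqxx mulr1n kE.
Qed.

Lemma eigenvaluesP n (A : 'M[R]_n) :
  A^T = A -> is_eigenvalues A (eigenvalues A).
Proof.
move=> /eigenvalues_exist[k Ak]; rewrite /eigenvalues.
by case: xgetP => [y _ //|/(_ k)].
Qed.

Lemma Amat_sym n z (q : 'rV[R]_n) (H : 'M[R]_n) :
  H^T = H -> (Amat z q H)^T = Amat z q H.
Proof.
move=> symH.
have symg : (gamma q)^T = gamma q.
  by apply/matrixP => i j; rewrite !mxE eq_sym [q 0 j * _]mulrC.
by rewrite /Amat linearZ/= linearD/= tr_scalar_mx linearZ/= !trmx_mul
  symH symg mulmxA.
Qed.

End SpectralTheorem.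

(* Main.v *)
Require Import Defs.
From HB Require Import structures.
From mathcomp Require Import all_boot all_order all_algebra all_fingroup.
From mathcomp Require Import ring lra.
From mathcomp Require Import all_classical all_reals all_analysis.
From mathcomp Require mpoly.
Import -(notations) mpoly.

(** Apply the maximum principle to [H ^ (p - 1) / nu ^ p], where [H = tr A[u]] is the
sum of the principal curvatures; the trace is smooth, so no perturbation theory of
eigenvalues is needed.  At an interior maximum, work in a frame that is orthonormal for
the induced metric and diagonalizes the shape operator.  The second derivative of the
equation [prod_I lambda_I = const] expresses the linearized operator on the curvatures
by concavity terms, and commuting the fourth derivatives of [u] turns it into the
linearized operator on [H], with a gain of [binom(n, p) |kappa|^2].  The exponents are
chosen so that the concavity terms absorb the remaining gradient terms, which leaves
[|kappa|^2 <= c (1 + H)] and bounds [H] there.  At a boundary maximum [H] is the sum of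
the boundary curvatures.  Since [sigma <= nu <= 1], [H] is then bounded everywhere, and
in the cone [P_p] with [p < n] it dominates every [|kappa_i|]. *)

Set Implicit Arguments.
Unset Strict Implicit.
Unset Printing Implicit Defensive.

Import Order.TTheory GRing.Theory Num.Theory.
Import numFieldNormedType.Exports.

Local Open Scope ring_scope.

(** * Sums over subsets of fixed size *)

Section SubsetSums.
Variables (R : realFieldType) (n p : nat) (k : 'I_n -> R).
Implicit Types (I : {set 'I_n}) (i j : 'I_n) (x : 'I_n -> R).

(** The weights [p - 1] and [p] come from a balance. With [L = p / (p - 1)], the maximum condition
    leaves a surplus of [L - 1] times the sum of the [dlog p k i * (1 + k i ^+ 2)], while completing
    squares in the gradient terms costs [L] times the sum of the [dlog p k i * t i ^+ 2]. Since
    [p * dlog p k i] is at most the sum of all [dlog p k j], and the [t i ^+ 2] add up to less than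
    1, the cost is at most [L / p = L - 1] times that sum. Two obstacles shape the rest. Eigenvalues
    need not be differentiable where they coincide; but the product of their p-fold sums is
    symmetric, hence a polynomial in the matrix entries, and its off-diagonal second-order
    coefficients are the quotient-free divided differences [dlog2]. Covariant derivatives are
    avoided by keeping the frame constant along straight lines: derivatives of [u] then commute
    exactly, but away from the base point the shape operator is not symmetric, and the Codazzi
    equations acquire error terms. These cancel in the sum, up to a term in the gradient of [H],
    thanks to the first derivative of the equation. *)

Definition ssum x I : R := \sum_(i in I) x i.

(* Gradient of [log (\prod_(#|I| = p) ssum k I)]; [dlog2 i j] is its divided
   difference [(dlog i - dlog j) / (k j - k i)], written without the quotient. *)
Definition dlog i : R :=
  \sum_(I : {set 'I_n} | (#|I| == p) && (i \in I)) (ssum k I)^-1.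

Definition dlog2 i j : R :=
  \sum_(I : {set 'I_n} | (#|I| == p) && ((i \in I) && (j \notin I)))
    (ssum k I * (ssum k I - k i + k j))^-1.

Definition npsets i : R :=
  \sum_(I : {set 'I_n} | (#|I| == p) && (i \in I)) 1.

(** The size-preserving involution that matches the sets containing only [j] with those containing
    only [i]. *)
Let sw i j I := tperm i j @: I.

Lemma mem_sw i j I a : (a \in sw i j I) = (tperm i j a \in I).
Proof.
apply/imsetP/idP => [[b bI ->]|aI]; first by rewrite tpermK.
by exists (tperm i j a); rewrite ?tpermK.
Qed.

Lemma swK i j : involutive (sw i j).
Proof. by move=> I; apply/setP => a; rewrite !mem_sw tpermK. Qed.

Lemma card_sw i j I : #|sw i j I| = #|I|.
Proof. by rewrite card_imset//; exact: perm_inj. Qed.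

Lemma ssum_sw i j x I : i \in I -> j \notin I ->
  ssum x (sw i j I) = ssum x I - x i + x j.
Proof.
move=> iI jI; rewrite /ssum big_imset /=; last by move=> a b _ _; apply: perm_inj.
rewrite (bigD1 i)//= tpermL [in RHS](bigD1 i)//=.
rewrite (eq_bigr x) => [|a /andP[aI ai]]; first by ring.
by rewrite tpermD// 1?eq_sym//; apply: contraNneq jI => <-.
Qed.

Lemma reindex_sw i j (P : pred {set 'I_n}) (F : {set 'I_n} -> R) :
  \sum_(I | P I) F I = \sum_(I | P (sw i j I)) F (sw i j I).
Proof. by rewrite (reindex_inj (can_inj (swK i j))). Qed.

Lemma sw_pred i j I :
  ((#|sw i j I| == p) && ((i \in sw i j I) && (j \notin sw i j I))) =
  ((#|I| == p) && ((j \in I) && (i \notin I))).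
Proof. by rewrite card_sw !mem_sw tpermL tpermR. Qed.

Lemma dlog2C i j : dlog2 i j = dlog2 j i.
Proof.
rewrite /dlog2 (reindex_sw i j); apply: eq_big => [I|I]; rewrite sw_pred//.
move=> /and3P[_ jI iI]; congr (_^-1).
by rewrite /sw tpermC ssum_sw//; ring.
Qed.

Lemma sum_dlog x : \sum_i dlog i * x i =
  \sum_(I : {set 'I_n} | #|I| == p) ssum x I / ssum k I.
Proof.
transitivity (\sum_i \sum_(I : {set 'I_n} | (#|I| == p) && (i \in I))
    x i / ssum k I).
  by apply: eq_bigr => i _; rewrite mulr_suml; apply: eq_bigr => I _;
     rewrite mulrC.
rewrite (exchange_big_dep (fun I : {set 'I_n} => #|I| == p)) /=; last first.
  by move=> i I _ /andP[].
apply: eq_bigr => I pI; rewrite mulr_suml; apply: eq_bigl => i.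
by rewrite pI.
Qed.

Hypothesis kP : forall I, #|I| = p -> 0 < ssum k I.

Lemma ssum_gt0 I : #|I| == p -> 0 < ssum k I.
Proof. by move=> /eqP /kP. Qed.

Lemma ssum_swap_gt0 i j I : #|I| == p -> i \in I -> j \notin I ->
  0 < ssum k I - k i + k j.
Proof. by move=> pI iI jI; rewrite -ssum_sw// ssum_gt0// card_sw. Qed.

Lemma dlog_ge0 i : 0 <= dlog i.
Proof.
by apply: sumr_ge0 => I /andP[/ssum_gt0 I0 _]; rewrite invr_ge0 ltW.
Qed.

Lemma dlog2_ge0 i j : 0 <= dlog2 i j.
Proof.
apply: sumr_ge0 => I /and3P[pI iI jI].
by rewrite invr_ge0 mulr_ge0// ltW ?ssum_gt0// ssum_swap_gt0.
Qed.

(** Sets containing both indices cancel in the difference. The sets containing only [j] are swapped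
    onto those containing only [i], and each pair of reciprocals differs by [k j - k i] over the
    product of the two sums. *)
Lemma dlog2_mul i j : dlog2 i j * (k j - k i) = dlog i - dlog j.
Proof.
rewrite /dlog (bigID (fun I : {set 'I_n} => j \in I)) /=.
rewrite [X in _ = _ - X](bigID (fun I : {set 'I_n} => i \in I)) /=.
rewrite (eq_bigl (fun I : {set 'I_n} => (#|I| == p) && (j \in I) && (i \in I)))/=;
  last by move=> I; rewrite -!andbA [(i \in I) && _]andbC.
rewrite [X in _ = _ - (_ + X)](reindex_sw i j).
under [X in _ = _ - (_ + X)]eq_bigl do
  rewrite -andbA card_sw !mem_sw tpermL tpermR.
under [X in _ = _ + X - _]eq_bigl do rewrite -andbA.
rewrite opprD addrACA subrr add0r -sumrB /dlog2 mulr_suml.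
apply: eq_bigr => I /and3P[pI iI jI].
rewrite ssum_sw//; have := ssum_gt0 pI; have := ssum_swap_gt0 pI iI jI.
move=> /lt0r_neq0 h1 /lt0r_neq0 h2; field; exact/andP.
Qed.

(** Euler's relation for a product of ['C(n, p)] linear forms. *)
Lemma sum_dlog_k : \sum_i dlog i * k i = ('C(n, p))%:R.
Proof.
rewrite sum_dlog (eq_bigr (fun=> 1)) => [|I /ssum_gt0 I0]; last first.
  by rewrite divff// gt_eqF.
rewrite sumr_const; congr (_%:R).
by rewrite -[in RHS](card_ord n) -card_draws cardsE.
Qed.

(** Each reciprocal occurs [p] times in the full sum, once per element of its set, and at most once
    in [dlog i]. *)
Lemma dlog_le_sum i : p%:R * dlog i <= \sum_j dlog j.
Proof.
have -> : \sum_j dlog j = p%:R * \sum_(I : {set 'I_n} | #|I| == p) (ssum k I)^-1.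
  under eq_bigr do rewrite -[dlog _]mulr1.
  rewrite (sum_dlog (fun=> 1)) mulr_sumr; apply: eq_bigr => I /eqP pI.
  by rewrite /ssum sumr_const pI.
rewrite ler_wpM2l// /dlog big_mkcondr /=.
apply: ler_sum => I pI; case: ifP => // _.
by rewrite invr_ge0 ltW// ssum_gt0.
Qed.

(** Double counting without binomial coefficients: the number [c j] of p-sets containing [i] and [j]
    is the same for all [j != i] by a transposition, and all the [c j] add up to [p * npsets i]. *)
Lemma sum_ssum_mem i : (0 < p)%N ->
  (n%:R - 1) * \sum_(I : {set 'I_n} | (#|I| == p) && (i \in I)) ssum k I =
  npsets i * ((n%:R - p%:R) * k i + (p%:R - 1) * \sum_j k j).
Proof.
move=> p0.
pose c j : R := \sum_(I : {set 'I_n} | (#|I| == p) && (i \in I)) (j \in I)%:R.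
have sE (x : 'I_n -> R) :
    \sum_(I : {set 'I_n} | (#|I| == p) && (i \in I)) ssum x I = \sum_j c j * x j.
  rewrite /ssum; under [RHS]eq_bigr do rewrite mulr_suml.
  rewrite [RHS]exchange_big /=; apply: eq_bigr => I _.
  rewrite big_mkcond /=; apply: eq_bigr => j _.
  by case: (j \in I); rewrite ?mul1r ?mul0r.
have ci : c i = npsets i.
  by apply: eq_bigr => I /andP[_ ->].
have cE j l : j != i -> l != i -> c j = c l.
  move=> ji li; rewrite /c (reindex_sw j l).
  apply: eq_big => I; first by rewrite card_sw mem_sw tpermD.
  by move=> _; rewrite mem_sw tpermL.
have c1 : \sum_j c j = p%:R * npsets i.
  under eq_bigr do rewrite -[c _]mulr1.
  rewrite -(sE (fun=> 1)) /npsets mulr_sumr.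
  by apply: eq_bigr => I /andP[/eqP pI _]; rewrite mulr1 /ssum sumr_const pI.
have c2 j : j != i -> (n%:R - 1) * c j = (p%:R - 1) * npsets i.
  move=> ji; move: c1; rewrite (bigD1 i)//= ci.
  rewrite (eq_bigr (fun=> c j)) => [|l li]; last exact: cE.
  rewrite sumr_const cardC1 card_ord -(mulr_natl (c j)) -subn1 natrB => [h|]; last first.
    by apply: leq_trans (ltn_ord i).
  by rewrite [RHS]mulrBl -h; ring.
rewrite sE (bigD1 i)//= [in RHS](bigD1 i)//= ci mulrDr mulr_sumr.
rewrite (eq_bigr (fun j => (p%:R - 1) * npsets i * k j)) => [|j ji]; last first.
  by rewrite mulrA c2.
rewrite -mulr_sumr; ring.
Qed.

(** Harmonic against arithmetic mean over the sets containing [i]; [sum_ssum_mem] evaluates the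
    arithmetic one. *)
Lemma dlog_lower i : (0 < p)%N ->
  (n%:R - 1) * npsets i <=
  dlog i * ((n%:R - p%:R) * k i + (p%:R - 1) * \sum_j k j).
Proof.
move=> p0; set X := (_ * k i + _).
have [I0 I0P|noI] := pickP (fun I : {set 'I_n} => (#|I| == p) && (i \in I));
  last first.
  by rewrite /npsets /dlog !big_pred0// mulr0 mul0r.
have N0 : 0 < npsets i.
  by rewrite /npsets (bigD1 I0)//= ltr_wpDr// sumr_ge0.
pose A := \sum_(I : {set 'I_n} | (#|I| == p) && (i \in I)) ssum k I.
have A0 : 0 < A.
  have /andP[pI0 _] := I0P.
  rewrite /A (bigD1 I0)//= ltr_wpDr ?ssum_gt0//.
  by apply: sumr_ge0 => I /andP[/andP[pI _] _]; rewrite ltW// ssum_gt0.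
(* Each [1 / l] lies above its tangent at [l = 1 / y]; the value [y = npsets i / A] used below is
   the optimal one. *)
have tangent y : 2 * y * npsets i - y ^+ 2 * A <= dlog i.
  rewrite /npsets /A /dlog !mulr_sumr -sumrB; apply: ler_sum => I /andP[pI _].
  have l0 := ssum_gt0 pI; rewrite -subr_ge0.
  have -> : (ssum k I)^-1 - (2 * y * 1 - y ^+ 2 * ssum k I) =
    ssum k I * ((ssum k I)^-1 - y) ^+ 2 by field; exact: lt0r_neq0.
  by rewrite mulr_ge0 ?sqr_ge0// ltW.
have := tangent (npsets i / A).
have -> : 2 * (npsets i / A) * npsets i - (npsets i / A) ^+ 2 * A =
  npsets i ^+ 2 / A by field; exact: lt0r_neq0.
rewrite ler_pdivrMr// => h.
have := sum_ssum_mem i p0; rewrite -/A -/X => AE.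
rewrite -(ler_pM2l N0) [leRHS]mulrCA -AE mulrCA [leRHS]mulrCA -expr2.
rewrite ler_wpM2l// subr_ge0 ler1n.
by apply: leq_trans (ltn_ord i).
Qed.

Lemma ssum_swap_sum i I : #|I| == p ->
  \sum_(j | j \notin I) (ssum k I - k i + k j) =
  (n%:R - p%:R) * (ssum k I - k i) + (\sum_j k j - ssum k I).
Proof.
move=> /eqP pI; rewrite big_split/= sumr_const; congr (_ + _).
  rewrite -[LHS]mulr_natl; congr (_ * _).
  have /(congr1 (fun m => m%:R : R)) := cardC (mem I).
  by rewrite card_ord natrD pI => <-; rewrite addrC addKr.
by rewrite [in RHS](bigID (fun j => j \in I)) /= [RHS]addrC addKr.
Qed.

(** Only the sets containing [i] are kept in the first sum. For each of them every square is
    replaced by a tangent with one common parameter [y], so that the linear terms over [I] and its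
    complement recombine into the full sum of [x]. The hypothesis on [th] ensures that the quadratic
    loss is at most half of the linear gain. *)
Lemma dlog_concave i x (th : R) : 0 < \sum_j k j -> 0 <= th ->
  th * ((\sum_j k j - (n%:R - p%:R) * k i) * dlog i +
        (n%:R - p%:R + 1) * npsets i) <= 2 * (\sum_j k j) * dlog i ->
  th * dlog i * (\sum_j x j) ^+ 2 / (\sum_j k j) <=
  \sum_(I : {set 'I_n} | #|I| == p) (ssum x I / ssum k I) ^+ 2 +
  2 * \sum_(j | j != i) dlog2 i j * x j ^+ 2.
Proof.
set H := \sum_j k j; set X := \sum_j x j => H0 th0 hth.
pose y := th * X / H.
(* Sum of the tangents attached to [I], multiplied by [ssum k I]; the part linear in [k] is
   evaluated by [ssum_swap_sum]. *)
pose Q I := 2 * y * X - y ^+ 2 / 2 *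
  (H - (n%:R - p%:R) * k i + (n%:R - p%:R + 1) * ssum k I).
have stepI I : #|I| == p -> i \in I ->
  (ssum k I)^-1 * Q I <= (ssum x I / ssum k I) ^+ 2 +
   \sum_(j | j \notin I) 2 * x j ^+ 2 / (ssum k I * (ssum k I - k i + k j)).
  move=> pI iI; have l0 := ssum_gt0 pI.
  rewrite -(ler_pM2l l0) mulVKf ?lt0r_neq0// mulrDr mulr_sumr.
  have -> : Q I = (2 * y * ssum x I - y ^+ 2 * ssum k I) +
      \sum_(j | j \notin I) (2 * y * x j - y ^+ 2 / 2 * (ssum k I - k i + k j)).
    rewrite sumrB -!mulr_sumr ssum_swap_sum//.
    have -> : \sum_(j | j \notin I) x j = X - ssum x I.
      by rewrite /X [in RHS](bigID (fun j => j \in I)) /= [RHS]addrC addKr.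
    by rewrite -/H /Q; field.
  apply: lerD.
    rewrite -subr_ge0.
    have -> : ssum k I * (ssum x I / ssum k I) ^+ 2 -
      (2 * y * ssum x I - y ^+ 2 * ssum k I) =
      (ssum x I - y * ssum k I) ^+ 2 / ssum k I by field; exact: lt0r_neq0.
    by rewrite divr_ge0 ?sqr_ge0// ltW.
  apply: ler_sum => j jI; have l1 := ssum_swap_gt0 pI iI jI.
  rewrite -subr_ge0; set l := ssum k I - k i + k j in l1 *.
  have -> : ssum k I * (2 * x j ^+ 2 / (ssum k I * l)) -
     (2 * y * x j - y ^+ 2 / 2 * l) = (2 * x j - y * l) ^+ 2 / (2 * l).
    by field; rewrite !lt0r_neq0.
  by rewrite divr_ge0 ?sqr_ge0// mulr_ge0// ltW.
apply: (@le_trans _ _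
    (\sum_(I : {set 'I_n} | (#|I| == p) && (i \in I)) (ssum k I)^-1 * Q I)).
  have -> : \sum_(I : {set 'I_n} | (#|I| == p) && (i \in I)) (ssum k I)^-1 * Q I =
    2 * y * X * dlog i - y ^+ 2 / 2 *
     ((H - (n%:R - p%:R) * k i) * dlog i + (n%:R - p%:R + 1) * npsets i).
    transitivity ((2 * y * X - y ^+ 2 / 2 * (H - (n%:R - p%:R) * k i)) * dlog i -
      (y ^+ 2 / 2 * (n%:R - p%:R + 1)) * npsets i); last by ring.
    set c1 := (_ - _ * (_ - _)).
    rewrite /dlog /npsets !mulr_sumr -sumrB.
    apply: eq_bigr => I /andP[pI _]; rewrite /Q /c1.
    have := ssum_gt0 pI => /lt0r_neq0 l0; field; exact: l0.
  set W := (_ - _) * dlog i + _ * npsets i in hth *.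
  have : y ^+ 2 / 2 * W <= th * X ^+ 2 / H * dlog i.
    have -> : y ^+ 2 / 2 * W = th * X ^+ 2 / (2 * H ^+ 2) * (th * W).
      by rewrite /y; field; exact: lt0r_neq0.
    have -> : th * X ^+ 2 / H * dlog i =
        th * X ^+ 2 / (2 * H ^+ 2) * (2 * H * dlog i).
      by field; exact: lt0r_neq0.
    by rewrite ler_wpM2l//; apply: divr_ge0; apply: mulr_ge0 => //; exact: sqr_ge0.
  have -> : 2 * y * X * dlog i = 2 * (th * X ^+ 2 / H * dlog i).
    by rewrite /y; field; exact: lt0r_neq0.
  have -> : th * dlog i * X ^+ 2 / H = th * X ^+ 2 / H * dlog i.
    by field; exact: lt0r_neq0.
  lra.
have -> : 2 * \sum_(j | j != i) dlog2 i j * x j ^+ 2 =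
  \sum_(I : {set 'I_n} | (#|I| == p) && (i \in I))
   \sum_(j | j \notin I) 2 * x j ^+ 2 / (ssum k I * (ssum k I - k i + k j)).
  rewrite (exchange_big_dep (fun j => j != i)) /=; last first.
    by move=> I j /andP[_ iI]; apply: contraNneq => ->.
  rewrite mulr_sumr; apply: eq_bigr => j ji.
  rewrite /dlog2 mulr_suml mulr_sumr; apply: eq_big => I; first by rewrite andbA.
  by move=> _; rewrite [in LHS]mulrCA mulrC.
rewrite [in leRHS](bigID (fun I : {set 'I_n} => i \in I)) /=.
rewrite addrAC -big_split /= ler_wpDr//.
  by apply: sumr_ge0 => I _; exact: sqr_ge0.
by apply: ler_sum => I /andP[pI iI]; exact: stepI.
Qed.

End SubsetSums.

(** * The inequality at a maximum *)

Section PointwiseBound.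
Variables (R : realFieldType) (n p : nat) (k t : 'I_n -> R) (nu : R).
Variable (b : 'I_n -> 'I_n -> R).
Implicit Types (I : {set 'I_n}) (i j m : 'I_n).

Hypothesis kP : forall I, #|I| = p -> 0 < ssum k I.
Hypothesis nu0 : 0 < nu.
Hypothesis t2 : \sum_i t i ^+ 2 = 1 - nu ^+ 2.

Local Notation M := (dlog p k).
Local Notation N := ('C(n, p)%:R : R).
Local Notation H := (\sum_j k j).
Local Notation dH m := (\sum_j b j m).
Local Notation concav i :=
  (\sum_(I : {set 'I_n} | #|I| == p) (ssum (b ^~ i) I / ssum k I) ^+ 2 +
   2 * \sum_(j | j != i) dlog2 p k i j * b j i ^+ 2).

(** * The linearized operator on the vertical normal component and on the trace *)

Section Commutation.
(** [nu2 i] is the second derivative of [nu] in direction [i], [B2 i j] that of the [i]-th diagonal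
    entry of the shape operator in direction [j], and [E i j l] the first derivative of its entry
    [(i, j)] in direction [l]; [b j i] above is [E j j i]. [E1] and [E2] are Codazzi equations with
    the error terms of a fixed frame. *)
Variables (nu2 : 'I_n -> R) (B2 : 'I_n -> 'I_n -> R) (E : 'I_n -> 'I_n -> 'I_n -> R).

Hypothesis nu2E : forall i, nu2 i =
  - (\sum_m t m * b i m) - (\sum_m t m ^+ 2 * k i * (k m - k i)) / nu
  - (nu - k i) ^+ 2 / nu.
Hypothesis E1 : forall i j, i != j -> E i j j = b j i + t i * k j / nu * (k i - k j).
Hypothesis E2 : forall i j, i != j -> E j i j = b j i + t i * (k i - k j).
Hypothesis Esym : forall i j l, i != j -> i != l -> j != l -> E i j l = E j i l.
Hypothesis B2_comm : forall i j, i != j -> B2 i j - B2 j i =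
  (k i * nu2 j - k j * nu2 i) / nu + 2 / nu * (t j * k i * b i j - t i * k j * b j i)
  + 2 / nu ^+ 2 * (t i ^+ 2 * ((nu - k i) * k j ^+ 2 - k i * k j * (nu - k j))
                   - t j ^+ 2 * ((nu - k j) * k i ^+ 2 - k i * k j * (nu - k i))).
Hypothesis con1 : forall i, \sum_j M j * b j i = 0.
Hypothesis con2 : forall i, \sum_j M j * B2 j i =
  \sum_(I : {set 'I_n} | #|I| == p) (ssum (b ^~ i) I / ssum k I) ^+ 2 +
  \sum_j \sum_(l | l != j) dlog2 p k j l * (E j l i * E l j i).

(** The derivatives of the shape operator disappear by [con1], and the terms linear in [k] are
    summed by Euler's relation. *)
Lemma sum_dlog_nu2 : \sum_i M i * nu2 i =
  2 * N - nu * \sum_i M i * (1 + k i ^+ 2) - N / nu * \sum_i t i ^+ 2 * k i.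
Proof.
pose A := \sum_i t i ^+ 2 * k i.
have h i : nu2 i = - (\sum_m t m * b i m) - k i * A / nu
    - nu + 2 * k i - nu * k i ^+ 2.
  rewrite nu2E; have -> : \sum_m t m ^+ 2 * k i * (k m - k i) =
      k i * A - k i ^+ 2 * (1 - nu ^+ 2).
    by rewrite -t2 !mulr_sumr -sumrB; apply: eq_bigr => m _; ring.
  by field; exact: lt0r_neq0.
transitivity (- (\sum_i \sum_m M i * (t m * b i m)) +
   (2 - A / nu) * (\sum_i M i * k i) - nu * \sum_i M i * (1 + k i ^+ 2)).
  rewrite !mulr_sumr -sumrN -!big_split -sumrB /=; apply: eq_bigr => i _.
  by rewrite h -mulr_sumr; ring.
rewrite sum_dlog_k// exchange_big /= big1; last first.
  move=> m _; rewrite (eq_bigr (fun i => t m * (M i * b i m))).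
    by rewrite -mulr_sumr con1 mulr0.
  by move=> i _; ring.
by rewrite -/A; ring.
Qed.

(** Commuting derivatives by [B2_comm] creates the errors [F], and expressing [E] by [b] creates the
    errors [G]. Once symmetrized, both carry the factor [M i - M j], since [dlog2_mul] clears the
    divided difference; by [con1] they add up to the last term of the bound alone. *)
Lemma sum_dlog_trace2 :
  \sum_i concav i + N * (\sum_i k i ^+ 2 + n%:R) - H * \sum_i M i * (1 + k i ^+ 2)
  + N / nu * (\sum_m t m * dH m) - 2 * (\sum_m M m * t m * dH m) <=
  \sum_j M j * \sum_i B2 i j.
Proof.
have nuN0 : nu != 0 by exact: lt0r_neq0.
pose G i j := (b i j * t j * (1 + k i / nu) +
               t j ^+ 2 * (k i / nu) * (k j - k i)) * (M i - M j).
pose F i j := 2 / nu * (t i ^+ 2 * k j * (k j - k i) - t i * k j * b j i).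
have GE i j : dlog2 p k i j * ((b i j + t j * k i / nu * (k j - k i)) *
   (b i j + t j * (k j - k i))) = dlog2 p k i j * b i j ^+ 2 + G i j.
  by rewrite /G -(dlog2_mul kP); field.
have con2_ge i : \sum_(I : {set 'I_n} | #|I| == p) (ssum (b ^~ i) I / ssum k I) ^+ 2 +
  2 * \sum_(j | j != i) (dlog2 p k i j * b i j ^+ 2 + G i j) <=
  \sum_j M j * B2 j i.
  rewrite con2 lerD2l [leRHS](bigD1 i)//= mulr2n mulrDl mul1r lerD//.
    apply: ler_sum => j ji; rewrite -GE E1// E2//.
    by rewrite [X in _ * X]mulrC.
  apply: ler_sum => j ji; rewrite [leRHS](bigD1 i) 1?eq_sym//= -GE.
  rewrite dlog2C E1// E2// ler_wpDr//.
  (* Three distinct indices: [Esym] makes the product a square, with a nonnegative weight, and the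
     term is dropped. *)
  apply: sumr_ge0 => l /andP[lj li]; rewrite (Esym (i := l))// mulr_ge0 ?dlog2_ge0//.
  by rewrite -expr2 sqr_ge0.
have B2E i j : B2 i j = B2 j i + (k i * nu2 j - k j * nu2 i) / nu + (F i j - F j i).
  have [->|ij] := eqVneq i j; first by rewrite subrr mul0r subrr !addr0.
  rewrite -addrA; apply/eqP; rewrite addrC -subr_eq B2_comm// /F; apply/eqP.
  by field.
have sumG : \sum_i \sum_j M j * (F i j - F j i) + 2 * \sum_i \sum_j G i j =
    - 2 * \sum_m M m * t m * dH m.
  have -> : \sum_i \sum_j M j * (F i j - F j i) = \sum_i \sum_j (M j - M i) * F i j.
    transitivity (\sum_i \sum_j M j * F i j - \sum_i \sum_j M j * F j i).
      rewrite -sumrB; apply: eq_bigr => i _; rewrite -sumrB.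
      by apply: eq_bigr => j _; ring.
    rewrite [X in _ - X]exchange_big /= -sumrB; apply: eq_bigr => i _.
    by rewrite -sumrB; apply: eq_bigr => j _; ring.
  rewrite [X in 2 * X]exchange_big /= mulr_sumr -big_split /=.
  rewrite mulr_sumr; apply: eq_bigr => i _; rewrite mulr_sumr -big_split /=.
  rewrite (eq_bigr (fun j => 2 * t i * (M j * b j i) - 2 * t i * M i * b j i)).
    by rewrite sumrB -!mulr_sumr con1; ring.
  by move=> j _; rewrite /F /G; field.
have dtr : \sum_i nu2 i = - (\sum_m t m * dH m) -
   (H * (\sum_i t i ^+ 2 * k i) - (1 - nu ^+ 2) * \sum_i k i ^+ 2) / nu -
   (n%:R * nu ^+ 2 - 2 * nu * H + \sum_i k i ^+ 2) / nu.
  rewrite (eq_bigr _ (fun i _ => nu2E i)) !sumrB -!mulr_suml; congr (_ - _ / _ - _ / _).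
  - rewrite sumrN exchange_big /=; congr (- _); apply: eq_bigr => m _.
    by rewrite mulr_sumr.
  - rewrite -t2 mulr_suml mulr_sumr -sumrB; apply: eq_bigr => i _.
    by rewrite mulr_sumr mulr_suml -sumrB; apply: eq_bigr => m _; ring.
  - transitivity (\sum_(i < n) (nu ^+ 2 - 2 * nu * k i + k i ^+ 2)).
      by apply: eq_bigr => i _; ring.
    rewrite big_split sumrB /= sumr_const card_ord [in RHS]mulr_natl.
    by rewrite [in RHS]mulr_sumr.
have -> : \sum_j M j * \sum_i B2 i j = \sum_i \sum_j M j * B2 j i +
   (H * (\sum_j M j * nu2 j) - N * \sum_i nu2 i) / nu +
   \sum_i \sum_j M j * (F i j - F j i).
  transitivity (\sum_i \sum_j M j * B2 i j).
    rewrite exchange_big /=; apply: eq_bigr => j _; by rewrite mulr_sumr.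
  have -> : H * (\sum_j M j * nu2 j) - N * \sum_i nu2 i =
      \sum_i \sum_j M j * (k i * nu2 j - k j * nu2 i).
    rewrite exchange_big /= -(sum_dlog_k kP) mulr_suml mulr_sumr -sumrB; apply: eq_bigr => i _.
    by rewrite mulr_sumr mulr_suml -sumrB; apply: eq_bigr => j _; ring.
  rewrite mulr_suml -!big_split /=; apply: eq_bigr => i _.
  rewrite mulr_suml -!big_split /=; apply: eq_bigr => j _.
  by rewrite [B2 i j]B2E; ring.
rewrite sum_dlog_nu2 dtr.
have := @ler_sum R 'I_n (index_enum _) xpredT _ _ (fun i _ => con2_ge i).
have -> : \sum_i (\sum_(I : {set 'I_n} | #|I| == p) (ssum (b ^~ i) I / ssum k I) ^+ 2 +
  2 * \sum_(j | j != i) (dlog2 p k i j * b i j ^+ 2 + G i j)) =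
  \sum_i concav i + 2 * \sum_i \sum_j G i j.
  rewrite !big_split /= -!addrA; congr (_ + _).
  rewrite -!mulr_sumr -mulrDr; congr (2 * _).
  transitivity (\sum_i (\sum_(j | j != i) dlog2 p k i j * b i j ^+ 2 +
      \sum_(j | j != i) G i j)).
    by apply: eq_bigr => i _; rewrite big_split.
  rewrite big_split /=; congr (_ + _).
    (* Exchanging the labels regroups the squares by direction of differentiation: [concav i] then
       contains only derivatives in direction [i], as [dlog_concave] requires. *)
    rewrite (exchange_big_dep xpredT) //= ; apply: eq_bigr => i _.
    by apply: eq_big => j; [rewrite eq_sym | rewrite dlog2C].
  apply: eq_bigr => i _; rewrite [RHS](bigD1 i)//=.
  have -> : G i i = 0 by rewrite /G; ring.
  by rewrite add0r.
move: sumG; set SG := \sum_i \sum_j G i j; set SF := \sum_i \sum_j _ * (_ - _).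
set SB := \sum_i \sum_j _ * _; set SC := \sum_i concav i.
set SM := \sum_m M m * t m * _; set ST := \sum_m t m * _.
set A := \sum_i t i ^+ 2 * k i; set Q := \sum_i k i ^+ 2.
set W := \sum_i M i * _ => sumG hSB.
have -> : (H * (2 * N - nu * W - N / nu * A) - N * (- ST -
   (H * A - (1 - nu ^+ 2) * Q) / nu - (n%:R * nu ^+ 2 - 2 * nu * H + Q) / nu)) / nu
   = N * (Q + n%:R) - H * W + N / nu * ST by field.
lra.
Qed.

End Commutation.

(** * From the first and second order conditions at a maximum to a bound on the trace *)

Section MaximumPrinciple.
Variables (sigma HH NU : R).
Hypotheses (p2 : (2 <= p)%N) (pn : (p < n)%N).
Hypotheses (sigma0 : 0 < sigma) (sigma_nu : sigma <= nu) (H0 : 0 < H).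
Hypothesis NUE :
  NU = 2 * N - nu * \sum_i M i * (1 + k i ^+ 2) - N / nu * \sum_i t i ^+ 2 * k i.
Hypothesis HHE :
  \sum_i concav i + N * (\sum_i k i ^+ 2 + n%:R) - H * \sum_i M i * (1 + k i ^+ 2)
  + N / nu * (\sum_m t m * dH m) - 2 * (\sum_m M m * t m * dH m) <= HH.
Hypothesis crit : forall i,
  (p%:R - 1) * (dH i / H) = p%:R * (t i * (nu - k i) / nu).
Hypothesis max2 : (p%:R - 1) * (HH / H - \sum_i M i * (dH i / H) ^+ 2) <=
  p%:R * (NU / nu - \sum_i M i * (t i * (nu - k i) / nu) ^+ 2).

(** [L] is the ratio of the two exponents of the test function, and [z] is normalized so that the
    first order condition reads [dH i / H = t i * z i]. *)
Let L : R := p%:R / (p%:R - 1).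
Let z i := L * (nu - k i) / nu.

Let p1 : 1 <= p%:R - 1 :> R.
Proof. by rewrite lerBrDr -(natrD _ 1 1) ler_nat. Qed.

Let pnR : p%:R + 1 <= n%:R :> R.
Proof. by rewrite natr1 ler_nat. Qed.

Let p0 : 0 < p%:R :> R.
Proof. by have := p1; lra. Qed.

Let q0 : 0 < p%:R - 1 :> R.
Proof. by have := p1; lra. Qed.

Let LE : L = 1 + (p%:R - 1)^-1.
Proof. by rewrite /L; field; exact: lt0r_neq0. Qed.

Let L1 : 1 <= L.
Proof. by rewrite LE lerDl invr_ge0 ltW. Qed.

Let L2 : L <= 2.
Proof. by rewrite LE -[2]/(1 + 1) lerD2l invf_le1. Qed.

Let nu1 : nu <= 1.
Proof.
have : 0 <= 1 - nu ^+ 2 by rewrite -t2 sumr_ge0// => i _; exact: sqr_ge0.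
by have := nu0; nra.
Qed.

Let t1 i : t i ^+ 2 <= 1.
Proof.
apply: (@le_trans _ _ (1 - nu ^+ 2)); last by rewrite gerBl sqr_ge0.
by rewrite -t2 (bigD1 i)//= lerDl sumr_ge0// => j _; exact: sqr_ge0.
Qed.

Let dHE i : dH i / H = t i * z i.
Proof.
apply: (mulfI (lt0r_neq0 q0)); rewrite crit /z /L.
by field; rewrite !lt0r_neq0.
Qed.

Lemma concav_theta i th : 0 <= th ->
  th * ((H - (n%:R - p%:R) * k i) * M i + (n%:R - p%:R + 1) * npsets R p i) <=
    2 * H * M i ->
  th * M i * (t i * z i) ^+ 2 <= concav i / H.
Proof.
move=> th0 hth; rewrite -dHE ler_pdivlMr//.
have := dlog_concave kP (b ^~ i) H0 th0 hth.
by congr (_ <= _); field; exact: lt0r_neq0.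
Qed.

Let npsets_le i : npsets R p i <= N.
Proof.
have -> : N = \sum_(I : {set 'I_n} | #|I| == p) 1.
  by rewrite sumr_const -cardsE card_draws card_ord.
rewrite /npsets big_mkcondr /=; apply: ler_sum => I _.
by case: (_ \in _).
Qed.

Let npsets_ge0 i : 0 <= npsets R p i.
Proof. exact: sumr_ge0. Qed.

(* [concav_theta] applies with [th = 2 / p] always.  If it does not apply with [th = 1],
   then [M i] is [O(N / H)] wherever the last bracket is negative. *)
Let index_bound i : 4 * n%:R ^+ 2 <= H ->
  - (M i * t i ^+ 2 * L) - 2 * n%:R ^+ 2 * N / H <=
  concav i / H + M i * t i ^+ 2 * (- 2 * z i - z i ^+ 2 / p%:R).
Proof.
move=> hH.
move: (p1) (pnR) (p0) (q0) (L1) (L2) => P1 Pn P0 Q0 PL PL2.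
move: (nu0) (nu1) (sigma0) (sigma_nu) (H0) => V0 V1 G0 GV HP.
have M0 : 0 <= M i by exact: dlog_ge0.
have t20 : 0 <= t i ^+ 2 by exact: sqr_ge0.
have h2p : 2 / p%:R * M i * (t i * z i) ^+ 2 <= concav i / H.
  apply: concav_theta; first by rewrite divr_ge0// ltW.
  have := dlog_lower kP i (ltnW p2).
  set X := (_ * k i + _) => hX.
  have {}hX : (n%:R - p%:R + 1) * npsets R p i <= M i * X.
    by apply: le_trans hX; rewrite ler_wpM2r//; lra.
  have -> : 2 * H * M i = 2 / p%:R * (p%:R * H * M i).
    by field; exact: lt0r_neq0.
  rewrite ler_wpM2l ?divr_ge0 ?(ltW P0)//.
  have -> : p%:R * H * M i = (H - (n%:R - p%:R) * k i) * M i + M i * X.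
    by rewrite /X; ring.
  by rewrite lerD2l.
have rest0 : 0 <= 2 * n%:R ^+ 2 * N / H.
  by rewrite divr_ge0 ?(ltW H0)// !mulr_ge0// ?sqr_ge0.
have Mt0 : 0 <= M i * t i ^+ 2 by rewrite mulr_ge0.
have [c1|c1] := lerP ((H - (n%:R - p%:R) * k i) * M i +
  (n%:R - p%:R + 1) * npsets R p i) (2 * H * M i).
  have h1 : M i * (t i * z i) ^+ 2 <= concav i / H.
    by have := @concav_theta i 1 ler01; rewrite !mul1r; exact.
  (* With [th = 1] the coefficient of [z i ^+ 2] is [1 - 1 / p = L^-1], so completing the square
     costs exactly [L]. *)
  have h3 : 0 <= M i * t i ^+ 2 * ((z i - L) ^+ 2 / L).
    by rewrite mulr_ge0// divr_ge0 ?sqr_ge0//; lra.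
  have E3 : (z i - L) ^+ 2 / L = z i ^+ 2 - z i ^+ 2 / p%:R - 2 * z i + L.
    by rewrite /L; field; rewrite !lt0r_neq0.
  rewrite E3 in h3; lra.
have E2 : 2 / p%:R * M i * (t i * z i) ^+ 2 +
    M i * t i ^+ 2 * (- 2 * z i - z i ^+ 2 / p%:R) =
    M i * t i ^+ 2 * (z i * (z i - 2 * p%:R) / p%:R).
  by field; exact: lt0r_neq0.
(* With [th = 2 / p] the bracket is [z i * (z i - 2 * p%:R) / p%:R], negative only for [z i] between
   0 and [2 p], and never below [- p]. In that range [k i >= - 2 p]. *)
suff : - (2 * n%:R ^+ 2 * N / H) <=
   M i * t i ^+ 2 * (z i * (z i - 2 * p%:R) / p%:R).
  have : 0 <= M i * t i ^+ 2 * L by rewrite mulr_ge0//; lra.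
  lra.
have [zp|zp] := lerP 0 (z i * (z i - 2 * p%:R)).
  by apply: (@le_trans _ _ 0); rewrite ?oppr_le0// mulr_ge0// divr_ge0// ltW.
have /andP[z0 z2p] : (0 < z i) && (z i < 2 * p%:R).
  have [z0|z0] := ltrP 0 (z i); first by move: zp; rewrite pmulr_rlt0 ?subr_lt0.
  by move: zp; nra.
have kE : k i = nu - nu * (z i / L).
  have L0 : 0 < L by lra.
  by rewrite /z; field; rewrite !lt0r_neq0.
have kge : - (2 * p%:R) <= k i.
  have s0 : 0 <= z i / L by rewrite divr_ge0//; lra.
  have s1 : z i / L <= 2 * p%:R.
    by rewrite ler_pdivrMr; [nra|lra].
  by rewrite kE; nra.
(* By [c1], [M i * H] is less than [- (n - p) * k i * M i] plus a multiple of [npsets i]. The lower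
   bound on [k i] makes the first part at most [2 n^2 * M i], which [H >= 4 n^2] absorbs into half
   of the left side. *)
have MH : M i * H <= 2 * n%:R * N.
  have : (n%:R - p%:R) * k i >= - (2 * n%:R ^+ 2) by nra.
  have := npsets_le i; have := npsets_ge0 i; nra.
have hp : - p%:R <= z i * (z i - 2 * p%:R) / p%:R.
  by rewrite ler_pdivlMr//; have := sqr_ge0 (z i - p%:R); nra.
apply: (@le_trans _ _ (M i * t i ^+ 2 * - p%:R)); last by rewrite ler_wpM2l.
rewrite mulrN lerN2 ler_pdivlMr//.
have -> : M i * t i ^+ 2 * p%:R * H = M i * H * (t i ^+ 2 * p%:R) by ring.
apply: (@le_trans _ _ (2 * n%:R * N * p%:R)).
  by apply: ler_pM => //; [rewrite mulr_ge0// ltW|rewrite mulr_ge0//|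
     rewrite ger_pMl// t1].
have -> : 2 * n%:R ^+ 2 * N = 2 * n%:R * N * n%:R by ring.
by rewrite ler_wpM2l// ?mulr_ge0//; lra.
Qed.

(** In the difference of the two operators the terms in [A] cancel and [(L - 1) * W] survives with
    the good sign. Of the constant, [4 n^2] is what [index_bound] asks for; the rest comes from
    [Q <= 4 / sigma * H + 2 n^3] together with [H ^+ 2 <= n * Q]. *)
Lemma trace_bound : H <= 4 * n%:R ^+ 2 + 2 * n%:R ^+ 4 + 4 * n%:R / sigma.
Proof.
move: (p1) (pnR) (p0) (q0) (L1) (L2) => P1 Pn P0 Q0 PL PL2.
move: (nu0) (nu1) (sigma0) (sigma_nu) (H0) => V0 V1 G0 GV HP.
have n0 : 0 < n%:R :> R by lra.
rewrite leNgt; apply/negP => hH.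
have big1 : 0 < 4 * n%:R / sigma by rewrite divr_gt0// mulr_gt0.
have big2 : 0 <= 2 * n%:R ^+ 4 :> R by rewrite mulr_ge0// exprn_ge0// ltW.
have big3 : 0 <= 4 * n%:R ^+ 2 :> R by rewrite mulr_ge0// exprn_ge0// ltW.
have N0 : 0 < N by rewrite ltr0n bin_gt0 ltnW.
have SM : 0 <= \sum_i M i by apply: sumr_ge0 => i _; exact: dlog_ge0.
have sumb : - L * \sum_i M i * t i ^+ 2 - 2 * n%:R ^+ 3 * N / H <=
  (\sum_i concav i) / H +
  \sum_i M i * t i ^+ 2 * (- 2 * z i - z i ^+ 2 / p%:R).
  rewrite mulr_suml -big_split /=.
  have -> : - L * \sum_i M i * t i ^+ 2 - 2 * n%:R ^+ 3 * N / H =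
      \sum_i (- (M i * t i ^+ 2 * L) - 2 * n%:R ^+ 2 * N / H).
    rewrite big_split /= sumr_const card_ord -[X in _ = _ + X]mulr_natl mulr_sumr.
    congr (_ + _); first by apply: eq_bigr => i _; ring.
    by field; exact: lt0r_neq0.
  by apply: ler_sum => i _; apply: index_bound; lra.
(* The choice of the exponents enters here, through [L - 1 = L / p] and the factor [p] of
   [dlog_le_sum]. *)
have sumt : L * \sum_i M i * t i ^+ 2 <= (L - 1) * \sum_i M i.
  have -> : L - 1 = L / p%:R by rewrite /L; field; rewrite !lt0r_neq0.
  rewrite -mulrA ler_wpM2l//; first by lra.
  apply: (@le_trans _ _ ((p%:R^-1 * \sum_i M i) * \sum_i t i ^+ 2)).
    rewrite mulr_sumr; apply: ler_sum => i _; rewrite ler_wpM2r ?sqr_ge0//.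
    by rewrite ler_pdivlMl ?dlog_le_sum//; lra.
  rewrite t2 ler_piMr ?gerBl ?sqr_ge0// mulr_ge0// invr_ge0 ltW//.
set S := \sum_i M i * t i ^+ 2 in sumb sumt.
set SC := \sum_i concav i in sumb.
pose Z1 := \sum_i M i * t i ^+ 2 * z i.
pose Z2 := \sum_i M i * (t i * z i) ^+ 2.
pose A := \sum_i t i ^+ 2 * k i.
pose Q := \sum_i k i ^+ 2.
pose W := \sum_i M i * (1 + k i ^+ 2).
have L0 : 0 < L by lra.
have sumb' : - L * S - 2 * n%:R ^+ 3 * N / H <= SC / H - 2 * Z1 - Z2 / p%:R.
  apply: le_trans sumb _; rewrite -addrA lerD2l le_eqVlt; apply/orP; left.
  rewrite /Z1 /Z2 -mulNr mulr_sumr mulr_suml -sumrB; apply/eqP.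
  by apply: eq_bigr => i _; ring.
have sumW : \sum_i M i <= W.
  apply: ler_sum => i _; rewrite ler_peMr ?dlog_ge0// lerDl.
  exact: sqr_ge0.
have dHz : (\sum_m t m * dH m) / H = L * (1 - nu ^+ 2) - L / nu * A.
  rewrite -t2 /A mulr_suml !mulr_sumr -sumrB; apply: eq_bigr => i _.
  by rewrite -mulrA dHE /z; field; exact: lt0r_neq0.
have dHz2 : (\sum_m M m * t m * dH m) / H = Z1.
  by rewrite mulr_suml; apply: eq_bigr => i _; rewrite -mulrA dHE; ring.
have dHz3 : \sum_i M i * (dH i / H) ^+ 2 = Z2.
  by apply: eq_bigr => i _; rewrite dHE.
have dnu : \sum_i M i * (t i * (nu - k i) / nu) ^+ 2 = Z2 / L ^+ 2.
  rewrite mulr_suml; apply: eq_bigr => i _; rewrite /z.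
  by field; rewrite !lt0r_neq0.
have HHH : SC / H + N * (Q + n%:R) / H - W +
    N / nu * (L * (1 - nu ^+ 2) - L / nu * A) - 2 * Z1 <= HH / H.
  rewrite -dHz -dHz2 ler_pdivlMr//; apply: le_trans HHE.
  rewrite -/SC -/Q -/W le_eqVlt; apply/orP; left; apply/eqP.
  by field; rewrite !lt0r_neq0.
have mx : HH / H - Z2 <= L * (2 * N / nu - W - N / nu ^+ 2 * A) - Z2 / L.
  rewrite -(ler_pM2l Q0); move: max2; rewrite dHz3 dnu NUE -/A -/W.
  congr (_ <= _); rewrite /L; field; rewrite !lt0r_neq0//.
have Z2E : Z2 - Z2 / L = Z2 / p%:R.
  by rewrite /L; field; rewrite !lt0r_neq0.
have LW : (L - 1) * \sum_i M i <= (L - 1) * W by rewrite ler_wpM2l//; lra.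
have EA : N / nu * (L * (1 - nu ^+ 2) - L / nu * A) =
   N * L * (nu^-1 - nu) - L * (N / nu ^+ 2 * A).
  by field; exact: lt0r_neq0.
have key : N * (Q + n%:R) / H - 2 * n%:R ^+ 3 * N / H <= N * L * (nu^-1 + nu).
  have -> : N * L * (nu^-1 + nu) = L * (2 * N / nu) - N * L * (nu^-1 - nu) by ring.
  rewrite EA in HHH; lra.
have {}key : (Q + n%:R - 2 * n%:R ^+ 3) / H <= L * (nu^-1 + nu).
  rewrite -(ler_pM2l N0); move: key; congr (_ <= _); ring.
have nuV : nu^-1 + nu <= 2 / sigma.
  have h1 : nu^-1 <= sigma^-1 by rewrite lef_pV2.
  have h2 : 1 <= nu^-1 by rewrite invf_ge1.
  lra.
have nuV0 : 0 <= nu^-1 + nu by rewrite addr_ge0// ?invr_ge0 ltW.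
have {}key : (Q + n%:R - 2 * n%:R ^+ 3) / H <= 4 / sigma.
  apply: le_trans key _; have -> : 4 / sigma = 2 * (2 / sigma) by ring.
  by apply: ler_pM => //; lra.
rewrite ler_pdivrMr// in key.
have CS : H ^+ 2 <= n%:R * Q.
  have : 0 <= \sum_i (k i - H / n%:R) ^+ 2 by apply: sumr_ge0 => i _; exact: sqr_ge0.
  have -> : \sum_i (k i - H / n%:R) ^+ 2 = Q - H ^+ 2 / n%:R.
    transitivity (\sum_i (k i ^+ 2 - 2 * (H / n%:R) * k i + (H / n%:R) ^+ 2)).
      by apply: eq_bigr => i _; ring.
    rewrite big_split sumrB /= sumr_const card_ord -[X in _ + X]mulr_natl -mulr_sumr.
    by rewrite -/Q; field; exact: lt0r_neq0.
  by rewrite subr_ge0 ler_pdivrMr// mulrC.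
have H1 : 1 <= H by nra.
have : n%:R * (4 / sigma * H + 2 * n%:R ^+ 3) < H ^+ 2.
  have -> : n%:R * (4 / sigma * H + 2 * n%:R ^+ 3) =
     4 * n%:R / sigma * H + 2 * n%:R ^+ 4 by ring.
  nra.
have : n%:R * Q <= n%:R * (4 / sigma * H + 2 * n%:R ^+ 3).
  by rewrite ler_pM2l//; lra.
lra.
Qed.

End MaximumPrinciple.
End PointwiseBound.

(** * Second-order jets *)

Section Jets.
Variable R : realFieldType.
Implicit Types (f g : R -> R) (a b c : R).

(** Peano expansion [f s = a + b s + c s^2 + o(s^2)] at 0: [c] is half a second derivative, and
    [s = 0] forces [f 0 = a]. Such expansions are unique and stable under algebraic operations, so
    an identity between functions can be differentiated twice by comparing coefficients. *)
Definition jet2 f a b c := forall e, 0 < e ->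
  exists2 d, 0 < d & forall s, `|s| < d ->
    `|f s - (a + b * s + c * s ^+ 2)| <= e * s ^+ 2.

Lemma jet2_ext f g a b c (d : R) : 0 < d -> (forall s, `|s| < d -> f s = g s) ->
  jet2 f a b c -> jet2 g a b c.
Proof.
move=> d0 fg jf e /jf[d' d'0 h]; exists (Num.min d d'); first by rewrite lt_min d0.
by move=> s; rewrite lt_min => /andP[sd sd']; rewrite -fg// h.
Qed.

Lemma eq_jet2 f g a b c : f =1 g -> jet2 f a b c -> jet2 g a b c.
Proof. by move=> fg; apply: (jet2_ext ltr01) => s _; exact: fg. Qed.

Lemma jet2_poly a b c : jet2 (fun s => a + b * s + c * s ^+ 2) a b c.
Proof.
by move=> e e0; exists 1 => // s _; rewrite subrr normr0 mulr_ge0 ?sqr_ge0 ?ltW.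
Qed.

Lemma jet2_cst a : jet2 (fun=> a) a 0 0.
Proof. by apply: (eq_jet2 _ (jet2_poly a 0 0)) => s; ring. Qed.

Lemma jet2D f g a b c a' b' c' : jet2 f a b c -> jet2 g a' b' c' ->
  jet2 (fun s => f s + g s) (a + a') (b + b') (c + c').
Proof.
move=> jf jg e e0; have e20 : 0 < e / 2 by lra.
have [d d0 hd] := jf _ e20; have [d' d'0 hd'] := jg _ e20.
exists (Num.min d d'); first by rewrite lt_min d0.
move=> s; rewrite lt_min => /andP[/hd h /hd' h'].
rewrite (_ : _ - _ = (f s - (a + b * s + c * s ^+ 2)) +
                     (g s - (a' + b' * s + c' * s ^+ 2))); last by ring.
apply: le_trans (ler_normD _ _) _; lra.
Qed.

Lemma jet2M f g a b c a' b' c' : jet2 f a b c -> jet2 g a' b' c' ->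
  jet2 (fun s => f s * g s) (a * a') (a * b' + b * a') (a * c' + b * b' + c * a').
Proof.
move=> jf jg e e0.
pose A := `|a| + `|b| + `|c| + `|a'| + `|b'| + `|c'| + 1.
have na := normr_ge0 a; have nb := normr_ge0 b; have nc := normr_ge0 c.
have na' := normr_ge0 a'; have nb' := normr_ge0 b'; have nc' := normr_ge0 c'.
have A1 : 1 <= A by rewrite /A; lra.
(* The error terms estimated below add up to at most [6 * A ^+ 2 * h * s ^+ 2]. *)
pose eta := e / (8 * A ^+ 2).
have A20 : 1 <= A ^+ 2 by rewrite expr2; nra.
pose h := Num.min 1 eta.
have h0 : 0 < h by rewrite lt_min ltr01 divr_gt0//; lra.
have h1 : h <= 1 by rewrite ge_min lexx.
have h2 : h * (8 * A ^+ 2) <= e.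
  by rewrite -ler_pdivlMr ?ge_min ?lexx ?orbT//; lra.
have [d d0 hd] := jf _ h0; have [d' d'0 hd'] := jg _ h0.
exists (Num.min (Num.min d d') h); first by rewrite lt_min h0 andbT lt_min d0.
move=> s; rewrite lt_min => /andP[+ sh]; rewrite lt_min => /andP[/hd {}hd /hd' {}hd'].
pose F := a + b * s + c * s ^+ 2; pose G := a' + b' * s + c' * s ^+ 2.
have s1 : `|s| <= 1 by lra.
have s2 : s ^+ 2 = `|s| ^+ 2 by rewrite real_normK ?num_real.
have bnd x y z : `|x| + `|y| + `|z| <= A -> `|x + y * s + z * s ^+ 2| <= A.
  move=> xyz; apply: le_trans xyz.
  apply: le_trans (ler_normD _ _) _; apply: lerD.
    apply: le_trans (ler_normD _ _) _; apply: lerD => //.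
    by rewrite normrM ler_piMr.
  by rewrite normrM ler_piMr// normrX expr_le1.
have hF : `|F| <= A by apply: bnd; rewrite /A; lra.
have hG : `|G| <= A by apply: bnd; rewrite /A; lra.
rewrite (_ : _ - _ = s ^+ 2 * (s * (b * c' + c * b' + c * c' * s)) +
   F * (g s - G) + (f s - F) * G + (f s - F) * (g s - G)); last by rewrite /F /G; ring.
rewrite -/F in hd; rewrite -/G in hd'.
set r := f s - F in hd *; set r' := g s - G in hd' *.
have hs : `|s * (b * c' + c * b' + c * c' * s)| <= h * (3 * A ^+ 2).
  rewrite normrM; apply: ler_pM => //; first exact: ltW.
  have AA x y : `|x| <= A -> `|y| <= A -> `|x * y| <= A ^+ 2.
    by move=> xA yA; rewrite normrM expr2; apply: ler_pM.
  have b1 : `|b * c'| <= A ^+ 2 by apply: AA; rewrite /A; lra.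
  have b2 : `|c * b'| <= A ^+ 2 by apply: AA; rewrite /A; lra.
  have b3 : `|c * c' * s| <= A ^+ 2.
    rewrite normrM; apply: (@le_trans _ _ `|c * c'|); first by rewrite ler_piMr.
    by apply: AA; rewrite /A; lra.
  have := ler_normD (b * c' + c * b') (c * c' * s).
  have := ler_normD (b * c') (c * b'); lra.
have s20 : 0 <= s ^+ 2 by exact: sqr_ge0.
have t1 : `|s ^+ 2 * (s * (b * c' + c * b' + c * c' * s))| <= s ^+ 2 * (h * (3 * A ^+ 2)).
  by rewrite normrM (ger0_norm s20) ler_wpM2l.
have t2 : `|F * r'| <= A * (h * s ^+ 2) by rewrite normrM; apply: ler_pM.
have t3 : `|r * G| <= h * s ^+ 2 * A by rewrite normrM; apply: ler_pM.
have t4 : `|r * r'| <= h * s ^+ 2.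
  rewrite normrM -[leRHS]mulr1; apply: ler_pM => //; apply: le_trans hd' _.
  by rewrite mulr_ile1 ?(ltW h0)// s2 expr_le1.
have hs20 : 0 <= h * s ^+ 2 by rewrite mulr_ge0// ltW.
have u1 : h * s ^+ 2 * A <= h * s ^+ 2 * A ^+ 2 by rewrite ler_wpM2l// expr2; nra.
have u2 : h * s ^+ 2 <= h * s ^+ 2 * A ^+ 2 by rewrite ler_peMr.
have u3 : h * s ^+ 2 * (8 * A ^+ 2) <= e * s ^+ 2.
  by rewrite mulrAC ler_wpM2r.
have := ler_normD (s ^+ 2 * (s * (b * c' + c * b' + c * c' * s)) + F * r' + r * G) (r * r').
have := ler_normD (s ^+ 2 * (s * (b * c' + c * b' + c * c' * s)) + F * r') (r * G).
have := ler_normD (s ^+ 2 * (s * (b * c' + c * b' + c * c' * s))) (F * r').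
lra.
Qed.

Lemma jet2Z (x : R) f a b c : jet2 f a b c ->
  jet2 (fun s => x * f s) (x * a) (x * b) (x * c).
Proof.
move=> /(jet2M (jet2_cst x)); rewrite !mul0r !addr0.
by [].
Qed.

Lemma jet2N f a b c : jet2 f a b c -> jet2 (fun s => - f s) (- a) (- b) (- c).
Proof.
by move=> /(jet2Z (-1)); rewrite !mulN1r; apply: eq_jet2 => s; rewrite mulN1r.
Qed.

Lemma jet2_sum (T : Type) (r : seq T) (P : pred T) (f : T -> R -> R) (a b c : T -> R) :
  (forall i, P i -> jet2 (f i) (a i) (b i) (c i)) ->
  jet2 (fun s => \sum_(i <- r | P i) f i s) (\sum_(i <- r | P i) a i)
    (\sum_(i <- r | P i) b i) (\sum_(i <- r | P i) c i).
Proof.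
move=> jf; elim: r => [|x r IH].
  by rewrite !big_nil; apply: (eq_jet2 _ (jet2_cst 0)) => s; rewrite big_nil.
rewrite !big_cons; case: ifP => Px; last first.
  by apply: (eq_jet2 _ IH) => s; rewrite big_cons Px.
by apply: (eq_jet2 _ (jet2D (jf _ Px) IH)) => s; rewrite big_cons Px.
Qed.

Lemma jet2_ge0 a b c : jet2 (fun=> 0) a b c -> [/\ a = 0, b = 0 & c = 0].
Proof.
move=> j.
have a0 : a = 0.
  have [//|a0] := eqVneq a 0; exfalso.
  have [d d0 /(_ 0)] := j 1 ltr01; rewrite normr0 => /(_ d0).
  by rewrite /= expr0n /= !mulr0 !addr0 sub0r normrN normr_le0 (negPf a0).
rewrite {}a0 in j *.
have b0 : b = 0.
  apply/eqP; rewrite -normr_le0 leNgt; apply/negP => b0.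
  have [d d0 h] := j 1 ltr01.
  pose s := Num.min (d / 2) (`|b| / (2 * (`|c| + 2))).
  have nc := normr_ge0 c.
  have s0 : 0 < s by rewrite lt_min !divr_gt0//; lra.
  have sd : `|s| < d.
    by rewrite gtr0_norm//; apply: (@le_lt_trans _ _ (d / 2)); [rewrite ge_min lexx|lra].
  have sb : s * (2 * (`|c| + 2)) <= `|b|.
    by rewrite -ler_pdivlMr ?ge_min ?lexx ?orbT//; lra.
  have := h s sd; rewrite /= !add0r normrN mul1r => h1.
  have := ler_normB (b * s + c * s ^+ 2) (c * s ^+ 2).
  rewrite addrK !normrM (gtr0_norm s0) => h2.
  have : `|b| * s <= s ^+ 2 * (1 + `|c|) by lra.
  rewrite expr2 -mulrA mulrC ler_pM2l//; nra.
rewrite {}b0 in j *; split=> //.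
apply/eqP; rewrite -normr_le0 leNgt; apply/negP => c0.
have c20 : 0 < `|c| / 2 by rewrite divr_gt0.
have [d d0 h] := j _ c20.
have s0 : 0 < d / 2 by rewrite divr_gt0.
have /h : `|d / 2| < d by rewrite gtr0_norm//; lra.
rewrite /= mul0r !add0r normrN normrM (ger0_norm (sqr_ge0 _)) ler_pM2r ?exprn_gt0//.
lra.
Qed.

Lemma jet2_uniq f a b c a' b' c' : jet2 f a b c -> jet2 f a' b' c' ->
  [/\ a = a', b = b' & c = c'].
Proof.
move=> jf /jet2N /(jet2D jf) j.
have /jet2_ge0[/eqP] : jet2 (fun=> 0) (a - a') (b - b') (c - c').
  by apply: eq_jet2 j => s; rewrite subrr.
by rewrite !subr_eq0 => /eqP-> /eqP; rewrite subr_eq0 => /eqP-> /eqP;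
   rewrite subr_eq0 => /eqP->.
Qed.

Lemma jet2_at0 f a b c : jet2 f a b c -> f 0 = a.
Proof.
move=> j; apply/eqP; rewrite -subr_eq0 -normr_le0; have [d d0 /(_ 0)] := j 1 ltr01.
by rewrite normr0 => /(_ d0); rewrite expr0n /= !mulr0 !addr0.
Qed.

Lemma jet2_max f a b c (d : R) : 0 < d -> (forall s, `|s| < d -> f s <= f 0) ->
  jet2 f a b c -> b = 0 /\ c <= 0.
Proof.
move=> d0 fmax jf; have f0 := jet2_at0 jf.
have ub e : 0 < e -> exists2 d', 0 < d' & forall s, `|s| < d' ->
    b * s + c * s ^+ 2 <= e * s ^+ 2.
  move=> /jf[d' d'0 h]; exists (Num.min d d'); first by rewrite lt_min d0.
  move=> s; rewrite lt_min => /andP[/fmax + /h]; rewrite f0 ler_norml => h1 /andP[h2 _].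
  by lra.
have b0 : b = 0.
  apply/eqP; rewrite -normr_le0 leNgt; apply/negP => b0.
  have [d' d'0 h] := ub 1 ltr01.
  pose s := Num.min (d' / 2) (`|b| / (2 * (`|c| + 2))).
  have nc := normr_ge0 c; have c1 := ler_norm (- c); rewrite normrN in c1.
  have s0 : 0 < s by rewrite lt_min !divr_gt0//; lra.
  have sd : s < d'.
    by apply: (@le_lt_trans _ _ (d' / 2)); [rewrite ge_min lexx|lra].
  have sb : s * (2 * (`|c| + 2)) <= `|b|.
    by rewrite -ler_pdivlMr ?ge_min ?lexx ?orbT//; lra.
  have : `|b| * s + c * s ^+ 2 <= 1 * s ^+ 2.
    have [bn|bp] := ltrP b 0.
      have := h (- s); rewrite normrN gtr0_norm// => /(_ sd).
      by rewrite ltr0_norm// sqrrN mulrN mulNr.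
    by have := h s; rewrite gtr0_norm// => /(_ sd); rewrite ger0_norm.
  rewrite mul1r -lerBrDr => h1.
  have : `|b| * s <= (1 + `|c|) * s * s.
    by apply: le_trans h1 _; have := sqr_ge0 s; rewrite expr2; nra.
  by rewrite ler_pM2r//; nra.
split=> //; rewrite leNgt; apply/negP => c0.
have c20 : 0 < c / 2 by rewrite divr_gt0.
have [d' d'0 h] := ub _ c20.
have s0 : 0 < d' / 2 by rewrite divr_gt0.
have /h : `|d' / 2| < d' by rewrite gtr0_norm//; lra.
by rewrite b0 mul0r add0r ler_pM2r ?exprn_gt0//; lra.
Qed.

Lemma jet2_prod_lin (T : Type) (r : seq T) (P : pred T) (l e : T -> R) :
  (forall i, P i -> l i != 0) ->
  let S := \sum_(i <- r | P i) e i / l i in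
  let S2 := \sum_(i <- r | P i) (e i / l i) ^+ 2 in
  let Pr := \prod_(i <- r | P i) l i in
  jet2 (fun s => \prod_(i <- r | P i) (l i + s * e i)) Pr (Pr * S)
    (Pr * (S ^+ 2 - S2) / 2).
Proof.
move=> l0; elim: r => [|x r IH] /=.
  rewrite !big_nil expr0n /= subr0 !mulr0 mul0r.
  by apply: (eq_jet2 _ (jet2_cst 1)) => s; rewrite big_nil.
rewrite !big_cons; case: ifP => Px; last first.
  by apply: (eq_jet2 _ IH) => s; rewrite big_cons Px.
have := jet2M (jet2_poly (l x) (e x) 0) IH.
set Pr := \prod_(i <- r | P i) _; set S := \sum_(i <- r | P i) _ / _.
set S2 := \sum_(i <- r | P i) _ ^+ 2.
have -> : l x * (Pr * S) + e x * Pr = l x * Pr * (e x / l x + S).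
  by field; exact: l0.
have -> : l x * (Pr * (S ^+ 2 - S2) / 2) + e x * (Pr * S) + 0 * Pr =
  l x * Pr * ((e x / l x + S) ^+ 2 - ((e x / l x) ^+ 2 + S2)) / 2.
  by field; exact: l0.
by apply: eq_jet2 => s; rewrite big_cons Px; congr (_ * _); ring.
Qed.

Lemma jet2_prod_sqr (T : Type) (r : seq T) (P : pred T) (l : T -> R) :
  (forall i, P i -> l i != 0) ->
  let Pr := \prod_(i <- r | P i) l i in
  jet2 (fun s => \prod_(i <- r | P i) (l i - s ^+ 2)) Pr 0
    (- (Pr * \sum_(i <- r | P i) (l i)^-1)).
Proof.
move=> l0; elim: r => [|x r IH] /=.
  rewrite !big_nil mulr0 oppr0.
  by apply: (eq_jet2 _ (jet2_cst 1)) => s; rewrite big_nil.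
rewrite !big_cons; case: ifP => Px; last first.
  by apply: (eq_jet2 _ IH) => s; rewrite big_cons Px.
have := jet2M (jet2_poly (l x) 0 (-1)) IH.
set Pr := \prod_(i <- r | P i) _; set S := \sum_(i <- r | P i) _^-1.
have -> : l x * 0 + 0 * Pr = 0 by ring.
have -> : l x * - (Pr * S) + 0 * 0 + -1 * Pr = - (l x * Pr * ((l x)^-1 + S)).
  by field; exact: l0.
by apply: eq_jet2 => s; rewrite big_cons Px; congr (_ * _); ring.
Qed.

End Jets.

(** * Second variation of spectral functions *)

Section Taylor.
Variables (R : realFieldType) (T : finType).
Implicit Types (D e : T -> R) (P : (T -> R) -> R) (L : T -> R) (Q : T -> T -> R).

Definition lform L e := \sum_x L x * e x.
Definition qform Q e := \sum_x \sum_y Q x y * (e x * e y).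

(** Curves rather than lines are allowed: the contribution [lform L E2] is what brings in the second
    derivative of the shape operator. *)
Definition expansion2 D P L Q := forall (E : R -> T -> R) (E1 E2 : T -> R),
  (forall x, jet2 (fun s => E s x) (D x) (E1 x) (E2 x)) ->
  jet2 (fun s => P (E s)) (P D) (lform L E1) (lform L E2 + qform Q E1).

Definition taylor2 D P := exists L Q, expansion2 D P L Q.

Lemma eq_taylor2 D P P' : P =1 P' -> taylor2 D P -> taylor2 D P'.
Proof.
move=> PP' [L [Q h]]; exists L, Q => E E1 E2 /h; rewrite PP'.
by apply: eq_jet2 => s; rewrite PP'.
Qed.

Lemma taylor2_cst D a : taylor2 D (fun=> a).
Proof.
exists (fun=> 0), (fun _ _ => 0) => E E1 E2 _.
have l0 e : lform (fun=> 0) e = 0 by rewrite /lform big1// => x _; rewrite mul0r.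
rewrite !l0 /qform big1 ?addr0; first exact: jet2_cst.
by move=> x _; rewrite big1// => y _; rewrite mul0r.
Qed.

Lemma taylor2_coord D x : taylor2 D (fun e => e x).
Proof.
exists (fun y => (y == x)%:R), (fun _ _ => 0) => E E1 E2 /(_ x).
have lE e : lform (fun y => (y == x)%:R) e = e x.
  rewrite /lform (bigD1 x)//= eqxx mul1r big1 ?addr0// => y /negPf->.
  by rewrite mul0r.
rewrite !lE [qform _ _]big1 ?addr0// => y _; rewrite big1// => z _.
by rewrite mul0r.
Qed.

Lemma taylor2D D P P' : taylor2 D P -> taylor2 D P' ->
  taylor2 D (fun e => P e + P' e).
Proof.
move=> [L [Q h]] [L' [Q' h']].
exists (fun x => L x + L' x), (fun x y => Q x y + Q' x y) => E E1 E2 j.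
have lE e : lform (fun x => L x + L' x) e = lform L e + lform L' e.
  by rewrite /lform -big_split; apply: eq_bigr => x _; rewrite mulrDl.
have qE e : qform (fun x y => Q x y + Q' x y) e = qform Q e + qform Q' e.
  rewrite /qform -big_split; apply: eq_bigr => x _; rewrite -big_split.
  by apply: eq_bigr => y _; rewrite mulrDl.
by rewrite !lE qE addrACA; apply: jet2D; [exact: h|exact: h'].
Qed.

Lemma taylor2M D P P' : taylor2 D P -> taylor2 D P' ->
  taylor2 D (fun e => P e * P' e).
Proof.
move=> [L [Q h]] [L' [Q' h']]; set a := P D; set a' := P' D.
exists (fun x => a * L' x + a' * L x),
  (fun x y => a * Q' x y + a' * Q x y + L x * L' y) => E E1 E2 j.
have lE e : lform (fun x => a * L' x + a' * L x) e = a * lform L' e + a' * lform L e.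
  by rewrite /lform !mulr_sumr -big_split; apply: eq_bigr => x _ /=; ring.
have qE e : qform (fun x y => a * Q' x y + a' * Q x y + L x * L' y) e =
    a * qform Q' e + a' * qform Q e + lform L e * lform L' e.
  rewrite /qform /lform mulr_suml !mulr_sumr -!big_split; apply: eq_bigr => x _ /=.
  rewrite !mulr_sumr -!big_split; apply: eq_bigr => y _ /=; ring.
have := jet2M (h _ _ _ j) (h' _ _ _ j).
by rewrite !lE qE -/a -/a'; congr (jet2 _ _ _ _); ring.
Qed.

Lemma taylor2_sum D (I : Type) (r : seq I) (p : pred I) (F : I -> (T -> R) -> R) :
  (forall i, p i -> taylor2 D (F i)) -> taylor2 D (fun e => \sum_(i <- r | p i) F i e).
Proof.
move=> hF; elim: r => [|x r IH].
  by apply: (eq_taylor2 _ (taylor2_cst _ 0)) => e; rewrite big_nil.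
case px: (p x); last by apply: (eq_taylor2 _ IH) => e; rewrite big_cons px.
by apply: (eq_taylor2 _ (taylor2D (hF _ px) IH)) => e; rewrite big_cons px.
Qed.

Lemma taylor2_prod D (I : Type) (r : seq I) (p : pred I) (F : I -> (T -> R) -> R) :
  (forall i, p i -> taylor2 D (F i)) -> taylor2 D (fun e => \prod_(i <- r | p i) F i e).
Proof.
move=> hF; elim: r => [|x r IH].
  by apply: (eq_taylor2 _ (taylor2_cst _ 1)) => e; rewrite big_nil.
case px: (p x); last by apply: (eq_taylor2 _ IH) => e; rewrite big_cons px.
by apply: (eq_taylor2 _ (taylor2M (hF _ px) IH)) => e; rewrite big_cons px.
Qed.

Lemma taylor2X D P m : taylor2 D P -> taylor2 D (fun e => P e ^+ m).
Proof.
move=> h; elim: m => [|m IH].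
  exact: (eq_taylor2 _ (taylor2_cst _ 1)).
by apply: (eq_taylor2 _ (taylor2M h IH)) => e; rewrite exprS.
Qed.

Definition ptaylor2 D (F : (T -> R) -> {poly R}) :=
  forall m, taylor2 D (fun e => (F e)`_m).

Lemma eq_ptaylor2 D F F' : F =1 F' -> ptaylor2 D F -> ptaylor2 D F'.
Proof. by move=> FF' h m; apply: eq_taylor2 (h m) => e; rewrite FF'. Qed.

Lemma ptaylor2_cst D q : ptaylor2 D (fun=> q).
Proof. by move=> m; exact: taylor2_cst. Qed.

Lemma ptaylor2D D F F' : ptaylor2 D F -> ptaylor2 D F' ->
  ptaylor2 D (fun e => F e + F' e).
Proof.
by move=> h h' m; apply: (eq_taylor2 _ (taylor2D (h m) (h' m))) => e; rewrite coefD.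
Qed.

Lemma ptaylor2M D F F' : ptaylor2 D F -> ptaylor2 D F' ->
  ptaylor2 D (fun e => F e * F' e).
Proof.
move=> h h' m.
apply: (@eq_taylor2 _ (fun e => \sum_(j < m.+1) (F e)`_j * (F' e)`_(m - j))).
  by move=> e; rewrite coefM.
by apply: taylor2_sum => j _; exact: taylor2M.
Qed.

Lemma ptaylor2_sum D (I : Type) (r : seq I) (F : I -> (T -> R) -> {poly R}) :
  (forall i, ptaylor2 D (F i)) -> ptaylor2 D (fun e => \sum_(i <- r) F i e).
Proof.
move=> hF; elim: r => [|x r IH].
  by apply: (eq_ptaylor2 _ (ptaylor2_cst _ 0)) => e; rewrite big_nil.
by apply: (eq_ptaylor2 _ (ptaylor2D (hF x) IH)) => e; rewrite big_cons.
Qed.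

Lemma ptaylor2_prod D (I : Type) (r : seq I) (F : I -> (T -> R) -> {poly R}) :
  (forall i, ptaylor2 D (F i)) -> ptaylor2 D (fun e => \prod_(i <- r) F i e).
Proof.
move=> hF; elim: r => [|x r IH].
  by apply: (eq_ptaylor2 _ (ptaylor2_cst _ 1)) => e; rewrite big_nil.
by apply: (eq_ptaylor2 _ (ptaylor2M (hF x) IH)) => e; rewrite big_cons.
Qed.

Lemma ptaylor2_coord D x : ptaylor2 D (fun e => (e x)%:P).
Proof.
move=> m; apply: (@eq_taylor2 _ (fun e => if m == 0 then e x else 0)).
  by move=> e; rewrite coefC.
by case: (m == 0); [exact: taylor2_coord|exact: taylor2_cst].
Qed.

End Taylor.

(** * The product of the p-fold eigenvalue sums as a polynomial in the matrix *)

Section SpectralPolynomial.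
Variables (R : realFieldType) (n p : nat).
Implicit Types (k : 'I_n -> R).

Definition mx_of (e : 'I_n * 'I_n -> R) : 'M[R]_n := \matrix_(i, j) e (i, j).

Lemma taylor2_char_poly D m : taylor2 D (fun e => (char_poly (mx_of e))`_m).
Proof.
move: m; rewrite -/(ptaylor2 D (fun e => char_poly (mx_of e))).
apply: ptaylor2_sum => s; apply: ptaylor2M; first exact: ptaylor2_cst.
apply: ptaylor2_prod => i.
apply: (@eq_ptaylor2 _ _ _ (fun e => ('X *+ (i == s i)) + (-1) * (e (i, s i))%:P)).
  by move=> e; rewrite !mxE mulN1r.
apply: ptaylor2D; first exact: ptaylor2_cst.
apply: ptaylor2M; [exact: ptaylor2_cst|exact: ptaylor2_coord].
Qed.

Definition ssum_mpoly : mpoly n R :=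
  \prod_(I : {set 'I_n} | #|I| == p) \sum_(i in I) mpolyX R (mnm1 i).

Lemma ssum_mpoly_eval k :
  meval k ssum_mpoly = \prod_(I : {set 'I_n} | #|I| == p) ssum k I.
Proof.
rewrite /ssum_mpoly rmorph_prod; apply: eq_bigr => I _.
by rewrite rmorph_sum /=; apply: eq_bigr => i _; exact: mevalXU.
Qed.

Lemma ssum_mpoly_sym : ssum_mpoly \is symmetric.
Proof.
apply/issymP => s; rewrite /ssum_mpoly rmorph_prod /=.
transitivity (\prod_(I : {set 'I_n} | #|I| == p)
    \sum_(i in s @: I) mpolyX R (mnm1 i)).
  apply: eq_bigr => I _; rewrite rmorph_sum /= big_imset /=; last first.
    by move=> a b _ _; apply: perm_inj.
  apply: eq_bigr => i _; rewrite msymX; congr mpolyX.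
  apply/mnmP => j; rewrite mnmE !mnm1E.
  by rewrite -(inj_eq (@perm_inj _ s)) permKV.
rewrite [RHS](reindex_inj (h := fun I : {set 'I_n} => s @: I)) /=; last first.
  by apply: imset_inj; apply: perm_inj.
by apply: eq_bigl => I; rewrite card_imset //; apply: perm_inj.
Qed.

(* the fundamental theorem of symmetric polynomials makes the product of the
   p-fold eigenvalue sums a polynomial in the entries of the matrix *)
Lemma spectral_polynomial : exists Phi : ('I_n * 'I_n -> R) -> R,
  [/\ forall D, taylor2 D Phi,
      forall e e', char_poly (mx_of e) = char_poly (mx_of e') -> Phi e = Phi e' &
      forall e k, char_poly (mx_of e) = \prod_(i < n) ('X - (k i)%:P) ->
        Phi e = \prod_(I : {set 'I_n} | #|I| == p) ssum k I].
Proof.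
have [t [tE _]] := sym_fundamental ssum_mpoly_sym.
(* Vieta: this is the elementary symmetric function of degree [i + 1] of the roots. *)
pose v e := (fun i : 'I_n => (-1) ^+ i.+1 * (char_poly (mx_of e))`_(n - i.+1)).
exists (fun e => meval (v e) t); split.
- move=> D; apply: (@eq_taylor2 _ _ _ (fun e => \sum_(m <- msupp t)
     mcoeff m t * \prod_i v e i ^+ m i)).
    by move=> e; rewrite mevalE.
  apply: taylor2_sum => m _; apply: taylor2M; first exact: taylor2_cst.
  apply: taylor2_prod => i _; apply: taylor2X; apply: taylor2M.
    exact: taylor2_cst.
  exact: taylor2_char_poly.
- by move=> e e' ee'; rewrite /v ee'.
- move=> e k ke; rewrite -ssum_mpoly_eval -tE comp_mpoly_meval.
  apply: meval_eq => i; rewrite /v ke tnth_mktuple.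
  have := mroots_coeff [tuple k i | i < n] (lift ord0 i).
  rewrite big_tuple /= (eq_bigr (fun j => 'X - (k j)%:P)); last first.
    by move=> j _; rewrite tnth_mktuple.
  rewrite /bump /= add1n => ->; rewrite mulrA -exprD addnn -mul2n exprM sqrrN expr1n.
  rewrite expr1n mul1r; apply: meval_eq => j; by rewrite tnth_mktuple.
Qed.

End SpectralPolynomial.

Lemma char_poly_conj (F : fieldType) n (P A : 'M[F]_n) : P \in unitmx ->
  char_poly (P *m A *m invmx P) = char_poly A.
Proof.
move=> Pu; rewrite /char_poly.
have -> : char_poly_mx (P *m A *m invmx P) =
    map_mx polyC P *m char_poly_mx A *m map_mx polyC (invmx P).
  rewrite /char_poly_mx mulmxBr mulmxBl -!map_mxM; congr (_ - _).
  by rewrite mul_mx_scalar -scalemxAl -map_mxM mulmxV// map_mx1 scalemx1.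
by rewrite !det_mulmx mulrAC -det_mulmx -map_mxM mulmxV// map_mx1 det1 mul1r.
Qed.

Lemma ord_ltn_eqF n (i j : 'I_n) : (i < j)%N -> (i == j) = false.
Proof. by move=> ij; rewrite -(inj_eq val_inj) ltn_eqF. Qed.

(** * Second order coefficients of the spectral polynomial at a diagonal matrix *)

Section SecondVariation.
Variables (R : rcfType) (n p : nat) (k : 'I_n -> R).
Hypothesis kP : forall I : {set 'I_n}, #|I| = p -> 0 < ssum k I.

Local Notation T := ('I_n * 'I_n)%type.
Let D (x : T) := k x.1 *+ (x.1 == x.2).

Variables (Phi : (T -> R) -> R) (L : T -> R) (Q : T -> T -> R).
Hypothesis PhiLQ : expansion2 D Phi L Q.
Hypothesis Phi_char : forall e e',
  char_poly (mx_of e) = char_poly (mx_of e') -> Phi e = Phi e'.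
Hypothesis Phi_val : forall e k', char_poly (mx_of e) = \prod_(i < n) ('X - (k' i)%:P) ->
  Phi e = \prod_(I : {set 'I_n} | #|I| == p) ssum k' I.

Let Pr := \prod_(I : {set 'I_n} | #|I| == p) ssum k I.

Let line (e : T -> R) (s : R) (x : T) := D x + s * e x.

Let line_jet e : jet2 (fun s => Phi (line e s)) (Phi D) (lform L e) (qform Q e).
Proof.
have := @PhiLQ (line e) e (fun=> 0); rewrite [X in X + _](_ : _ = 0) ?add0r.
  apply=> x; apply: eq_jet2 (jet2_poly (D x) (e x) 0) => s.
  by rewrite /line mul0r addr0 mulrC.
by rewrite /lform big1// => x _; rewrite mulr0.
Qed.

Let conjf (J : 'I_n -> R) (e : T -> R) (x : T) := J x.1 * e x / J x.2.

(** Conjugation by a diagonal matrix fixes [D], so it maps lines through [D] to lines through [D]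
    without changing [Phi]; uniqueness of jets passes the invariance on to [L] and [Q]. *)
Lemma conj_inv (J : 'I_n -> R) e : (forall i, J i != 0) ->
  lform L (conjf J e) = lform L e /\ qform Q (conjf J e) = qform Q e.
Proof.
move=> J0; suff h s : Phi (line (conjf J e) s) = Phi (line e s).
  have := jet2_uniq (line_jet (conjf J e)) (eq_jet2 (fsym h) (line_jet e)).
  by case.
apply: Phi_char; pose P : 'M[R]_n := diag_mx (\row_i J i).
have PV : P *m diag_mx (\row_i (J i)^-1) = 1%:M.
  rewrite mulmx_diag; apply/matrixP => i j; rewrite !mxE.
  by rewrite divff.
have Pu : P \in unitmx by case/mulmx1_unit: PV.
rewrite -(char_poly_conj (mx_of (line e s)) Pu); congr char_poly.
have -> : invmx P = diag_mx (\row_i (J i)^-1).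
  by apply: (can_inj (mulKmx Pu)); rewrite PV mulmxV.
apply/matrixP => i j; rewrite mul_mx_diag mxE mul_diag_mx !mxE /line /conjf /D /=.
by case: eqP => [->|_]; rewrite ?mulr1n ?mulr0n; field; rewrite ?J0.
Qed.

Let J0 a (i : 'I_n) : (if i == a then 2 else 1) != 0 :> R.
Proof. by case: ifP => _; rewrite ?oner_eq0 ?pnatr_eq0. Qed.

(* Conjugating by a diagonal matrix with one entry 2 rescales the entries of [e]
   by [W]; invariance then kills every monomial that it rescales. *)
Let W a (x : T) : R := (if x.1 == a then 2 else 1) / (if x.2 == a then 2 else 1).

Let conjW a e : conjf (fun i => if i == a then 2 else 1) e =1 (fun x => W a x * e x).
Proof. by move=> x; rewrite /conjf /W mulrAC. Qed.

Let lform_inv a e : lform L (fun x => W a x * e x) = lform L e.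
Proof.
have [<- _] := conj_inv e (J0 a).
by apply: eq_bigr => x _; rewrite conjW.
Qed.

Let qform_inv a e : qform Q (fun x => W a x * e x) = qform Q e.
Proof.
have [_ <-] := conj_inv e (J0 a).
by apply: eq_bigr => x _; apply: eq_bigr => y _; rewrite !conjW.
Qed.

Let WE x : x.1 != x.2 -> W x.1 x = 2 /\ W x.2 x = 2^-1.
Proof.
move=> ne; have ne' : (x.2 == x.1) = false by rewrite eq_sym; exact: negPf.
by rewrite /W !eqxx (negPf ne) ne' divr1 div1r.
Qed.

Let L_off x : x.1 != x.2 -> L x = 0.
Proof.
move=> ne; have := lform_inv x.1 (fun y => (y == x)%:R).
have lE c : lform L (fun y => c y * (y == x)%:R) = L x * c x.
  rewrite /lform (bigD1 x)//= eqxx mulr1 big1 ?addr0// => y /negPf->.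
  by rewrite !mulr0.
rewrite lE; have := lE (fun=> 1); rewrite /lform.
under eq_bigr do rewrite mul1r.
move=> ->; rewrite (WE ne).1; lra.
Qed.

(** Only this symmetrization of [Q] is determined by the quadratic form. *)
Let bq x y := Q x y + Q y x.

Let qform1 x (c : R) : qform Q (fun z => c * (z == x)%:R) = Q x x * c ^+ 2.
Proof.
rewrite /qform (bigD1 x)//= [X in _ + X]big1 ?addr0; last first.
  by move=> y /negPf yx; rewrite big1// => z _; rewrite yx !(mulr0, mul0r).
rewrite (bigD1 x)//= eqxx big1 ?addr0; first by rewrite !mulr1.
by move=> y /negPf->; rewrite !mulr0.
Qed.

Let qform2 x y (c d : R) : x != y ->
  qform Q (fun z => c * (z == x)%:R + d * (z == y)%:R) =
  Q x x * c ^+ 2 + Q y y * d ^+ 2 + bq x y * (c * d).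
Proof.
move=> xy; have yx : y != x by rewrite eq_sym.
pose e z := c * (z == x)%:R + d * (z == y)%:R.
have inner a : \sum_z Q a z * (e a * e z) = e a * (Q a x * c + Q a y * d).
  rewrite (bigD1 x)//= (bigD1 y)//= big1 ?addr0; last first.
    by move=> z /andP[/negPf zx /negPf zy]; rewrite /e zx zy !mulr0 addr0 !mulr0.
  by rewrite /e !eqxx (negPf xy) (negPf yx) /=; ring.
rewrite /qform (eq_bigr _ (fun a _ => inner a)) (bigD1 x)//= (bigD1 y)//=.
rewrite [X in _ + (_ + X)]big1 ?addr0.
  by rewrite /e !eqxx (negPf xy) (negPf yx) /bq /=; ring.
by move=> z /andP[/negPf zx /negPf zy]; rewrite /e zx zy !mulr0 addr0 mul0r.
Qed.

Let eq_qform e e' : e =1 e' -> qform Q e = qform Q e'.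
Proof. by move=> h; apply: eq_bigr => x _; apply: eq_bigr => y _; rewrite !h. Qed.

Let bq_inv a x y : bq x y * (W a x * W a y) = bq x y.
Proof.
have one z : Q z z * (W a z) ^+ 2 = Q z z.
  transitivity (qform Q (fun u => 1 * (u == z)%:R)).
    rewrite -qform1 -[RHS](qform_inv a); apply: eq_qform => u.
    by rewrite mul1r; case: eqP => [->|_]; rewrite ?mulr0.
  by rewrite qform1 expr1n mulr1.
have [->|xy] := eqVneq x y; first by rewrite /bq -expr2 mulrDl one.
have := qform_inv a (fun u => 1 * (u == x)%:R + 1 * (u == y)%:R).
rewrite qform2// !expr1n !mulr1.
rewrite (@eq_qform _ (fun u => W a x * (u == x)%:R + W a y * (u == y)%:R)).
  by rewrite qform2// !one => /addrI.
move=> u; rewrite !mul1r mulrDr.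
by congr (_ + _); case: eqP => [->|_]; rewrite ?mulr0.
Qed.

(** For a nonzero coefficient the weights 2 and 1/2 of [x] at its two indices must be undone by
    those of [y], which forces [y] to be the transposed position. *)
Let bq0 x y : x.1 != x.2 -> y != (x.2, x.1) -> bq x y = 0.
Proof.
move=> ne yx; apply/eqP; apply: contraNT yx => b0.
have h a : W a x * W a y = 1 by apply: (mulfI b0); rewrite bq_inv mulr1.
have h1 (b1 b2 : bool) :
    2 * ((if b1 then 2 else 1) / (if b2 then 2 else 1)) = 1 :> R -> b2.
  by case: b1; case: b2 => //; rewrite ?divr1 ?div1r ?divff//; lra.
have h2 (b1 b2 : bool) :
    2^-1 * ((if b1 then 2 else 1) / (if b2 then 2 else 1)) = 1 :> R -> b1.
  by case: b1; case: b2 => //; rewrite ?divr1 ?div1r ?divff//; lra.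
have := h x.1; have := h x.2; rewrite (WE ne).1 (WE ne).2 /W.
by move=> /h2/eqP <- /h1/eqP <-; rewrite -surjective_pairing.
Qed.

Let dg (eps : 'I_n -> R) (x : T) := eps x.1 *+ (x.1 == x.2).

Let ssum_neq0 (I : {set 'I_n}) : #|I| == p -> ssum k I != 0.
Proof. by move=> pI; apply/lt0r_neq0; exact: (ssum_gt0 kP pI). Qed.

Let Phi_diag eps s : Phi (line (dg eps) s) =
  \prod_(I : {set 'I_n} | #|I| == p) (ssum k I + s * ssum eps I).
Proof.
rewrite (@Phi_val _ (fun i => k i + s * eps i)).
  by apply: eq_bigr => I _; rewrite /ssum big_split mulr_sumr.
rewrite char_poly_trig; last first.
  apply/is_trig_mxP => i j ij; rewrite !mxE /line /D /dg /=.
  by rewrite (ord_ltn_eqF ij) !mulr0n mulr0 addr0.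
by apply: eq_bigr => i _; rewrite !mxE /line /D /dg /= eqxx.
Qed.

Let jet_diag eps :
  let S := \sum_(I : {set 'I_n} | #|I| == p) ssum eps I / ssum k I in
  let S2 := \sum_(I : {set 'I_n} | #|I| == p) (ssum eps I / ssum k I) ^+ 2 in
  [/\ Phi D = Pr, lform L (dg eps) = Pr * S &
      qform Q (dg eps) = Pr * (S ^+ 2 - S2) / 2].
Proof.
apply: (jet2_uniq (line_jet (dg eps))).
have := @jet2_prod_lin R {set 'I_n} (index_enum _)
  (fun I => #|I| == p) (ssum k) (ssum eps) ssum_neq0.
by apply: eq_jet2 => s; rewrite Phi_diag.
Qed.

Let eij (i j : 'I_n) (x : T) : R := 1 * (x == (i, j))%:R + 1 * (x == (j, i))%:R.

(* conjugating by the elementary matrix [1 + c e_ij] makes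
   [diag k + s (e_ij + e_ji)] triangular, with diagonal entries
   [k_i + d] and [k_j - d] *)
Let char_pair (i j : 'I_n) (s d : R) : (i < j)%N -> s ^+ 2 + d * (k j - k i) - d ^+ 2 = 0 ->
  (s = 0 -> d = 0) ->
  char_poly (mx_of (line (eij i j) s)) =
  \prod_(l < n) ('X - (k l + (if l == i then d else if l == j then - d else 0))%:P).
Proof.
move=> ij dE s0d.
have ne := ord_ltn_eqF ij.
have ne' : (j == i) = false by rewrite eq_sym.
(* For [s = 0] this is 0 by the convention on division; the premise [s = 0 -> d = 0] keeps the two
   relations below valid. *)
pose c := d / s.
have cs : c * s = d.
  have [s0|s0] := eqVneq s 0; first by rewrite /c s0 s0d// !mul0r.
  by rewrite /c mulfVK.
have cE : s + c * k j - c * (k i + c * s) = 0.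
  have [s0|s0] := eqVneq s 0; first by rewrite /c s0 s0d//; ring.
  apply: (mulfI s0); rewrite mulr0 -dE -cs; ring.
pose P : 'M[R]_n := 1%:M + c *: delta_mx i j.
pose P' : 'M[R]_n := 1%:M - c *: delta_mx i j.
have dd : delta_mx i j *m delta_mx i j = 0 :> 'M[R]_n.
  by rewrite mul_delta_mx_0// eq_sym ne.
have PP' : P *m P' = 1%:M.
  rewrite /P /P' mulmxDl mul1mx mulmxBr mulmx1 -scalemxAl -scalemxAr dd !scaler0 subr0.
  by rewrite subrK.
have Pu : P \in unitmx by case/mulmx1_unit: PP'.
rewrite -(char_poly_conj _ Pu).
have -> : invmx P = P' by apply: (can_inj (mulKmx Pu)); rewrite PP' mulmxV.
set M := mx_of _.
have PME a b : (P *m M *m P') a b =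
    M a b + c * (a == i)%:R * M j b - c * (b == j)%:R * (M a i + c * (a == i)%:R * M j i).
  have PM a' b' : (P *m M) a' b' = M a' b' + c * (a' == i)%:R * M j b'.
    rewrite mulmxDl mul1mx -scalemxAl mxE; congr (_ + _); rewrite mxE -mulrA; congr (_ * _).
    rewrite mxE (bigD1 j)//= mxE eqxx andbT big1 ?addr0// => l /negPf lj.
    by rewrite mxE lj andbF mul0r.
  rewrite mulmxBr mulmx1 -scalemxAr mxE PM; congr (_ + _); rewrite mxE [in LHS]mxE.
  congr (- _); rewrite -mulrA; congr (_ * _).
  rewrite mxE (bigD1 i)//= PM [delta_mx i j i b]mxE eqxx big1 ?addr0 1?mulrC// => l /negPf li.
  by rewrite [X in _ * X]mxE li mulr0.
have ME a b : M a b = k a *+ (a == b) + s * (((a == i) && (b == j))%:R +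
    ((a == j) && (b == i))%:R).
  by rewrite !mxE /line /D /eij /= !mul1r !xpair_eqE.
rewrite char_poly_trig; last first.
  apply/is_trig_mxP => a b ab; rewrite PME !ME.
  have abF := ord_ltn_eqF ab.
  rewrite !eqxx ne ne' abF mulr0n add0r !andbF !andbT.
  have [ai|ai] := eqVneq a i; have [bj|bj] := eqVneq b j.
  - by rewrite ai bj ne ne' /= ?mulr1n ?mulr0n -[RHS]cE; ring.
  - rewrite (_ : (b == i) = false); last by rewrite -ai eq_sym.
    by rewrite ai ne /= ?mulr1n ?mulr0n; ring.
  - by rewrite (_ : (a == j) = false) -?bj//= ?mulr1n ?mulr0n; ring.
  rewrite /= ?mulr1n ?mulr0n; have [aj|aj] := eqVneq a j; last by rewrite /=; ring.
  rewrite (_ : (b == i) = false) /=; first by ring.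
  by apply/negbTE; apply: contraTneq ab => ->; rewrite -leqNgt aj ltnW.
apply: eq_bigr => l _; congr ('X - _%:P); rewrite PME !ME !eqxx ne ne' !andbF !andbT.
have [li|li] := eqVneq l i.
  by rewrite li ?eqxx ?ne ?ne' /= ?mulr0n ?mulr1n -cs; ring.
have [lj|lj] := eqVneq l j.
  by rewrite lj ?ne ?ne' ?eqxx /= ?mulr1n ?mulr0n -cs; ring.
by rewrite /= ?mulr1n ?mulr0n; ring.
Qed.

(** Sums over sets containing both or neither of [i], [j] do not move. The other sets pair up under
    the swap, and the product of a pair, [(ssum k I + d) * (ssum k I - k i + k j - d)], equals
    [mu I - s ^+ 2]: the square root in [d] disappears and the jet can be read off. *)
Let bq_pair_lt (i j : 'I_n) : (i < j)%N -> bq (i, j) (j, i) = - (Pr * dlog2 p k i j).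
Proof.
move=> ij; have ne : i != j by rewrite ord_ltn_eqF.
pose bad (I : {set 'I_n}) := (i \in I) != (j \in I).
pose C := \prod_(I : {set 'I_n} | (#|I| == p) && ~~ bad I) ssum k I.
pose mu (I : {set 'I_n}) := ssum k I * (ssum k I - k i + k j).
pose good (I : {set 'I_n}) := (#|I| == p) && ((i \in I) && (j \notin I)).
have mu0 I : good I -> mu I != 0.
  move=> /and3P[pI iI jI]; rewrite mulf_neq0 ?ssum_neq0// lt0r_neq0//.
  exact: (ssum_swap_gt0 kP pI iI jI).
have split (F : {set 'I_n} -> R) : \prod_(I : {set 'I_n} | #|I| == p) F I =
    \prod_(I : {set 'I_n} | (#|I| == p) && ~~ bad I) F I *
    \prod_(I | good I) (F I * F (tperm i j @: I)).
  rewrite (bigID bad) /= mulrC; congr (_ * _).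
  rewrite (bigID (fun I : {set 'I_n} => i \in I)) /= big_split /=; congr (_ * _).
    by apply: eq_bigl => I; rewrite /good /bad -andbA;
       case: (i \in I); case: (j \in I).
  rewrite (reindex_inj (can_inj (@swK n i j))) /=; apply: eq_bigl => I.
  rewrite /good /bad card_sw !mem_sw tpermL tpermR.
  by case: (i \in I); case: (j \in I); rewrite ?andbT ?andbF.
have swE x I : good I -> ssum x (tperm i j @: I) = ssum x I - x i + x j.
  by move=> /and3P[_ iI jI]; exact: ssum_sw.
have val s : Phi (line (eij i j) s) = C * \prod_(I | good I) (mu I - s ^+ 2).
  pose b := k j - k i; pose d := (b + Num.sqrt (b ^+ 2 + 4 * s ^+ 2)) / 2.
  (* At [s = 0] the root [d] equals [k j - k i] when this is positive, hence the reset to 0 that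
     [char_pair] demands. *)
  pose d1 := if s == 0 then 0 else d.
  have b4 : 0 <= b ^+ 2 + 4 * s ^+ 2 by rewrite addr_ge0 ?sqr_ge0// mulr_ge0// sqr_ge0.
  have dE : s ^+ 2 + d1 * (k j - k i) - d1 ^+ 2 = 0.
    rewrite /d1; case: eqP => [->|_]; first by ring.
    rewrite -/b /d; have := sqr_sqrtr b4; set q := Num.sqrt _ => qE.
    have -> : s ^+ 2 = (q ^+ 2 - b ^+ 2) / 4 by rewrite qE; field.
    by field.
  have d0 : s = 0 -> d1 = 0 by rewrite /d1 => ->; rewrite eqxx.
  pose k' l := k l + (if l == i then d1 else if l == j then - d1 else 0).
  rewrite (@Phi_val _ k' (char_pair ij dE d0)).
  have kI (I : {set 'I_n}) : ssum k' I = ssum k I + (i \in I)%:R * d1 - (j \in I)%:R * d1.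
    rewrite /ssum big_split /= -addrA; congr (_ + _).
    transitivity (\sum_(l in I) ((l == i)%:R * d1 - (l == j)%:R * d1)).
      apply: eq_bigr => l _; case: eqP => [->|_]; first by rewrite (negPf ne) mul1r mul0r subr0.
      by case: eqP; rewrite ?mul1r ?mul0r ?sub0r ?oppr0.
    have one (m : 'I_n) : \sum_(l in I) (l == m)%:R = (m \in I)%:R :> R.
      have [mI|mI] := boolP (m \in I).
        by rewrite (bigD1 m)//= eqxx big1 ?addr0// => l /andP[_ /negPf->].
      by rewrite big1// => l lI; case: eqP => // lm; rewrite -lm lI in mI.
    by rewrite sumrB -!mulr_suml !one.
  rewrite split; congr (_ * _).
    apply: eq_bigr => I /andP[_]; rewrite negbK => /eqP bI.
    by rewrite kI bI addrK.
  apply: eq_bigr => I gI; have /and3P[_ iI jI] := gI.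
  rewrite swE// !kI iI (negPf jI) /k' !eqxx (eq_sym j) (negPf ne) /= /mu.
  have -> : s ^+ 2 = d1 ^+ 2 - d1 * (k j - k i) by lra.
  by ring.
have := jet2_uniq (line_jet (eij i j)) (eq_jet2 (fsym val)
  (jet2Z C (jet2_prod_sqr (index_enum _) mu0))).
move=> [PhiD _]; rewrite /eij qform2 ?xpair_eqE ?negb_and ?ne//.
have Q0 : Q (i, j) (i, j) = 0 /\ Q (j, i) (j, i) = 0.
  have := @bq0 (i, j) (i, j) ne; have := @bq0 (j, i) (j, i); rewrite /= eq_sym ne.
  rewrite !xpair_eqE (negPf ne) [j == i]eq_sym (negPf ne) /= /bq.
  by move=> /(_ isT isT) h1 /(_ isT) h2; split; lra.
rewrite Q0.1 Q0.2 !mul0r !add0r !mulr1 => ->; rewrite mulrN mulrA; congr (- (_ * _)).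
  by rewrite /Pr split; congr (_ * _); apply: eq_bigr => I gI; rewrite swE.
Qed.

Let bq_pair i j : i != j -> bq (i, j) (j, i) = - (Pr * dlog2 p k i j).
Proof.
move=> ne; have [ij|ji|ij] := ltngtP i j; first exact: bq_pair_lt.
  by rewrite /bq addrC -/(bq _ _) bq_pair_lt// dlog2C.
by move: ne; rewrite (val_inj ij) eqxx.
Qed.

Let lformE e : lform L e = Pr * \sum_i dlog p k i * e (i, i).
Proof.
have [_ + _] := jet_diag (fun i => e (i, i)); rewrite /= -sum_dlog => <-.
apply: eq_bigr => x _; rewrite /dg; have [xx|xx] := eqVneq x.1 x.2.
  by rewrite mulr1n {2}xx -surjective_pairing.
by rewrite L_off// !mul0r.
Qed.

(** By [bq0] diagonal entries interact only among themselves and an off-diagonal entry only with its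
    transpose, so the form splits. *)
Let qformE e : qform Q e = qform Q (dg (fun i => e (i, i))) -
  Pr / 2 * \sum_i \sum_(j | j != i) dlog2 p k i j * (e (i, j) * e (j, i)).
Proof.
pose qb e := \sum_x \sum_y bq x y * (e x * e y).
have qbE f : qb f = 2 * qform Q f.
  have -> : 2 * qform Q f = qform Q f + \sum_y \sum_x Q x y * (f x * f y).
    by rewrite exchange_big /= -/(qform Q f); ring.
  rewrite /qb /qform -big_split /=; apply: eq_bigr => x _.
  by rewrite -big_split /=; apply: eq_bigr => y _; rewrite /bq; ring.
have pairE (F : T -> R) : \sum_x F x = \sum_i F (i, i) + \sum_i \sum_(j | j != i) F (i, j).
  rewrite (eq_bigr (fun x => F (x.1, x.2))) => [|x _]; last by rewrite -surjective_pairing.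
  rewrite -(pair_bigA _ (fun i j => F (i, j))) /= -big_split /=.
  by apply: eq_bigr => i _; rewrite (bigD1 i).
have main f : qb f = \sum_i \sum_y bq (i, i) y * (f (i, i) * f y) -
    Pr * \sum_i \sum_(j | j != i) dlog2 p k i j * (f (i, j) * f (j, i)).
  rewrite /qb pairE; congr (_ + _); rewrite mulr_sumr -sumrN; apply: eq_bigr => i _.
  rewrite mulr_sumr -sumrN; apply: eq_bigr => j ji.
  rewrite (bigD1 (j, i))//= bq_pair 1?eq_sym// big1 ?addr0; first by ring.
  by move=> y yji; rewrite bq0 ?mul0r//= eq_sym.
have := main e; have := main (dg (fun i => e (i, i))); rewrite !qbE.
rewrite [X in _ - Pr * X]big1 ?mulr0 ?subr0; last first.
  move=> i _; rewrite big1// => j ji; rewrite /dg /= eq_sym (negPf ji) mulr0n.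
  by rewrite mul0r mulr0.
have -> : \sum_i \sum_y bq (i, i) y * (dg (fun i => e (i, i)) (i, i) * dg (fun i => e (i, i)) y) =
  \sum_i \sum_y bq (i, i) y * (e (i, i) * e y).
  apply: eq_bigr => i _; apply: eq_bigr => y _; rewrite {1}/dg /= eqxx mulr1n /dg.
  have [yy|yy] := eqVneq y.1 y.2; first by rewrite mulr1n {2}yy -surjective_pairing.
  by rewrite /bq addrC -/(bq _ _) bq0 ?mul0r//; apply: contraNneq yy => -[-> ->].
lra.
Qed.

(** Near 0 [Phi] is constant along the curve, so both coefficients of its jet vanish; the first
    identity then removes the squared trace term from the second. *)
Lemma second_variation_subproof (B : R -> 'M[R]_n) (B1 B2 : 'M[R]_n) (d : R) :
  (forall i j, jet2 (fun s => B s i j) (k i *+ (i == j)) (B1 i j) (B2 i j)) ->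
  0 < d -> (forall s, `|s| < d -> exists2 k' : 'I_n -> R,
    char_poly (B s) = \prod_(i < n) ('X - (k' i)%:P) &
    \prod_(I : {set 'I_n} | #|I| == p) ssum k' I = Pr) ->
  \sum_i dlog p k i * B1 i i = 0 /\
  \sum_i dlog p k i * (2 * B2 i i) =
  \sum_(I : {set 'I_n} | #|I| == p) (ssum (fun i => B1 i i) I / ssum k I) ^+ 2 +
  \sum_i \sum_(j | j != i) dlog2 p k i j * (B1 i j * B1 j i).
Proof.
move=> jB d0 hB.
pose E s (x : T) := B s x.1 x.2.
have jE : jet2 (fun s => Phi (E s)) (Phi D) (lform L (fun x => B1 x.1 x.2))
   (lform L (fun x => B2 x.1 x.2) + qform Q (fun x => B1 x.1 x.2)).
  by apply: PhiLQ => x; exact: jB.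
have EB s : mx_of (E s) = B s by apply/matrixP => i j; rewrite mxE.
have Pr0 : 0 < Pr by apply: prodr_gt0 => I; exact: (ssum_gt0 kP).
have [_ l1 l2] := jet2_uniq jE (jet2_ext d0 (fun s sd => esym (let: ex_intro2 k' h h' :=
   hB s sd in etrans (Phi_val (etrans (congr1 _ (EB s)) h)) h')) (jet2_cst Pr)).
move: l1 l2; rewrite qformE !lformE /=.
have [_ _ ->] := jet_diag (fun i => B1 i i).
move=> /eqP; rewrite mulf_eq0 gt_eqF//= => /eqP l1; rewrite l1.
rewrite -sum_dlog l1 expr0n /= sub0r => l2; split=> //.
apply: (mulfI (lt0r_neq0 Pr0)).
have -> : \sum_i dlog p k i * (2 * B2 i i) = 2 * \sum_i dlog p k i * B2 i i.
  by rewrite mulr_sumr; apply: eq_bigr => i _; ring.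
lra.
Qed.

End SecondVariation.

(** The products [B1 i j * B1 j i] are not written as squares because in a frame fixed along a line
    the shape operator is symmetric only at the base point. *)
Lemma second_variation (R : rcfType) n p (k : 'I_n -> R)
    (B : R -> 'M[R]_n) (B1 B2 : 'M[R]_n) (d : R) :
  (forall I : {set 'I_n}, #|I| = p -> 0 < ssum k I) ->
  (forall i j, jet2 (fun s => B s i j) (k i *+ (i == j)) (B1 i j) (B2 i j)) ->
  0 < d -> (forall s, `|s| < d -> exists2 k' : 'I_n -> R,
    char_poly (B s) = \prod_(i < n) ('X - (k' i)%:P) &
    \prod_(I : {set 'I_n} | #|I| == p) ssum k' I =
    \prod_(I : {set 'I_n} | #|I| == p) ssum k I) ->
  \sum_i dlog p k i * B1 i i = 0 /\
  \sum_i dlog p k i * (2 * B2 i i) =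
  \sum_(I : {set 'I_n} | #|I| == p) (ssum (fun i => B1 i i) I / ssum k I) ^+ 2 +
  \sum_i \sum_(j | j != i) dlog2 p k i j * (B1 i j * B1 j i).
Proof.
move=> kP; have [Phi [tP Phi_char Phi_val]] := spectral_polynomial R n p.
have [L [Q PhiLQ]] := tP (fun x => k x.1 *+ (x.1 == x.2)).
exact: (second_variation_subproof kP PhiLQ Phi_char Phi_val).
Qed.

(** * Derivatives in the adapted frame *)

Lemma sum_delta (R : pzRingType) (I : finType) (d : I) (F : I -> R) :
  \sum_m (m == d)%:R * F m = F d.
Proof.
rewrite (bigD1 d)//= eqxx mul1r big1 ?addr0// => m /negPf->.
by rewrite mul0r.
Qed.

Section FrameDerivatives.
Variables (R : realFieldType) (n : nat) (k t : 'I_n -> R) (nu : R).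
Variables (U3 : 'I_n -> 'I_n -> 'I_n -> R) (U4 : 'I_n -> 'I_n -> R).
Implicit Types (i j d m : 'I_n).
Hypothesis nu0 : nu != 0.
Hypothesis U3C : forall i j m, U3 i j m = U3 j i m.
Hypothesis U3R : forall i j m, U3 i j m = U3 i m j.
Hypothesis U4C : forall i j, U4 i j = U4 j i.
Hypothesis t2 : \sum_i t i ^+ 2 = 1 - nu ^+ 2.

(* Derivatives (first and second, in the direction [d]) in a frame orthonormal for
   the induced metric and diagonalizing the shape operator: [g] is the metric, [V]
   the matrix of [D^2 ((|x|^2 + u^2) / 2)], [B = nu g^-1 V] the shape operator; the
   second derivatives are recorded on the diagonal only. [t] and [U3], [U4] are the
   frame components of the derivatives of [u] at the point, divided by [u]. *)
Definition hcoef i := (k i - nu) / nu.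

Definition dg1 d i j := hcoef d * ((i == d)%:R * t j + (j == d)%:R * t i).
Definition dV1 d i j := dg1 d i j + t d * hcoef i * (i == j)%:R + U3 i j d.
Definition dnu1 d := - (nu * t d * hcoef d).
Definition dB1 d i j :=
  dnu1 d * (k i / nu) * (i == j)%:R + nu * dV1 d i j - dg1 d i j * k j.
Definition dnu2 d := 2 * nu * t d ^+ 2 * hcoef d ^+ 2 -
  nu * (\sum_m t m * U3 m d d) - nu ^+ 3 * hcoef d ^+ 2.
Definition dg2 d i := 2 * U3 i d d * t i + 2 * hcoef d ^+ 2 * (i == d)%:R.
Definition dV2 d i := dg2 d i + hcoef d * hcoef i + 2 * t d * U3 i i d + U4 i d.
Definition dB2 d i := dnu2 d * (k i / nu) + 2 * dnu1 d * dV1 d i i + nu * dV2 d i -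
  2 * (hcoef d * (i == d)%:R * (\sum_m t m * dB1 d m i) + t i * hcoef d * dB1 d d i)
  - dg2 d i * k i.

Lemma dnu1E d : dnu1 d = t d * (nu - k d).
Proof. by rewrite /dnu1 /hcoef; field. Qed.

Lemma dB1_diag m i : dB1 m i i =
  t m * (nu - k m) * (k i / nu) + t m * (k i - nu) + nu * U3 m i i +
  (m == i)%:R * (2 * t i * (k i - nu) * (nu - k i) / nu).
Proof.
rewrite /dB1 /dV1 dnu1E /dg1 /hcoef eqxx (U3R i) (U3C i) (eq_sym m).
by case: eqP => [->|_] /=; field.
Qed.

Lemma dnu2E d : dnu2 d =
  - (\sum_m t m * dB1 m d d) - (\sum_m t m ^+ 2 * k d * (k m - k d)) / nu
  - (nu - k d) ^+ 2 / nu.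
Proof.
have E (m : 'I_n) : t m * dB1 m d d + t m ^+ 2 * k d * (k m - k d) / nu =
   (nu * (t m * U3 m d d) + t m ^+ 2 * (2 * k d - nu - k d ^+ 2 / nu)) +
   (m == d)%:R * (t d * (2 * t d * (k d - nu) * (nu - k d) / nu)).
  by rewrite dB1_diag; case: eqP => [->|_] /=; field.
have -> : - (\sum_m t m * dB1 m d d) - (\sum_m t m ^+ 2 * k d * (k m - k d)) / nu =
   - \sum_m (t m * dB1 m d d + t m ^+ 2 * k d * (k m - k d) / nu).
  by rewrite big_split /= -mulr_suml opprD.
rewrite (eq_bigr _ (fun m _ => E m)) !big_split /= sum_delta -mulr_sumr -mulr_suml t2.
by rewrite /dnu2 /hcoef; field.
Qed.

(** Codazzi equation in the fixed frame: the third derivatives of [u] cancel by symmetry, and the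
    correction measures how the metric leaves the identity along the line. *)
Lemma dB1_rowdiff i j : i != j ->
  dB1 j i j = dB1 i j j + t i * k j / nu * (k i - k j).
Proof.
move=> /negPf ij; rewrite dB1_diag /dB1 /dV1 /dg1 ij eqxx /hcoef /=.
by rewrite ?(eq_sym j i) ?ij /=; field.
Qed.

Lemma dB1_coldiff i j : i != j ->
  dB1 j j i = dB1 i j j + t i * (k i - k j).
Proof.
move=> /negPf ij; rewrite dB1_diag /dB1 /dV1 /dg1 (eq_sym j i) ij eqxx /hcoef /=.
by rewrite (U3C j i j); field.
Qed.

Lemma dB1_sym i j d : i != j -> i != d -> j != d -> dB1 d i j = dB1 d j i.
Proof.
move=> /negPf ij /negPf id /negPf jd.
rewrite /dB1 /dV1 /dg1 (eq_sym j i) ij id jd (U3C i j d) /=; ring.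
Qed.

(** Simons-type identity. The fourth derivatives cancel by [U4C], and the third ones are absorbed
    into the first derivatives of the shape operator and into [dnu2]. *)
Lemma dB2_comm i j : i != j -> dB2 j i - dB2 i j =
  (k i * dnu2 j - k j * dnu2 i) / nu
  + 2 / nu * (t j * k i * dB1 j i i - t i * k j * dB1 i j j)
  + 2 / nu ^+ 2 * (t i ^+ 2 * ((nu - k i) * k j ^+ 2 - k i * k j * (nu - k j))
                   - t j ^+ 2 * ((nu - k j) * k i ^+ 2 - k i * k j * (nu - k i))).
Proof.
move=> ij; have ji : j != i by rewrite eq_sym.
rewrite /dB2 (dB1_coldiff ij) (dB1_coldiff ji) !dB1_diag /dV1 /dV2 /dg1 /dg2 !dnu1E.
rewrite /hcoef !eqxx (negPf ij) (negPf ji) /= (U4C j i).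
rewrite (U3R i i j) (U3C i j i) (U3R j j i) (U3C j i j).
by field.
Qed.

End FrameDerivatives.

(** * Identification of the derivatives along a line of the frame *)

Section FrameJets.
Variables (R : realFieldType) (n : nat) (k t : 'I_n -> R) (nu : R).
Variables (U3 : 'I_n -> 'I_n -> 'I_n -> R) (U4 : 'I_n -> 'I_n -> R).
Hypothesis nu0 : nu != 0.
Hypothesis t2 : \sum_i t i ^+ 2 = 1 - nu ^+ 2.

(** Along the line in direction [d]: height, vertical normal component, gradient, Hessian and shape
    operator in frame components, the height, gradient and Hessian being divided by the height at
    the base point. The metric is the constant [G] plus the outer square of [q]. *)
Variables (d : 'I_n) (U V : R -> R) (q : 'I_n -> R -> R) (C B : 'I_n -> 'I_n -> R -> R).
Variables (X b1 b2 : 'I_n -> 'I_n -> R) (n1 n2 : R) (G : 'I_n -> 'I_n -> R).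

Local Notation hc := (hcoef k nu).

Hypothesis jU : jet2 U 1 (t d) (hc d / 2).
Hypothesis jq : forall i, jet2 (q i) (t i) (hc d * (i == d)%:R) (U3 i d d / 2).
Hypothesis jC : forall i j,
  jet2 (C i j) (hc i * (i == j)%:R) (U3 i j d) (X i j / 2).
Hypothesis XE : forall i, X i i = U4 i d.
Hypothesis GE : forall i j, G i j + t i * t j = (i == j)%:R.
Hypothesis jV : jet2 V nu n1 n2.
Hypothesis jB : forall i j, jet2 (B i j) (k i * (i == j)%:R) (b1 i j) (b2 i j).
(** This is [nu^2 * w^2 = 1]. The frame is orthonormal for the graph metric and not for the
    Euclidean one, so the Euclidean square norm of the gradient exceeds that of [q] by the last
    summand. *)
Hypothesis VE : forall s,
  V s ^+ 2 * (1 + \sum_i q i s ^+ 2 + (\sum_i t i * q i s) ^+ 2 / nu ^+ 2) = 1.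
Hypothesis BE : forall i j s, \sum_m (G i m + q i s * q m s) * B m j s =
  V s * (G i j + q i s * q j s + U s * C i j s).

Lemma frame_nu : n1 = dnu1 k t nu d /\ 2 * n2 = dnu2 k t nu U3 d.
Proof.
have jq2 : jet2 (fun s => \sum_i q i s ^+ 2) (1 - nu ^+ 2) (2 * t d * hc d)
    ((\sum_m t m * U3 m d d) + hc d ^+ 2).
  have := jet2_sum (index_enum _) (P := xpredT) (fun i _ => jet2M (jq i) (jq i)).
  have -> : \sum_i t i * t i = 1 - nu ^+ 2.
    by rewrite -t2; apply: eq_bigr => i _; rewrite expr2.
  have -> : \sum_i (t i * (hc d * (i == d)%:R) + hc d * (i == d)%:R * t i) =
      2 * t d * hc d.
    rewrite -[RHS](sum_delta d (fun i => 2 * t i * hc d)); apply: eq_bigr => i _; ring.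
  have -> : \sum_i (t i * (U3 i d d / 2) + hc d * (i == d)%:R * (hc d * (i == d)%:R) +
      U3 i d d / 2 * t i) = (\sum_m t m * U3 m d d) + hc d ^+ 2.
    rewrite -[X in _ = _ + X](sum_delta d (fun i => hc d ^+ 2)) -big_split.
    by apply: eq_bigr => i _ /=; case: (i == d) => /=; field.
  by apply: eq_jet2 => s; apply: eq_bigr => i _; rewrite expr2.
have jtq : jet2 (fun s => \sum_i t i * q i s) (1 - nu ^+ 2) (t d * hc d)
    ((\sum_m t m * U3 m d d) / 2).
  have := jet2_sum (index_enum _) (P := xpredT) (fun i _ => jet2Z (t i) (jq i)).
  have -> : \sum_i t i * t i = 1 - nu ^+ 2.
    by rewrite -t2; apply: eq_bigr => i _; rewrite expr2.
  have -> : \sum_i t i * (hc d * (i == d)%:R) = t d * hc d.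
    rewrite -[RHS](sum_delta d (fun i => t i * hc d)); apply: eq_bigr => i _; ring.
  rewrite mulr_suml; congr (jet2 _ _ _ _); apply: eq_bigr => i _; ring.
set A := \sum_m t m * U3 m d d in jq2 jtq *.
have jVV := jet2M jV jV.
have jtq2 := jet2Z (nu ^+ 2)^-1 (jet2M jtq jtq).
have jW := jet2D (jet2D (jet2_cst 1) jq2) jtq2.
have W1 s : V s * V s * (1 + \sum_i q i s ^+ 2 +
    (nu ^+ 2)^-1 * ((\sum_i t i * q i s) * (\sum_i t i * q i s))) = 1.
  by rewrite -[RHS](VE s); field.
have [_ e1 e2] := jet2_uniq (eq_jet2 W1 (jet2M jVV jW)) (jet2_cst 1).
have n1E : n1 = dnu1 k t nu d.
  have : nu * n1 * 2 / nu ^+ 2 + 2 * t d * hc d = 0.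
    by rewrite -[RHS]e1; field.
  rewrite /dnu1 => h; apply: (mulfI (_ : 2 / nu != 0)); first by rewrite mulf_neq0 ?invr_eq0 ?pnatr_eq0.
  apply/eqP; rewrite -subr_eq0; apply/eqP; rewrite -[RHS]h; field; exact: nu0.
split=> //; rewrite n1E /dnu1 in e2.
rewrite /dnu2 -/A; apply: (mulfI (invr_neq0 nu0)); apply/eqP; rewrite -subr_eq0.
apply/eqP; rewrite -[RHS]e2; field; exact: nu0.
Qed.

(** [BE] says [g B = V (g + U C)]. Comparing the jets of its two sides gives the derivatives of [B]
    without expanding the inverse of the metric. *)
Lemma frame_B i j : b1 i j = dB1 k t nu U3 d i j /\
  2 * b2 i i = dB2 k t nu U3 U4 d i.
Proof.
have [n1E n2E] := frame_nu.
have jg a m := jet2D (jet2_cst (G a m)) (jet2M (jq a) (jq m)).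
have jL a c := jet2_sum (index_enum _) (P := xpredT)
  (fun m _ => jet2M (jg a m) (jB m c)).
have jR a c := jet2M jV (jet2D (jg a c) (jet2M jU (jC a c))).
have uq a c := jet2_uniq (jL a c) (eq_jet2 (fun s => esym (BE a c s)) (jR a c)).
have first a c : b1 a c = dB1 k t nu U3 d a c.
  have [_ + _] := uq a c; rewrite GE.
  have -> : \sum_i0 ((G a i0 + t a * t i0) * b1 i0 c +
     (0 + (t a * (hc d * (i0 == d)%:R) + hc d * (a == d)%:R * t i0)) *
     (k i0 * (i0 == c)%:R)) = b1 a c + dg1 k t nu d a c * k c.
    rewrite -[X in _ = X + _](sum_delta a (b1 ^~ c)).
    rewrite -[X in _ = _ + X](sum_delta c (fun m => dg1 k t nu d a m * k m)) -big_split.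
    by apply: eq_bigr => m _ /=; rewrite GE (eq_sym m a) /dg1; ring.
  rewrite /dB1 -n1E /dV1 /dg1 => h.
  apply: (addIr (dg1 k t nu d a c * k c)); rewrite h /dg1.
  by case: (a =P c) => [->|_] /=; rewrite /hcoef; field.
split=> //; have [_ _] := uq i i; rewrite GE eqxx.
have -> : \sum_i0 ((G i i0 + t i * t i0) * b2 i0 i +
     (0 + (t i * (hc d * (i0 == d)%:R) + hc d * (i == d)%:R * t i0)) * b1 i0 i +
     (0 + (t i * (U3 i0 d d / 2) + hc d * (i == d)%:R * (hc d * (i0 == d)%:R) +
           U3 i d d / 2 * t i0)) * (k i0 * (i0 == i)%:R)) =
   b2 i i + (hc d * (i == d)%:R * (\sum_m t m * dB1 k t nu U3 d m i) +
     t i * hc d * dB1 k t nu U3 d d i) + dg2 k t nu U3 d i * k i / 2.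
  rewrite -[X in _ = X + _ + _](sum_delta i (b2 ^~ i)).
  rewrite -[X in _ = _ + (_ + X) + _](sum_delta d (fun m => t i * hc d * dB1 k t nu U3 d m i)).
  rewrite -[X in _ = _ + X](sum_delta i (fun m => dg2 k t nu U3 d m * k m / 2)).
  rewrite mulr_sumr -!big_split; apply: eq_bigr => m _ /=; rewrite GE first (eq_sym m i).
  case: (i =P m) => [->|_] /=; rewrite /dg2; last by ring.
  by case: (m == d) => /=; field.
rewrite XE => h.
have {}h := canRL (addrK _) h.
have {}h := canRL (addrK _) h.
rewrite h /dB2 -n1E -n2E /dV2 /dg2 /dV1 /dg1 eqxx /hcoef /=.
by case: (i == d) => /=; field.
Qed.

End FrameJets.

(** * Existence of jets for powers, inverses and square roots *)

Section HasJet.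
Variable R : realFieldType.
Implicit Types f g : R -> R.

Lemma jet2X f a b c m : a != 0 -> jet2 f a b c ->
  jet2 (fun s => f s ^+ m) (a ^+ m) (a ^+ m * (m%:R * (b / a)))
    (a ^+ m * (m%:R * (c / a) + m%:R * (m%:R - 1) / 2 * (b / a) ^+ 2)).
Proof.
move=> a0 jf; elim: m => [|m IH].
  by rewrite !mul0r !addr0 !mulr0; exact: jet2_cst.
have m1 : (m.+1)%:R = m%:R + 1 :> R by rewrite natr1.
apply: (@eq_jet2 _ (fun s => f s * f s ^+ m)) => [s|]; first by rewrite exprS.
have := jet2M jf IH.
by congr (jet2 _ _ _ _); rewrite ?exprS ?m1 //; field; exact: a0.
Qed.

(* Type-valued, so that witnesses for finite families need no choice *)
Definition hasjet f : Type := {bc : R * R | jet2 f (f 0) bc.1 bc.2}.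

Lemma jet2_hasjet f a b c : jet2 f a b c -> hasjet f.
Proof. by move=> j; exists (b, c) => /=; rewrite (jet2_at0 j). Qed.

Lemma hasjet_cst a : hasjet (fun=> a).
Proof. exact: jet2_hasjet (jet2_cst a). Qed.

Lemma hasjetD f g : hasjet f -> hasjet g -> hasjet (fun s => f s + g s).
Proof. by move=> [? jf] [? jg]; exact: jet2_hasjet (jet2D jf jg). Qed.

Lemma hasjetN f : hasjet f -> hasjet (fun s => - f s).
Proof. by move=> [? jf]; exact: jet2_hasjet (jet2N jf). Qed.

Lemma hasjetM f g : hasjet f -> hasjet g -> hasjet (fun s => f s * g s).
Proof. by move=> [? jf] [? jg]; exact: jet2_hasjet (jet2M jf jg). Qed.

Lemma hasjet_sum (T : Type) (r : seq T) (f : T -> R -> R) :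
  (forall i, hasjet (f i)) -> hasjet (fun s => \sum_(i <- r) f i s).
Proof.
move=> jf; apply: (jet2_hasjet (a := \sum_(i <- r) f i 0)
  (b := \sum_(i <- r) (sval (jf i)).1) (c := \sum_(i <- r) (sval (jf i)).2)).
by apply: jet2_sum => i _; case: (jf i).
Qed.

(** For inverses and square roots: [f] is the residual left when the candidate polynomial is put
    into the equation defining [h], and it controls the error of the candidate. *)
Lemma jet2_close f h a b c (K d : R) : 0 < K -> 0 < d ->
  jet2 f 0 0 0 -> (forall s, `|s| < d -> `|h s - (a + b * s + c * s ^+ 2)| <= K * `|f s|) ->
  jet2 h a b c.
Proof.
move=> K0 d0 jf hf e e0; have eK : 0 < e / K by rewrite divr_gt0.
have [d' d'0 h'] := jf _ eK; exists (Num.min d d'); first by rewrite lt_min d0.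
move=> s; rewrite lt_min => /andP[/hf h1 /h']; rewrite !mul0r !addr0 subr0 => h2.
apply: le_trans h1 _; apply: (le_trans (ler_wpM2l (ltW K0) h2)).
have -> // : K * (e / K * s ^+ 2) = e * s ^+ 2 by field; exact: lt0r_neq0.
Qed.

Lemma jet2_near_gt f a b c : 0 < a -> jet2 f a b c ->
  exists2 d, 0 < d & forall s, `|s| < d -> a / 2 < f s.
Proof.
move=> a0 jf; have [d d0 h] := jf 1 ltr01.
pose K := `|b| + `|c| + 1.
have K0 : 0 < K by rewrite /K; have := normr_ge0 b; have := normr_ge0 c; lra.
have nb := normr_ge0 b; have nc := normr_ge0 c.
pose d1 := Num.min 1 (a / (2 * (K + 1))).
have d10 : 0 < d1 by rewrite lt_min ltr01 divr_gt0//; lra.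
exists (Num.min d d1); first by rewrite lt_min d0.
move=> s; rewrite lt_min => /andP[/h {}h]; rewrite lt_min => /andP[s1 s2].
rewrite ltr_pdivlMr in s2; last by lra.
have ns := normr_ge0 s.
have sq : s ^+ 2 <= `|s| by rewrite -real_normK ?num_real// expr2; nra.
have s20 := sqr_ge0 s.
move: h; rewrite mul1r ler_norml => /andP[h _].
have : - (`|b| * `|s|) <= b * s by rewrite -normrM lerNnormlW.
have : - (`|c| * `|s|) <= c * s ^+ 2.
  apply: (@le_trans _ _ (- (`|c| * s ^+ 2))); first by rewrite lerN2 ler_wpM2l.
  by rewrite -[X in `|c| * X]ger0_norm// -normrM lerNnormlW.
rewrite /K in s2 *; lra.
Qed.

Lemma hasjetV f : 0 < f 0 -> hasjet f -> hasjet (fun s => (f s)^-1).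
Proof.
move=> f0 [[b c] /= jf]; set a := f 0 in f0 jf.
(* Solution of [(a + b s + c s^2) (1 / a + b' s + c' s^2) = 1] up to order two. *)
pose b' := - b / a ^+ 2; pose c' := (b ^+ 2 / a - c) / a ^+ 2.
have aN0 := lt0r_neq0 f0.
apply: (@jet2_hasjet _ a^-1 b' c').
have [d d0 fgt] := jet2_near_gt f0 jf.
have j0 : jet2 (fun s => 1 - f s * (a^-1 + b' * s + c' * s ^+ 2)) 0 0 0.
  have := jet2D (jet2_cst 1) (jet2N (jet2M jf (jet2_poly a^-1 b' c'))).
  by congr (jet2 _ _ _ _); rewrite /b' /c'; field.
have K0 : 0 < 2 / a by rewrite divr_gt0.
apply: (jet2_close K0 d0 j0) => s /fgt fs.
have fs0 : 0 < f s by apply: lt_trans fs; rewrite divr_gt0.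
have -> : (f s)^-1 - (a^-1 + b' * s + c' * s ^+ 2) =
   (f s)^-1 * (1 - f s * (a^-1 + b' * s + c' * s ^+ 2)).
  by rewrite mulrBr mulr1 mulKf// lt0r_neq0.
rewrite normrM ler_wpM2r// ger0_norm ?invr_ge0 ?(ltW fs0)//.
rewrite -[leRHS]invrK lef_pV2 ?posrE ?invr_gt0//.
by rewrite invf_div ltW.
Qed.

End HasJet.

Lemma hasjet_sqrt (R : rcfType) (f : R -> R) :
  0 < f 0 -> hasjet f -> hasjet (fun s => Num.sqrt (f s)).
Proof.
move=> f0 [[b c] /= jf]; set a := f 0 in f0 jf.
pose r := Num.sqrt a; have r0 : 0 < r by rewrite sqrtr_gt0.
have rN0 := lt0r_neq0 r0.
have ra : r ^+ 2 = a by rewrite sqr_sqrtr// ltW.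
pose b' := b / (2 * r); pose c' := (c - b' ^+ 2) / (2 * r).
apply: (@jet2_hasjet _ _ r b' c').
have [d d0 fgt] := jet2_near_gt f0 jf.
have [d' d'0 Pgt] := jet2_near_gt r0 (jet2_poly r b' c').
have j0 : jet2 (fun s => f s - (r + b' * s + c' * s ^+ 2) ^+ 2) 0 0 0.
  have jP := jet2_poly r b' c'.
  have := jet2D jf (jet2N (jet2M jP jP)).
  have -> : a - r * r = 0 by rewrite -ra; ring.
  have -> : b - (r * b' + b' * r) = 0 by rewrite /b'; field.
  have -> : c - (r * c' + b' * b' + c' * r) = 0 by rewrite /c'; field.
  by apply: eq_jet2 => s; rewrite expr2.
have K0 : 0 < 2 / r by rewrite divr_gt0.
have dd0 : 0 < Num.min d d' by rewrite lt_min d0.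
apply: (jet2_close K0 dd0 j0) => s; rewrite lt_min => /andP[/fgt fs /Pgt Ps].
set P := r + _ + _ in Ps *.
have fs0 : 0 < f s by apply: lt_trans fs; rewrite divr_gt0.
have g0 : 0 <= Num.sqrt (f s) by exact: sqrtr_ge0.
have sum0 : r / 2 <= Num.sqrt (f s) + P by lra.
have r20 : 0 < r / 2 by rewrite divr_gt0.
have -> : f s - P ^+ 2 = (Num.sqrt (f s) - P) * (Num.sqrt (f s) + P).
  by rewrite -{1}[f s]sqr_sqrtr ?(ltW fs0)//; ring.
rewrite normrM (ger0_norm (le_trans (ltW r20) sum0)).
rewrite -(ler_pM2l r20).
have -> : r / 2 * (2 / r * (`|Num.sqrt (f s) - P| * (Num.sqrt (f s) + P))) =
   (Num.sqrt (f s) + P) * `|Num.sqrt (f s) - P| by field.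
by rewrite ler_wpM2r.
Qed.

(** Converts the second order test for the powers into the one for [(P - 1) log H - P log nu]: the
    extra squares [((P - 1) a)^2] and [(P m)^2] agree by the first order condition. *)
Lemma log_second_order (R : realFieldType) (P a m x y : R) :
  (P - 1) * a = P * m ->
  (P - 1) * x + (P - 1) * ((P - 1 - 1) * (2^-1 * a ^+ 2)) -
    (P * y + P * ((P - 1) * (2^-1 * m ^+ 2))) <= 0 ->
  (P - 1) * (2 * x - a ^+ 2) <= P * (2 * y - m ^+ 2).
Proof.
move=> am; have : ((P - 1) * a) ^+ 2 = (P * m) ^+ 2 by rewrite am.
lra.
Qed.

(** * The maximum principle for jets along the frame directions *)

Section FrameMaximum.
Variables (R : rcfType) (n p : nat) (k t : 'I_n -> R) (nu sigma : R).
Variables (U3 : 'I_n -> 'I_n -> 'I_n -> R) (U4 : 'I_n -> 'I_n -> R).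
Hypothesis kP : forall I : {set 'I_n}, #|I| = p -> 0 < ssum k I.
Hypotheses (p2 : (2 <= p)%N) (pn : (p < n)%N).
Hypotheses (sigma0 : 0 < sigma) (sigma_nu : sigma <= nu).
Hypothesis H0 : 0 < \sum_j k j.
Hypothesis U3C : forall i j m, U3 i j m = U3 j i m.
Hypothesis U3R : forall i j m, U3 i j m = U3 i m j.
Hypothesis U4C : forall i j, U4 i j = U4 j i.
Hypothesis t2 : \sum_i t i ^+ 2 = 1 - nu ^+ 2.

Variables (U V : 'I_n -> R -> R) (q : 'I_n -> 'I_n -> R -> R).
Variables (C : 'I_n -> 'I_n -> 'I_n -> R -> R) (B : 'I_n -> R -> 'M[R]_n).
Variables (X : 'I_n -> 'I_n -> 'I_n -> R) (G : 'I_n -> 'I_n -> R) (eps : R).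

Local Notation hc := (hcoef k nu).

Hypothesis jU : forall d, jet2 (U d) 1 (t d) (hc d / 2).
Hypothesis jq : forall d i,
  jet2 (q d i) (t i) (hc d * (i == d)%:R) (U3 i d d / 2).
Hypothesis jC : forall d i j,
  jet2 (C d i j) (hc i * (i == j)%:R) (U3 i j d) (X d i j / 2).
Hypothesis XE : forall d i, X d i i = U4 i d.
Hypothesis GE : forall i j, G i j + t i * t j = (i == j)%:R.
Hypothesis jV : forall d, hasjet (V d).
Hypothesis V0 : forall d, V d 0 = nu.
Hypothesis jB : forall d i j, hasjet (fun s => B d s i j).
Hypothesis B0 : forall d i j, B d 0 i j = k i * (i == j)%:R.
Hypothesis VE : forall d s, V d s ^+ 2 *
  (1 + \sum_i q d i s ^+ 2 + (\sum_i t i * q d i s) ^+ 2 / nu ^+ 2) = 1.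
Hypothesis BE : forall d i j s, \sum_m (G i m + q d i s * q d m s) * B d s m j =
  V d s * (G i j + q d i s * q d j s + U d s * C d i j s).
Hypothesis eps0 : 0 < eps.
Hypothesis spec : forall d s, `|s| < eps -> exists2 k' : 'I_n -> R,
  char_poly (B d s) = \prod_(i < n) ('X - (k' i)%:P) &
  \prod_(I : {set 'I_n} | #|I| == p) ssum k' I =
  \prod_(I : {set 'I_n} | #|I| == p) ssum k I.
Hypothesis maxH : forall d s, `|s| < eps ->
  (\tr (B d s)) ^+ p.-1 * nu ^+ p <= (\sum_j k j) ^+ p.-1 * V d s ^+ p.

Lemma interior_trace_bound :
  \sum_j k j <= 4 * n%:R ^+ 2 + 2 * n%:R ^+ 4 + 4 * n%:R / sigma.
Proof.
have nu0 : 0 < nu by exact: lt_le_trans sigma_nu.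
have nuN0 := lt0r_neq0 nu0.
pose b1 d i j := (sval (jB d i j)).1; pose b2 d i j := (sval (jB d i j)).2.
pose n1 d := (sval (jV d)).1; pose n2 d := (sval (jV d)).2.
have jb d i j : jet2 (fun s => B d s i j) (k i * (i == j)%:R) (b1 d i j) (b2 d i j).
  by rewrite -(B0 d); exact: (svalP (jB d i j)).
have jn d : jet2 (V d) nu (n1 d) (n2 d) by rewrite -(V0 d); exact: (svalP (jV d)).
have fnu d := frame_nu nuN0 t2 (jq d) (jn d) (VE d).
have fB d i j := frame_B nuN0 t2 (jU d) (jq d) (jC d) (XE d) GE
  (jn d) (jb d) (VE d) (BE d) i j.
have B1E d i j : b1 d i j = dB1 k t nu U3 d i j by case: (fB d i j).
have B2E d i : 2 * b2 d i i = dB2 k t nu U3 U4 d i by case: (fB d i i).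
have n1E d : n1 d = t d * (nu - k d) by case: (fnu d) => -> _; rewrite dnu1E.
have n2E d : 2 * n2 d = dnu2 k t nu U3 d by case: (fnu d).
pose b j i := dB1 k t nu U3 i j j.
have sv d := @second_variation R n p k (B d)
  (\matrix_(i, j) b1 d i j) (\matrix_(i, j) b2 d i j) eps kP.
have {}sv d : \sum_j dlog p k j * b j d = 0 /\
  \sum_j dlog p k j * dB2 k t nu U3 U4 d j =
  \sum_(I : {set 'I_n} | #|I| == p) (ssum (b ^~ d) I / ssum k I) ^+ 2 +
  \sum_j \sum_(l | l != j) dlog2 p k j l *
     (dB1 k t nu U3 d j l * dB1 k t nu U3 d l j).
  have jm : forall i j, jet2 (fun s => B d s i j) (k i *+ (i == j))
      ((\matrix_(i, j) b1 d i j) i j) ((\matrix_(i, j) b2 d i j) i j).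
    by move=> i j; rewrite !mxE -mulr_natr.
  have [s1 s2] := sv d jm eps0 (@spec d); split.
    rewrite -[RHS]s1; apply: eq_bigr => j _; by rewrite mxE B1E.
  transitivity (\sum_i dlog p k i * (2 * (\matrix_(i, j) b2 d i j) i i)).
    by apply: eq_bigr => j _; rewrite mxE B2E.
  rewrite s2; congr (_ + _).
    apply: eq_bigr => I _; congr ((_ / _) ^+ 2); apply: eq_bigr => j _.
    by rewrite mxE B1E.
  by apply: eq_bigr => j _; apply: eq_bigr => l _; rewrite !mxE !B1E.
have NUE := sum_dlog_nu2 kP nu0 t2 (dnu2E k nuN0 U3C U3R t2) (fun d => (sv d).1).
have HHE := @sum_dlog_trace2 R n p k t nu b kP nu0 t2 (dnu2 k t nu U3)
  (fun i j => dB2 k t nu U3 U4 j i) (fun i j d => dB1 k t nu U3 d i j)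
  (dnu2E k nuN0 U3C U3R t2) (fun i j ij => dB1_rowdiff k t nuN0 U3C U3R ij)
  (fun i j ij => dB1_coldiff k t nuN0 U3C U3R ij)
  (fun i j d ij id jd => dB1_sym k t nu U3C ij id jd)
  (fun i j ij => dB2_comm k t nuN0 U3C U3R U4C ij) (fun d => (sv d).1) (fun d => (sv d).2).
have first_second d : (p%:R - 1) * ((\sum_j b j d) / \sum_j k j) =
    p%:R * (t d * (nu - k d) / nu) /\
  (p%:R - 1) * ((\sum_i dB2 k t nu U3 U4 d i) / (\sum_j k j) -
      ((\sum_j b j d) / \sum_j k j) ^+ 2) <=
    p%:R * (dnu2 k t nu U3 d / nu - (t d * (nu - k d) / nu) ^+ 2).
  set H := \sum_j k j; set h1 := \sum_j b j d.
  have HN0 : H != 0 by exact: lt0r_neq0.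
  pose h2 := \sum_j b2 d j j.
  have jH : jet2 (fun s => \tr (B d s)) H h1 h2.
    have := jet2_sum (index_enum _) (P := xpredT) (fun i _ => jb d i i).
    congr (jet2 _ _ _ _); apply: eq_bigr => i _; first by rewrite eqxx mulr1.
    by rewrite B1E.
  have h2E : \sum_i dB2 k t nu U3 U4 d i = 2 * h2.
    by rewrite mulr_sumr; apply: eq_bigr => i _; rewrite B2E.
  (* Normalized so that [K * tr(B)^(p-1) - V^p] vanishes at 0, its maximum; this test function
     involves no quotient of jets. *)
  pose K := nu ^+ p / H ^+ p.-1.
  have K0 : 0 < K by rewrite divr_gt0 ?exprn_gt0.
  have jF := jet2D (jet2Z K (jet2X p.-1 HN0 jH)) (jet2N (jet2X p nuN0 (jn d))).
  have KH : K * H ^+ p.-1 = nu ^+ p by rewrite /K mulfVK// expf_neq0.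
  have [|c1 c2] := jet2_max eps0 _ jF.
    move=> s /(maxH d) hs; rewrite V0 (jet2_at0 jH) KH subrr subr_le0.
    rewrite /K mulrAC ler_pdivrMr ?exprn_gt0//.
    by rewrite mulrC [leRHS]mulrC.
  move: c1 c2; rewrite !mulrA -![K * _ * _]mulrA.
  rewrite h2E -(n2E d) -/h1 n1E.
  have p1 : (p.-1)%:R = p%:R - 1 :> R by rewrite -subn1 natrB// ltnW.
  rewrite !mulrA KH p1 -!mulrA.
  set mu := t d * ((nu - k d) / nu).
  have np0 : 0 < nu ^+ p by rewrite exprn_gt0.
  rewrite -!mulrBr => /eqP; rewrite mulf_eq0 gt_eqF//= subr_eq0 => /eqP c1.
  rewrite pmulr_rle0// => c2; split=> //.
  have mu2 : t d * ((nu - k d) * (nu^-1 * mu)) = mu ^+ 2 by rewrite /mu; ring.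
  have a2 : h1 * (H^-1 * (h1 / H)) = (h1 / H) ^+ 2 by ring.
  by rewrite mu2 a2 in c2; exact: log_second_order c2.
have crit d := (first_second d).1.
have max2 : (p%:R - 1) * ((\sum_j dlog p k j * \sum_i dB2 k t nu U3 U4 j i) / (\sum_j k j) -
    \sum_i dlog p k i * ((\sum_j b j i) / \sum_j k j) ^+ 2) <=
  p%:R * ((\sum_j dlog p k j * dnu2 k t nu U3 j) / nu -
    \sum_i dlog p k i * (t i * (nu - k i) / nu) ^+ 2).
  rewrite !mulr_suml -!sumrB !mulr_sumr; apply: ler_sum => d _.
  have := ler_wpM2l (dlog_ge0 kP d) (first_second d).2.
  by congr (_ <= _); ring.
have := trace_bound kP nu0 t2 p2 pn sigma0 sigma_nu H0 NUE HHE crit max2.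
by [].
Qed.

End FrameMaximum.

Local Open Scope classical_set_scope.
Local Open Scope ring_scope.

(** * Directional derivatives *)

Section DirectionalCalculus.
Variables (R : realType) (E : normedModType R).
Implicit Types (f g : E -> R) (x v w : E) (l : R) (O : set E).

Lemma is_deriveP f x v l : is_derive x v f l <->
  forall e, 0 < e -> exists2 d, 0 < d &
    forall h, `|h| < d -> `|f (x + h *: v) - f x - h * l| <= e * `|h|.
Proof.
split=> [[dfx <-] e e0|H].
  have /cvgrPdist_le/(_ e e0) := dfx; rewrite -/(derive f x v).
  move=> /nbhs_ballP[d d0 hd]; exists d => // h hh.
  have [->|h0] := eqVneq h 0.
    by rewrite scale0r addr0 subrr mul0r subr0 !normr0 mulr0.
  have := hd h; rewrite /ball /= sub0r normrN => /(_ hh h0).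
  rewrite -(ler_pM2r (_ : 0 < `|h|)) ?normr_gt0// -normrM; congr (_ <= _).
  rewrite -normrN; congr `|_|; rewrite [h *: v + x]addrC /GRing.scale /=.
  by field.
have hl : (fun h => h^-1 *: ((f \o shift x) (h *: v) - f x)) @ 0^' --> l.
  apply/cvgrPdist_le => e e0; have [d d0 hd] := H e e0.
  apply/nbhs_ballP; exists d => // h; rewrite /ball /= sub0r normrN => hh h0.
  have := hd h hh; rewrite -(ler_pM2r (_ : 0 < `|h|)) ?normr_gt0// -normrM.
  rewrite -[leRHS]/(_ * _) => hle.
  have nh : `|h| != 0 by rewrite normr_eq0.
  rewrite -(ler_pM2r (_ : 0 < `|h|)) ?normr_gt0// -normrM.
  apply: le_trans (hd h hh); rewrite -normrN.
  rewrite [h *: v + x]addrC /GRing.scale /= le_eqVlt; apply/orP; left; apply/eqP.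
  by congr `|_|; field.
by apply: DeriveDef; [apply/cvg_ex; exists l|exact: cvg_lim].
Qed.

Lemma continuous_ball f x : {for x, continuous f} -> forall e, 0 < e ->
  exists2 d, 0 < d & forall y, `|y - x| < d -> `|f y - f x| <= e.
Proof.
move=> /cvgrPdist_le fx e /fx /nbhs_ballP[d d0 hd]; exists d => // y yx.
by rewrite distrC; apply: hd; rewrite -ball_normE /= distrC.
Qed.

Lemma open_ball O x : open O -> O x -> exists2 d, 0 < d & forall y, `|y - x| < d -> O y.
Proof.
rewrite openE => /(_ x) h /h /nbhs_ballP[d d0 hd]; exists d => // y yx.
by apply: hd; rewrite -ball_normE /= distrC.
Qed.

End DirectionalCalculus.

Lemma is_derive_along (R : realType) (E : normedModType R) (f : E -> R) x v l (s : R) :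
  is_derive (x + s *: v) v f l -> is_derive s 1 (fun r => f (x + r *: v)) l.
Proof.
move=> /is_deriveP H; apply/is_deriveP => e /H[d d0 hd]; exists d => // h /hd.
have -> : h *: (1 : R) = h by rewrite /GRing.scale /= mulr1.
by rewrite scalerDl addrA.
Qed.

Lemma segment_MVT (R : realType) (E : normedModType R) (f : E -> R) (g : R -> R) x v :
  (forall r : R, 0 <= r <= 1 -> is_derive (x + r *: v) v f (g r)) ->
  exists2 c, 0 <= c <= 1 & f (x + v) - f x = g c.
Proof.
move=> H.
have dH (r : R) : 0 <= r <= 1 -> is_derive r 1 (fun r => f (x + r *: v)) (g r).
  by move=> r01; apply: is_derive_along; exact: H.
have [||c] := @MVT R (fun r => f (x + r *: v)) g 0 1 ltr01.
- by move=> r; rewrite in_itv /= => /andP[r0 r1]; apply: dH; rewrite !ltW.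
- apply: derivable_within_continuous => r; rewrite in_itv /= => r01.
  by case: (dH r r01).
rewrite in_itv /= scale0r addr0 scale1r subr0 mulr1 => /andP[c0 c1] ->.
by exists c; rewrite // !ltW.
Qed.

Lemma is_derive_quad (R : realType) (a q r : R) :
  is_derive r 1 (fun r => a * r + q * r ^+ 2) (a + 2 * q * r).
Proof.
apply/is_deriveP => e e0; exists (e / (`|q| + 1)).
  by rewrite divr_gt0// ltr_wpDl.
move=> h; rewrite ltr_pdivlMr ?ltr_wpDl// => hh.
have -> : h *: (1 : R) = h by rewrite /GRing.scale /= mulr1.
rewrite (_ : _ - _ - _ = q * h * h); last by ring.
rewrite normrM ler_wpM2r// normrM; have := normr_ge0 h; nra.
Qed.

Section SmoothClass.
Variables (R : realType) (E : normedModType R) (O : set E).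
Hypothesis oO : open O.
Implicit Types (f g : E -> R) (x v w : E).

Definition Cdir1 f v g := (forall x, O x -> is_derive x v f (g x)) /\
  (forall x, O x -> {for x, continuous g}).

Lemma near_point x v (d : R) : 0 < d -> exists2 d', 0 < d' &
  forall h, `|h| < d' -> `|h *: v| < d.
Proof.
move=> d0; exists (d / (`|v| + 1)); first by rewrite divr_gt0// ltr_pwDr.
move=> h; rewrite ltr_pdivlMr ?ltr_pwDr// normrZ; apply: le_lt_trans.
by rewrite ler_wpM2l// lerDl.
Qed.

Lemma is_derive_scale f x v (h l : R) : is_derive x v f l -> is_derive x (h *: v) f (h * l).
Proof.
have [->|h0] := eqVneq h 0.
  by move=> _; rewrite scale0r mul0r; apply/is_deriveP => e e0; exists 1 => // h' _;
     rewrite scaler0 addr0 subrr mulr0 subr0 normr0 mulr_ge0// ltW.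
move=> /is_deriveP H; apply/is_deriveP => e e0.
have nh : 0 < `|h| by rewrite normr_gt0.
have [d d0 hd] := H (e / `|h|) (divr_gt0 e0 nh).
exists (d / `|h|); first by rewrite divr_gt0.
move=> h'; rewrite ltr_pdivlMr// -normrM => /hd; rewrite scalerA normrM.
have -> : e / `|h| * (`|h'| * `|h|) = e * `|h'| by field; exact: lt0r_neq0.
by rewrite mulrA.
Qed.

(** Move by [h *: v] first and by [h *: w] next; on the second leg the mean value theorem and the
    continuity of [g'] control the error. *)
Lemma Cdir1D f v w g g' : Cdir1 f v g -> Cdir1 f w g' ->
  Cdir1 f (v + w) (fun x => g x + g' x).
Proof.
move=> [dg cg] [dg' cg']; split; last first.
  by move=> x Ox; apply: continuousD; [exact: cg|exact: cg'].
move=> x Ox; apply/is_deriveP => e e0; have e2 : 0 < e / 2 by rewrite divr_gt0.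
have [d1 d10 h1] := (is_deriveP f x v (g x)).1 (dg x Ox) _ e2.
have [d2 d20 h2] := continuous_ball (cg' x Ox) e2.
have [d3 d30 h3] := open_ball oO Ox.
have d230 : 0 < Num.min d2 d3 / 2 by rewrite divr_gt0// lt_min d20.
have [d4 d40 h4] := near_point x v d230.
have [d5 d50 h5] := near_point x w d230.
exists (Num.min d1 (Num.min d4 d5)); first by rewrite !lt_min d10 d40.
move=> h; rewrite !lt_min => /and3P[/h1 k1 /h4 k4 /h5 k5].
have near (r : R) : 0 <= r <= 1 -> `|x + h *: v + r *: (h *: w) - x| < Num.min d2 d3.
  move=> /andP[r0 r1]; rewrite -[x + _ + _]addrA [_ - x]addrC addKr.
  apply: le_lt_trans (ler_normD _ _) _; rewrite [`|r *: _|]normrZ (ger0_norm r0).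
  have : r * `|h *: w| <= `|h *: w| by rewrite ler_piMl.
  lra.
have [|c c01 E1] := @segment_MVT R E f (fun r => h * g' (x + h *: v + r *: (h *: w)))
  (x + h *: v) (h *: w).
  move=> r /near; rewrite lt_min => /andP[_ /h3 Or].
  by apply: is_derive_scale; exact: dg'.
have := near c c01; rewrite lt_min => /andP[/h2 k2 _].
rewrite scalerDr addrA.
have -> : f (x + h *: v + h *: w) - f x - h * (g x + g' x) =
  (f (x + h *: v) - f x - h * g x) +
  h * (g' (x + h *: v + c *: (h *: w)) - g' x).
  by rewrite mulrBr -E1; ring.
apply: le_trans (ler_normD _ _) _; rewrite normrM.
have : `|h| * `|g' (x + h *: v + c *: (h *: w)) - g' x| <= `|h| * (e / 2).
  by rewrite ler_wpM2l.
lra.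
Qed.

Lemma Cdir1Z f v g (c : R) : Cdir1 f v g -> Cdir1 f (c *: v) (fun x => c * g x).
Proof.
move=> [dg cg]; split=> x Ox; first by apply: is_derive_scale; exact: dg.
by apply: continuousM; [exact: cst_continuous|exact: cg].
Qed.

Lemma Cdir1_eq f v g g' : (forall x, O x -> g x = g' x) -> Cdir1 f v g -> Cdir1 f v g'.
Proof.
move=> gg' [dg cg]; split=> x Ox; first by rewrite -gg'//; exact: dg.
rewrite /prop_for /continuous_at -gg'//; apply: cvg_trans (cg x Ox).
apply: near_eq_cvg; have := open_nbhs_nbhs (conj oO Ox).
by apply: filterS => y Oy; rewrite gg'.
Qed.

Lemma is_derive_congr f g x v l : O x -> (forall y, O y -> f y = g y) ->
  is_derive x v f l -> is_derive x v g l.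
Proof.
move=> Ox fg /is_deriveP H; apply/is_deriveP => e /H[d d0 hd].
have [d1 d10 h1] := open_ball oO Ox; have [d2 d20 h2] := near_point x v d10.
exists (Num.min d d2); first by rewrite lt_min d0.
move=> h; rewrite lt_min => /andP[/hd + /h2 k2]; rewrite !fg//.
by apply: h1; rewrite addrC addKr.
Qed.

(* Arbitrary directions, not just the coordinate ones: the frame is not Euclidean. *)
Fixpoint Cd k f : Prop := (forall x, O x -> {for x, continuous f}) /\
  if k is k'.+1 then forall v, (forall x, O x -> derivable f x v) /\ Cd k' ('D_v f)
  else True.

Lemma Cd_cont k f : Cd k f -> forall x, O x -> {for x, continuous f}.
Proof. by case: k => [|k] []. Qed.

Lemma Cd_D k f v : Cd k.+1 f -> Cd k ('D_v f).
Proof. by move=> [_ /(_ v)[]]. Qed.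

Lemma Cd_dir1 k f v : Cd k.+1 f -> Cdir1 f v ('D_v f).
Proof.
move=> [_ /(_ v)[df cf]]; split; last exact: Cd_cont cf.
by move=> x Ox; apply/derivableP; exact: df.
Qed.

Lemma CdW k f : Cd k.+1 f -> Cd k f.
Proof.
elim: k f => [|k IH] f [cf df]; split=> // v; split; first by case: (df v).
by apply: IH; case: (df v).
Qed.

Lemma continuous_congr f g x : O x -> (forall y, O y -> f y = g y) ->
  {for x, continuous f} -> {for x, continuous g}.
Proof.
move=> Ox fg cf; rewrite /prop_for /continuous_at -fg//; apply: cvg_trans cf.
apply: near_eq_cvg; have := open_nbhs_nbhs (conj oO Ox).
by apply: filterS => y Oy; rewrite fg.
Qed.

Lemma Cd_congr k f g : (forall x, O x -> f x = g x) -> Cd k f -> Cd k g.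
Proof.
elim: k f g => [|k IH] f g fg [cf df]; split=> //.
- by move=> x Ox; apply: continuous_congr fg _ => //; exact: cf.
- by move=> x Ox; apply: continuous_congr fg _ => //; exact: cf.
- have dg v x : O x -> is_derive x v g ('D_v f x).
    move=> Ox; apply: is_derive_congr fg _ => //.
    by apply/derivableP; case: (df v) => + _; exact.
  move=> v; split=> [x Ox|]; first by case: (dg v x Ox).
  apply: IH (proj2 (df v)) => x Ox.
  by case: (dg v x Ox).
Qed.

Lemma CdD k f g : Cd k f -> Cd k g -> Cd k (fun x => f x + g x).
Proof.
elim: k f g => [|k IH] f g [cf df] [cg dg]; split=> //.
- by move=> x Ox; apply: continuousD; [exact: cf|exact: cg].
- by move=> x Ox; apply: continuousD; [exact: cf|exact: cg].
- move=> v; have [df1 df2] := df v; have [dg1 dg2] := dg v.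
  have dfg x : O x -> is_derive x v (f + g) ('D_v f x + 'D_v g x).
    by move=> Ox; apply: is_deriveD; apply/derivableP; [exact: df1|exact: dg1].
  split=> [x Ox|]; first by case: (dfg x Ox).
  by apply: Cd_congr (IH _ _ df2 dg2) => x Ox; case: (dfg x Ox).
Qed.

Lemma CdZ k (c : R) f : Cd k f -> Cd k (fun x => c * f x).
Proof.
elim: k f => [|k IH] f [cf df]; split=> //.
- by move=> x Ox; apply: continuousM; [exact: cst_continuous|exact: cf].
- by move=> x Ox; apply: continuousM; [exact: cst_continuous|exact: cf].
- move=> v; have [df1 df2] := df v.
  have dcf x : O x -> is_derive x v (c \*: f) (c *: 'D_v f x).
    by move=> Ox; apply: is_deriveZ; apply/derivableP; exact: df1.
  split=> [x Ox|]; first by case: (dcf x Ox).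
  by apply: Cd_congr (IH _ df2) => x Ox; case: (dcf x Ox).
Qed.

Lemma Cd0 k : Cd k (fun=> 0).
Proof.
elim: k => [|k IH]; split=> //; try by move=> x _; exact: cst_continuous.
move=> v; have d0 x : is_derive x v (cst (0 : R) : E -> R) 0 by exact: is_derive_cst.
split=> [x _|]; first by case: (d0 x).
by apply: Cd_congr IH => x _; case: (d0 x).
Qed.

Lemma Cd_sum k (I : Type) (r : seq I) (F : I -> E -> R) :
  (forall i, Cd k (F i)) -> Cd k (fun x => \sum_(i <- r) F i x).
Proof.
move=> hF; elim: r => [|i r IH].
  by apply: Cd_congr (Cd0 k) => x _; rewrite big_nil.
by apply: Cd_congr (CdD (hF i) IH) => x _; rewrite big_cons.
Qed.

Lemma Cd_shift_close x v w (d : R) : 0 < d -> exists2 d', 0 < d' &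
  forall h (c c' : R), `|h| < d' -> 0 <= c <= 1 -> 0 <= c' <= 1 ->
    `|x + c *: (h *: v) + c' *: (h *: w) - x| < d.
Proof.
move=> d0; have d20 : 0 < d / 2 by rewrite divr_gt0.
have [d1 d10 h1] := near_point x v d20; have [d2 d20' h2] := near_point x w d20.
exists (Num.min d1 d2); first by rewrite lt_min d10.
move=> h c c'; rewrite lt_min => /andP[/h1 k1 /h2 k2] /andP[c0 c1] /andP[c0' c1'].
rewrite -[x + _ + _]addrA [_ - x]addrC addKr; apply: le_lt_trans (ler_normD _ _) _.
rewrite [`|c *: _|]normrZ [`|c' *: _|]normrZ (ger0_norm c0) (ger0_norm c0').
have : c * `|h *: v| <= `|h *: v| by rewrite ler_piMl.
have : c' * `|h *: w| <= `|h *: w| by rewrite ler_piMl.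
lra.
Qed.

Lemma second_difference f v w fv fvw x : Cdir1 f v fv -> Cdir1 fv w fvw -> O x ->
  forall e, 0 < e -> exists2 d, 0 < d & forall h, `|h| < d ->
   `|f (x + h *: v + h *: w) - f (x + h *: v) - f (x + h *: w) + f x - h ^+ 2 * fvw x|
     <= e * h ^+ 2.
Proof.
move=> [dv cv] [dw cw] Ox e e0.
have [d1 d10 h1] := continuous_ball (cw x Ox) e0.
have [d2 d20 h2] := open_ball oO Ox.
have d120 : 0 < Num.min d1 d2 by rewrite lt_min d10.
have [d3 d30 h3] := Cd_shift_close x v w d120.
exists d3 => // h hh.
have O1 (c c' : R) : 0 <= c <= 1 -> 0 <= c' <= 1 -> O (x + c *: (h *: v) + c' *: (h *: w)).
  by move=> c01 c01'; have := h3 h c c' hh c01 c01'; rewrite lt_min => /andP[_ /h2].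
have l01 : 0 <= (1 : R) <= 1 by rewrite ler01 lexx.
have l00 : 0 <= (0 : R) <= 1 by rewrite ler01 lexx.
pose psi y := f (y + h *: w) - f y.
have [|c c01 E1] := @segment_MVT R E psi
    (fun r => h * (fv (x + r *: (h *: v) + h *: w) - fv (x + r *: (h *: v)))) x (h *: v).
  move=> r r01; rewrite mulrBr; apply: is_deriveB.
    have := O1 r 1 r01 l01; rewrite scale1r => /dv /(@is_derive_scale _ _ _ h).
    move=> /is_deriveP H; apply/is_deriveP => e' /H[d d0 hd]; exists d => // h' /hd.
    by rewrite [x + r *: _ + h' *: _ + _]addrAC.
  have := O1 r 0 r01 l00; rewrite scale0r addr0 => /dv.
  exact: is_derive_scale.
have [|c' c01' E2] := @segment_MVT R E fv
    (fun r => h * fvw (x + c *: (h *: v) + r *: (h *: w))) (x + c *: (h *: v)) (h *: w).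
  by move=> r r01; apply: is_derive_scale; apply: dw; exact: O1.
rewrite E2 in E1.
have -> : f (x + h *: v + h *: w) - f (x + h *: v) - f (x + h *: w) + f x - h ^+ 2 * fvw x
   = h ^+ 2 * (fvw (x + c *: (h *: v) + c' *: (h *: w)) - fvw x).
  rewrite mulrBr -[X in _ = X - _]mulrA -E1 /psi; ring.
rewrite normrM ger0_norm ?sqr_ge0// mulrC ler_wpM2r ?sqr_ge0//.
by apply: h1; have := h3 h c c' hh c01 c01'; rewrite lt_min => /andP[].
Qed.

(** Both sides are limits of one second difference quotient, which is symmetric in [v] and [w]. *)
Lemma Schwarz f v w x : Cd 2 f -> O x -> 'D_v ('D_w f) x = 'D_w ('D_v f) x.
Proof.
move=> cf Ox.
have A := second_difference (Cd_dir1 v cf) (Cd_dir1 w (Cd_D v cf)) Ox.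
have B := second_difference (Cd_dir1 w cf) (Cd_dir1 v (Cd_D w cf)) Ox.
apply/eqP; rewrite -subr_eq0 -normr_le0; apply/ler_addgt0Pr => e e0; rewrite add0r.
have e20 : 0 < e / 2 by rewrite divr_gt0.
have [d1 d10 h1] := A _ e20; have [d2 d20 h2] := B _ e20.
pose h := Num.min d1 d2 / 2.
have h0 : 0 < h by rewrite divr_gt0// lt_min d10.
have hd : `|h| < Num.min d1 d2 by rewrite gtr0_norm// ltr_pdivrMr//; rewrite /h in h0; lra.
move: hd; rewrite lt_min => /andP[/h1 k1 /h2 k2].
have hh : 0 < h ^+ 2 by rewrite exprn_gt0.
rewrite -(ler_pM2r hh) -{1}[h ^+ 2]ger0_norm ?(ltW hh)// -normrM.
move: k1 k2; set a1 := f _; set a2 := f (x + h *: v); set a3 := f (x + h *: w).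
rewrite [x + h *: w + h *: v]addrAC -/a1 => k1 k2.
set D1 := 'D_v _ x; set D2 := 'D_w _ x in k1 *.
rewrite -/D1 in k2.
have -> : (D1 - D2) * h ^+ 2 = (a1 - a2 - a3 + f x - h ^+ 2 * D2) -
   (a1 - a3 - a2 + f x - h ^+ 2 * D1) by ring.
by apply: le_trans (ler_normB _ _) (le_trans (lerD k1 k2) _); rewrite -mulrDl -splitr.
Qed.

(** One mean value step for [f] minus its quadratic polynomial reduces the claim to the first order
    expansion of ['D_v f] at [x]. *)
Lemma jet2_along f v x : Cd 2 f -> O x ->
  jet2 (fun s => f (x + s *: v)) (f x) ('D_v f x) ('D_v ('D_v f) x / 2).
Proof.
move=> cf Ox e e0.
have [d1 _] := Cd_dir1 v cf; have [d2 _] := Cd_dir1 v (Cd_D v cf).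
have [da da0 ha] := (is_deriveP _ _ _ _).1 (d2 x Ox) _ e0.
have [db db0 hb] := open_ball oO Ox; have [dc dc0 hc] := near_point x v db0.
exists (Num.min da dc); first by rewrite lt_min da0.
move=> s; rewrite lt_min => /andP[sa sc].
set b := 'D_v f x; set c := 'D_v ('D_v f) x.
have rs (r : R) : 0 <= r <= 1 -> `|r * s| <= `|s|.
  by move=> /andP[r0 r1]; rewrite normrM (ger0_norm r0) ler_piMl.
have dF (r : R) : 0 <= r <= 1 -> is_derive r 1
    ((fun r => f (x + r *: (s *: v))) - (fun r => b * s * r + c / 2 * s ^+ 2 * r ^+ 2))
    (s * 'D_v f (x + r *: (s *: v)) - (b * s + 2 * (c / 2 * s ^+ 2) * r)).
  move=> r01; apply: is_deriveB; last exact: is_derive_quad.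
  apply: is_derive_along; apply: is_derive_scale; apply: d1; apply: hb.
  rewrite addrC addKr scalerA; apply: hc; apply: le_lt_trans sc; exact: rs.
have [||r] := @MVT R ((fun r => f (x + r *: (s *: v))) -
    (fun r => b * s * r + c / 2 * s ^+ 2 * r ^+ 2))
    (fun r => s * 'D_v f (x + r *: (s *: v)) - (b * s + 2 * (c / 2 * s ^+ 2) * r)) 0 1 ltr01.
- by move=> r; rewrite in_itv /= => /andP[r0 r1]; apply: dF; rewrite !ltW.
- apply: derivable_within_continuous => r; rewrite in_itv /= => r01.
  by case: (dF r r01).
rewrite in_itv /= subr0 mulr1 => /andP[r0 r1].
have r01 : 0 <= r <= 1 by rewrite !ltW.
rewrite -![(_ - _ : R -> R) _]/(_ - _) scale0r addr0 scale1r => E1.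
have -> : f (x + s *: v) - (f x + b * s + c / 2 * s ^+ 2) =
    s * ('D_v f (x + (r * s) *: v) - b - r * s * c).
  transitivity (s * 'D_v f (x + r *: (s *: v)) - (b * s + 2 * (c / 2 * s ^+ 2) * r)).
    by rewrite -E1; ring.
  by rewrite scalerA; field.
rewrite normrM.
have := ha (r * s) (le_lt_trans (rs r r01) sa); rewrite -/b -/c => k1.
have k2 : e * `|r * s| <= e * `|s| by rewrite ler_wpM2l ?(ltW e0)// rs.
apply: (le_trans (ler_wpM2l (normr_ge0 s) (le_trans k1 k2))).
by rewrite -[s ^+ 2]real_normK ?num_real// expr2 mulrCA.
Qed.

End SmoothClass.

(** * From coordinate partial derivatives to arbitrary directions *)

Section PartialDerivatives.
Variables (R : realType) (n : nat) (O : set 'rV[R]_n).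
Hypothesis oO : open O.
Implicit Types (f u : 'rV[R]_n -> R) (v w : 'rV[R]_n).

Lemma Cdir1_coord f (g : 'I_n -> 'rV[R]_n -> R) v :
  (forall i, Cdir1 O f (delta_mx 0 i) (g i)) ->
  Cdir1 O f v (fun x => \sum_i v 0 i * g i x).
Proof.
move=> fg; rewrite [v]row_sum_delta.
have : Cdir1 O f (\sum_i v 0 i *: delta_mx 0 i) (fun x => \sum_i v 0 i * g i x).
  elim: (index_enum _) => [|i r IH].
    rewrite big_nil; split=> x Ox; first by rewrite big_nil; exact: is_derive0.
    by under [X in {for _, continuous X}]eq_fun do rewrite big_nil; exact: cst_continuous.
  rewrite big_cons; apply: (Cdir1_eq oO) (Cdir1D oO (Cdir1Z _ (fg i)) IH) => x _.
  by rewrite big_cons.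
apply: Cdir1_eq => // x _; apply: eq_bigr => i _; congr (_ * _).
by rewrite -row_sum_delta.
Qed.

Lemma Cd_coord k f (g : 'I_n -> 'rV[R]_n -> R) :
  (forall i, Cdir1 O f (delta_mx 0 i) (g i)) -> (forall i, Cd O k (g i)) ->
  (forall x, O x -> {for x, continuous f}) -> Cd O k.+1 f.
Proof.
move=> fg gk cf; split=> // v; have [df _] := Cdir1_coord v fg.
split=> [x Ox|]; first by case: (df x Ox).
have cg : Cd O k (fun x => \sum_i v 0 i * g i x) by apply: Cd_sum => // i; exact: CdZ.
by apply: (Cd_congr oO) cg => x Ox; case: (df x Ox).
Qed.

Lemma Ck_Cd K u k (s : seq 'I_n) : Ck K O u -> (size s + k <= K)%N ->
  Cd O k (pderivs s u).
Proof.
move=> [du cu]; elim: k s => [|k IH] s sk.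
  by split=> // x Ox; apply: cu => //; rewrite addn0 in sk.
apply: (@Cd_coord _ _ (fun i => pderivs (i :: s) u)) => [i|i|x Ox].
- split=> x Ox; first by apply/derivableP/du => //; apply: leq_trans sk; rewrite addnS ltnS leq_addr.
  by apply: cu => //=; apply: leq_trans sk; rewrite addnS ltnS leq_addr.
- by apply: IH; rewrite /= addSnnS.
- by apply: cu => //; apply: leq_trans sk; exact: leq_addr.
Qed.

Lemma D_coord f v x : Cd O 1 f -> O x -> 'D_v f x = \sum_i v 0 i * pderiv i f x.
Proof.
move=> cf Ox.
have [df _] := @Cdir1_coord f (fun i => pderiv i f) v (fun i => Cd_dir1 (delta_mx 0 i) cf).
by case: (df x Ox).
Qed.

Lemma D2_coord f v w x : Cd O 2 f -> O x ->
  'D_v ('D_w f) x = \sum_i \sum_j v 0 i * w 0 j * pderiv i (pderiv j f) x.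
Proof.
move=> cf Ox; rewrite (D_coord v (Cd_D w cf) Ox); apply: eq_bigr => i _.
rewrite /pderiv; have cf1 := CdW cf.
have : is_derive x (delta_mx 0 i) (fun y => \sum_j w 0 j * pderiv j f y)
    (\sum_j w 0 j * pderiv i (pderiv j f) x).
  have : Cdir1 O (fun y => \sum_j w 0 j * pderiv j f y) (delta_mx 0 i)
      ('D_(delta_mx 0 i) (fun y => \sum_j w 0 j * pderiv j f y)).
    by apply: (@Cd_dir1 _ _ _ 0); apply: (Cd_sum oO) => j; exact: (CdZ oO _ (Cd_D _ cf)).
  move=> [d _]; apply: is_derive_eq (d x Ox) _.
  have dj j : is_derive x (delta_mx 0 i) (w 0 j \*: pderiv j f)
      (w 0 j *: pderiv i (pderiv j f) x).
    apply: is_deriveZ; apply/derivableP.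
    by have [+ _] := Cd_dir1 (delta_mx 0 i) (Cd_D (delta_mx 0 j) cf); case/(_ x Ox).
  have := is_derive_sum dj.
  rewrite (_ : \sum_(i0 < n) (w 0 i0 \*: pderiv i0 f) =
     (fun y => \sum_j w 0 j * pderiv j f y)); last first.
    by apply/funext => y; rewrite fct_sumE.
  by case.
move=> H; have := is_derive_congr oO Ox (fun y Oy => esym (D_coord w cf1 Oy)) H.
case=> _ ->; rewrite mulr_sumr; apply: eq_bigr => j _; by rewrite mulrA.
Qed.

Lemma hess_sym u x : Cd O 2 u -> O x -> (hess u x)^T = hess u x.
Proof.
move=> cu Ox; apply/matrixP => i j; rewrite !mxE; exact: (Schwarz oO _ _ cu Ox).
Qed.

End PartialDerivatives.

Local Close Scope classical_set_scope.

(** * The spectral theorem and the graph metric *)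

Section RealSpectralTheorem.
Variable R : rcfType.

Lemma row_dot_gt0 n (v : 'rV[R]_n) : v != 0 -> 0 < (v *m v^T) 0 0.
Proof.
move=> v0; rewrite mxE; under eq_bigr do rewrite mxE -expr2.
have [i vi] : exists i, v 0 i != 0.
  apply/existsP; apply: contraNT v0 => /existsPn h; apply/eqP/rowP => i.
  by rewrite mxE; apply/eqP; have := h i; rewrite negbK.
rewrite (bigD1 i)//= ltr_wpDr ?sumr_ge0// => [j _|]; first exact: sqr_ge0.
by rewrite exprn_even_gt0.
Qed.

(* Householder reflection *)
Lemma orthogonal_first_row n (v : 'rV[R]_n.+1) : v *m v^T = 1%:M ->
  exists2 Q : 'M[R]_n.+1, Q *m Q^T = 1%:M & row 0 Q = v.
Proof.
move=> v1; pose e : 'rV[R]_n.+1 := delta_mx 0 0.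
have [ve|ve] := eqVneq v e.
  by exists 1%:M; [rewrite trmx1 mulmx1|rewrite row1 ve].
have [x xE] : exists x, x = v - e by exists (v - e).
have x0 : x != 0 by rewrite xE subr_eq0.
have s0 := row_dot_gt0 x0; set s := (x *m x^T) 0 0 in s0.
have sN0 := lt0r_neq0 s0.
have xx : x *m x^T = s%:M by rewrite [LHS]mx11_scalar.
pose Q : 'M[R]_n.+1 := 1%:M - (2 / s) *: (x^T *m x).
have QT : Q^T = Q by rewrite /Q linearB /= linearZ /= trmx_mul trmxK trmx1.
have QQ : Q *m Q = 1%:M.
  rewrite /Q mulmxBl mul1mx mulmxBr mulmx1 -scalemxAl -scalemxAr.
  rewrite mulmxA -[_ *m x *m x^T]mulmxA xx mul_mx_scalar -scalemxAl !scalerA.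
  have -> : 2 / s * (2 / s * s) = 2 / s + 2 / s by field.
  by rewrite scalerDl opprB addrK subrK.
exists Q; first by rewrite QT.
have vE : v 0 0 = 1 - s / 2.
  have : s = 2 - 2 * v 0 0.
    rewrite /s xE [(v - e)^T]linearB /= mulmxBl !mulmxBr v1.
    have -> : e *m e^T = 1%:M.
      rewrite /e trmx_delta mul_delta_mx; apply/matrixP => i j.
      by rewrite !ord1 !mxE.
    have -> : v *m e^T = (v 0 0)%:M.
      rewrite /e trmx_delta -colE; apply/matrixP => i j; rewrite !ord1 !mxE.
      by rewrite mulr1n.
    have -> : e *m v^T = (v 0 0)%:M.
      by rewrite /e -rowE; apply/matrixP => i j; rewrite !ord1 !mxE mulr1n.
    by rewrite !mxE /= !mulr1n; ring.
  by move=> ->; field.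
rewrite rowE /Q mulmxBr mulmx1 -scalemxAr mulmxA -/e.
have -> : e *m x^T = (- (s / 2))%:M.
  rewrite xE /e -rowE; apply/matrixP => i j; rewrite !ord1 !mxE mulr1n vE eqxx /=.
  by ring.
rewrite mul_scalar_mx scalerA.
have -> : 2 / s * - (s / 2) = -1 by field.
by rewrite scaleN1r opprK xE addrC subrK.
Qed.

(** Deflation that respects the prescribed order of the eigenvalues: a unit eigenvector for [k 0 0]
    is made the first row of an orthogonal matrix, and symmetry clears the first row and column of
    the conjugate. *)
Lemma spectral_theorem n (A : 'M[R]_n) (k : 'rV[R]_n) : A^T = A ->
  char_poly A = \prod_(i < n) ('X - (k 0 i)%:P) ->
  exists2 Q : 'M[R]_n, Q *m Q^T = 1%:M & Q *m A *m Q^T = diag_mx k.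
Proof.
elim: n A k => [|n IH] A k symA chA.
  by exists 1%:M; apply/matrixP => [] [].
pose a := k 0 0.
have /eigenvalueP[w wA w0] : eigenvalue A a.
  by rewrite eigenvalue_root_char chA /root big_ord_recl hornerM !hornerE subrr mul0r.
pose v := (Num.sqrt ((w *m w^T) 0 0))^-1 *: w.
have vA : v *m A = a *: v by rewrite /v -scalemxAl wA !scalerA mulrC.
have v1 : v *m v^T = 1%:M.
  rewrite [LHS]mx11_scalar /v linearZ /= -scalemxAl -scalemxAr !mxE.
  have := row_dot_gt0 w0; rewrite mxE => ww; set c := \sum_j _ in ww *.
  rewrite mulrA -invfM -expr2 sqr_sqrtr ?ltW// mulVf// gt_eqF//.
have [Q1 QQ Qv] := orthogonal_first_row v1.
have QQ' : Q1^T *m Q1 = 1%:M by exact: mulmx1C.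
have [A1 A1def] : exists A1 : 'M[R]_(1 + n), A1 = Q1 *m A *m Q1^T by eexists.
have symA1 : A1^T = A1 by rewrite A1def !trmx_mul trmxK symA mulmxA.
have rowA1 : row 0 A1 = a *: delta_mx 0 0.
  rewrite A1def !row_mul Qv vA -scalemxAl; congr (_ *: _).
  by rewrite -Qv -row_mul QQ row1.
have rA1 j : A1 0 j = a *+ (0 == j).
  have := congr1 (fun M : 'rV_(1 + n) => M 0 j) rowA1.
  by rewrite !mxE eqxx /= => ->; rewrite mulr_natr eq_sym.
pose A2 := drsubmx A1.
have A1E : A1 = block_mx a%:M 0 0 A2.
  rewrite -[A1]submxK; congr block_mx.
  - apply/matrixP => i j; rewrite !ord1 !mxE; rewrite (_ : lshift n 0 = 0); last exact: val_inj.
    by rewrite rA1.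
  - apply/matrixP => i j; rewrite !ord1 !mxE (_ : lshift n 0 = 0); last exact: val_inj.
    by rewrite rA1 mulr0n.
  - apply/matrixP => i j; rewrite !ord1 !mxE -symA1 mxE (_ : lshift n 0 = 0); last exact: val_inj.
    by rewrite rA1 mulr0n.
have chA1 : char_poly A1 = char_poly A.
  rewrite A1def.
  have Qu : Q1 \in unitmx by case/mulmx1_unit: QQ.
  have <- : invmx Q1 = Q1^T by apply: (can_inj (mulKmx Qu)); rewrite QQ mulmxV.
  exact: char_poly_conj.
have symA2 : A2^T = A2 by rewrite /A2 trmx_drsub symA1.
have chA2 : char_poly A2 = \prod_(i < n) ('X - ((\row_i k 0 (lift 0 i)) 0 i)%:P).
  apply: (@mulfI _ ('X - a%:P)); first by rewrite polyXsubC_eq0.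
  transitivity (char_poly A1).
    rewrite A1E /char_poly char_block_diag_mx det_ublock; congr (_ * _).
    by rewrite det_mx11 !mxE eqxx !mulr1n.
  rewrite chA1 chA big_ord_recl; congr (_ * _); apply: eq_bigr => i _.
  by rewrite mxE.
have [Q2 QQ2 Q2A] := IH _ _ symA2 chA2.
pose P : 'M[R]_(1 + n) := block_mx 1%:M 0 0 Q2.
have PP : P *m P^T = 1%:M.
  rewrite /P tr_block_mx !trmx0 trmx1 mulmx_block !mulmx0 !mul0mx !mulmx1 !addr0 !add0r QQ2.
  by rewrite -scalar_mx_block.
exists (P *m Q1).
  by rewrite trmx_mul mulmxA -(mulmxA P) QQ mulmx1.
have -> : P *m Q1 *m A *m (P *m Q1)^T = P *m A1 *m P^T.
  by rewrite trmx_mul A1def !mulmxA.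
rewrite A1E /P tr_block_mx !trmx0 trmx1 !mulmx_block !mulmx0 !mul0mx !mulmx1 !mul1mx.
rewrite !addr0 !add0r mul0mx Q2A.
apply/matrixP => i j; rewrite [RHS]mxE.
case: (@split_ordP 1 n i) => i' ->; case: (@split_ordP 1 n j) => j' ->.
- apply: (etrans (@block_mxEul R 1 n 1 n _ _ _ _ i' j')).
  by rewrite !ord1 mxE eqxx eqxx; congr (k 0 _ *+ _); exact: val_inj.
- apply: (etrans (@block_mxEur R 1 n 1 n _ _ _ _ i' j')).
  by rewrite mxE (@eq_lrshift 1 n) mulr0n.
- apply: (etrans (@block_mxEdl R 1 n 1 n _ _ _ _ i' j')).
  by rewrite mxE (@eq_rlshift 1 n) mulr0n.
- apply: (etrans (@block_mxEdr R 1 n 1 n _ _ _ _ i' j')).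
  by rewrite !mxE (@eq_rshift 1 n); congr (k 0 _ *+ _); exact: val_inj.
Qed.

End RealSpectralTheorem.

(** * Linear algebra of the graph metric and its inverse square root *)

Section GraphMetric.
Variables (R : realType) (n : nat).
Implicit Types (q : 'rV[R]_n) (z : R) (H : 'M[R]_n).

Definition graph_metric q : 'M[R]_n := 1%:M + q^T *m q.

(** The Sherman-Morrison formula. *)
Definition graph_metric_inv q : 'M[R]_n := 1%:M - (wfun q ^- 2) *: (q^T *m q).

(* [D^2 ((|x|^2 + u^2) / 2)], for [u] of value [z], gradient [q], Hessian [H] *)
Definition half_square_hess z q H : 'M[R]_n := graph_metric q + z *: H.

Definition shape_mx z q H : 'M[R]_n :=
  (wfun q)^-1 *: (graph_metric_inv q *m half_square_hess z q H).

Lemma wfun_sqr q : wfun q ^+ 2 = 1 + \sum_i q 0 i ^+ 2.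
Proof. by rewrite sqr_sqrtr// addr_ge0// sumr_ge0// => i _; exact: sqr_ge0. Qed.

Lemma wfun_ge1 q : 1 <= wfun q.
Proof.
rewrite -(@expr_ge1 _ 2)// ?sqrtr_ge0// wfun_sqr lerDl.
by apply: sumr_ge0 => i _; exact: sqr_ge0.
Qed.

Lemma wfun_gt0 q : 0 < wfun q.
Proof. exact: lt_le_trans (wfun_ge1 q). Qed.

Lemma row_dotE q : q *m q^T = (wfun q ^+ 2 - 1)%:M.
Proof.
rewrite [LHS]mx11_scalar wfun_sqr addrC addKr; congr (_%:M); rewrite mxE.
by apply: eq_bigr => i _; rewrite mxE expr2.
Qed.

Lemma outer_sqr q : (q^T *m q) *m (q^T *m q) = (wfun q ^+ 2 - 1) *: (q^T *m q).
Proof. by rewrite mulmxA -(mulmxA _ q) row_dotE mul_mx_scalar -scalemxAl. Qed.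

(** The metric, its inverse and [gamma] are all of the form [1 + a q^T q], so identities between
    them become scalar ones. *)
Let comb q (a b : R) : (1%:M + a *: (q^T *m q)) *m (1%:M + b *: (q^T *m q)) =
  1%:M + (a + b + a * b * (wfun q ^+ 2 - 1)) *: (q^T *m q).
Proof.
rewrite mulmxDl mul1mx mulmxDr mulmx1 -scalemxAl -scalemxAr outer_sqr !scalerA.
by rewrite -addrA -!scalerDl; congr (_ + _ *: _); ring.
Qed.

Lemma gammaE q : gamma q = 1%:M + (- (wfun q * (1 + wfun q))^-1) *: (q^T *m q).
Proof.
apply/matrixP => i j; rewrite !mxE big_ord1 !mxE mulNr; congr (_ - _).
by rewrite mulrC.
Qed.

Lemma gamma_sym q : (gamma q)^T = gamma q.
Proof. by apply/matrixP => i j; rewrite !mxE eq_sym [q 0 j * _]mulrC. Qed.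

Let w0 q := lt0r_neq0 (wfun_gt0 q).
Let w1 q : 1 + wfun q != 0.
Proof. by rewrite lt0r_neq0// addr_gt0// wfun_gt0. Qed.

Lemma gamma_sqr q : gamma q *m gamma q = graph_metric_inv q.
Proof.
rewrite gammaE comb /graph_metric_inv -scaleNr; congr (_ + _ *: _).
by field; rewrite w0 w1.
Qed.

Lemma graph_metricV q : graph_metric q *m graph_metric_inv q = 1%:M.
Proof.
rewrite /graph_metric /graph_metric_inv -scaleNr -[q^T *m q in X in X *m _]scale1r comb.
rewrite [X in X *: _](_ : _ = 0) ?scale0r ?addr0//.
by field; rewrite w0.
Qed.

Lemma gamma_metric q : gamma q *m graph_metric q *m gamma q = 1%:M.
Proof.
rewrite gammaE /graph_metric -[q^T *m q in X in _ *m X *m _]scale1r !comb.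
rewrite [X in X *: _](_ : _ = 0) ?scale0r ?addr0//.
by field; rewrite w0 w1.
Qed.

Lemma gamma_unit q : gamma q \in unitmx.
Proof. by have := gamma_metric q; rewrite -mulmxA => /mulmx1_unit[]. Qed.

Lemma AmatE z q H : Amat z q H =
  (wfun q)^-1 *: (gamma q *m half_square_hess z q H *m gamma q).
Proof.
rewrite /Amat /half_square_hess mulmxDr mulmxDl gamma_metric.
by rewrite -scalemxAr -scalemxAl.
Qed.

(** Conjugation by [gamma], the inverse square root of the metric, carries the symmetric matrix to
    the shape operator in coordinates. *)
Lemma char_poly_shape z q H : char_poly (shape_mx z q H) = char_poly (Amat z q H).
Proof.
rewrite -(char_poly_conj (Amat z q H) (gamma_unit q)); congr char_poly.
rewrite AmatE -scalemxAr -scalemxAl /shape_mx; congr (_ *: _).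
by rewrite -gamma_sqr !mulmxA mulmxK// gamma_unit.
Qed.

(** The frame is [z *: (Q *m gamma q)] with [Q] diagonalizing [Amat z q H]: its rows are orthonormal
    for the hyperbolic metric [z^-2 g] and are principal directions. *)
Lemma frame_exists z q H (k : 'rV[R]_n) : z != 0 -> H^T = H ->
  char_poly (Amat z q H) = \prod_(i < n) ('X - (k 0 i)%:P) ->
  exists T : 'M[R]_n,
    [/\ T \in unitmx,
        T *m graph_metric q *m T^T = (z ^+ 2)%:M,
        T^T *m T = z ^+ 2 *: graph_metric_inv q &
        T *m half_square_hess z q H *m T^T = (z ^+ 2 * wfun q) *: diag_mx k].
Proof.
move=> z0 symH chA; have [Q QQ QA] := spectral_theorem (Amat_sym z q symH) chA.
have QQ' := mulmx1C QQ.
have Qu : Q \in unitmx by case/mulmx1_unit: QQ.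
exists (z *: (Q *m gamma q)).
have conjE (M : 'M[R]_n) : (z *: (Q *m gamma q)) *m M *m (z *: (Q *m gamma q))^T =
    z ^+ 2 *: (Q *m (gamma q *m M *m gamma q) *m Q^T).
  rewrite linearZ /= trmx_mul gamma_sym -!scalemxAl -scalemxAr scalerA -expr2.
  by rewrite !mulmxA.
split.
- by rewrite unitmxZ ?unitfE// unitmx_mul Qu gamma_unit.
- by rewrite conjE gamma_metric mulmx1 QQ scale_scalar_mx mulr1.
- rewrite [(z *: _)^T]linearZ /= trmx_mul gamma_sym -scalemxAl -scalemxAr scalerA -expr2.
  by rewrite mulmxA -(mulmxA _ Q^T) QQ' mulmx1 gamma_sqr.
- rewrite conjE -QA AmatE -scalemxAr -scalemxAl scalerA mulfK//; exact: w0.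
Qed.

End GraphMetric.

Local Open Scope classical_set_scope.
Local Open Scope ring_scope.

(** * The interior maximum *)

Section HasJetMatrix.
Variable R : rcfType.

Definition hasjet_mx m n (M : R -> 'M[R]_(m, n)) : Type :=
  forall i j, hasjet (fun s => M s i j).

Lemma eq_hasjet (f g : R -> R) : f =1 g -> hasjet f -> hasjet g.
Proof. by move=> fg [bc j]; apply: (jet2_hasjet (eq_jet2 fg j)). Qed.

Lemma hasjet_mxM m n p (M : R -> 'M[R]_(m, n)) (N : R -> 'M[R]_(n, p)) :
  hasjet_mx M -> hasjet_mx N -> hasjet_mx (fun s => M s *m N s).
Proof.
move=> jM jN i j; apply: (@eq_hasjet (fun s => \sum_l M s i l * N s l j)).
  by move=> s; rewrite mxE.
by apply: hasjet_sum => l; exact: hasjetM.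
Qed.

Lemma hasjet_mxD m n (M N : R -> 'M[R]_(m, n)) :
  hasjet_mx M -> hasjet_mx N -> hasjet_mx (fun s => M s + N s).
Proof.
move=> jM jN i j; apply: (@eq_hasjet (fun s => M s i j + N s i j)).
  by move=> s; rewrite mxE.
exact: hasjetD.
Qed.

Lemma hasjet_mxZ m n (c : R -> R) (M : R -> 'M[R]_(m, n)) :
  hasjet c -> hasjet_mx M -> hasjet_mx (fun s => c s *: M s).
Proof.
move=> jc jM i j; apply: (@eq_hasjet (fun s => c s * M s i j)).
  by move=> s; rewrite mxE.
exact: hasjetM.
Qed.

Lemma hasjet_mx_cst m n (M : 'M[R]_(m, n)) : hasjet_mx (fun=> M).
Proof. by move=> i j; exact: hasjet_cst. Qed.

Lemma hasjet_mx_tr m n (M : R -> 'M[R]_(m, n)) :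
  hasjet_mx M -> hasjet_mx (fun s => (M s)^T).
Proof.
by move=> jM i j; apply: eq_hasjet (jM j i) => s; rewrite mxE.
Qed.

End HasJetMatrix.

Section WfunJets.
Variables (R : realType) (n : nat) (q : R -> 'rV[R]_n) (z : R -> R) (H : R -> 'M[R]_n).
Hypotheses (jq : hasjet_mx q) (jz : hasjet z) (jH : hasjet_mx H).

Lemma hasjet_wfunV : hasjet (fun s => (wfun (q s))^-1).
Proof.
apply: hasjetV; first exact: wfun_gt0.
apply: hasjet_sqrt; first by rewrite -wfun_sqr exprn_gt0// wfun_gt0.
apply: hasjetD; first exact: hasjet_cst.
apply: hasjet_sum => i; apply: (@eq_hasjet _ (fun s => q s 0 i * q s 0 i)).
  by move=> s; rewrite expr2.
by apply: hasjetM; exact: jq.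
Qed.

Lemma hasjet_shape_mx : hasjet_mx (fun s => shape_mx (z s) (q s) (H s)).
Proof.
apply: hasjet_mxZ; first exact: hasjet_wfunV.
have jqq : hasjet_mx (fun s => (q s)^T *m q s).
  by apply: hasjet_mxM => //; exact: hasjet_mx_tr.
apply: hasjet_mxM.
  have jV2 : hasjet (fun s => - wfun (q s) ^- 2).
    apply: (@eq_hasjet _ (fun s => - ((wfun (q s))^-1 * (wfun (q s))^-1))).
      by move=> s; rewrite -invfM expr2.
    by apply: hasjetN; apply: hasjetM; exact: hasjet_wfunV.
  move=> i j; apply: eq_hasjet (hasjet_mxD (hasjet_mx_cst 1%:M) (hasjet_mxZ jV2 jqq) i j).
  by move=> s; rewrite scaleNr.
apply: hasjet_mxD; last exact: hasjet_mxZ.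
by apply: hasjet_mxD => //; exact: hasjet_mx_cst.
Qed.

End WfunJets.

Section DirectionalSymmetry.
Variables (R : realType) (E : normedModType R) (O : set E).
Hypothesis oO : open O.
Implicit Types (f g : E -> R) (a b c d x : E).

Lemma D_congr f g a x : O x -> (forall y, O y -> f y = g y) -> Cd O 1 f ->
  'D_a f x = 'D_a g x.
Proof.
move=> Ox fg cf; have [df _] := Cd_dir1 a cf.
by case: (is_derive_congr oO Ox fg (df x Ox)).
Qed.

Lemma D3_swap12 f a b c x : Cd O 3 f -> O x ->
  'D_a ('D_b ('D_c f)) x = 'D_b ('D_a ('D_c f)) x.
Proof. by move=> cf Ox; exact: (Schwarz oO a b (Cd_D c cf) Ox). Qed.

Lemma D3_swap23 f a b c x : Cd O 3 f -> O x ->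
  'D_a ('D_b ('D_c f)) x = 'D_a ('D_c ('D_b f)) x.
Proof.
move=> cf Ox.
have h y : O y -> 'D_b ('D_c f) y = 'D_c ('D_b f) y.
  by move=> Oy; exact: (Schwarz oO b c (CdW cf) Oy).
exact: (D_congr a Ox h (Cd_D b (Cd_D c cf))).
Qed.

Lemma D4_comm f a b x : Cd O 4 f -> O x ->
  'D_a ('D_a ('D_b ('D_b f))) x = 'D_b ('D_b ('D_a ('D_a f))) x.
Proof.
move=> cf Ox.
have e1 := D3_swap23 a a b (Cd_D b cf) Ox.
have e2 := D3_swap12 a b a (Cd_D b cf) Ox.
have h y : O y -> 'D_a ('D_a ('D_b f)) y = 'D_a ('D_b ('D_a f)) y.
  by move=> Oy; exact: (D3_swap23 a a b (CdW cf) Oy).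
have e3 := D_congr b Ox h (Cd_D a (Cd_D a (Cd_D b cf))).
have e4 := D3_swap23 b a b (Cd_D a cf) Ox.
exact: (etrans e1 (etrans e2 (etrans e3 e4))).
Qed.

End DirectionalSymmetry.

Lemma fcurv_prod (R : realType) n p (k : 'rV[R]_n) (sigma : R) :
  (0 < p)%N -> (p <= n)%N -> Pcone p k -> fcurv p k = sigma ->
  \prod_(I : {set 'I_n} | #|I| == p) lambda k I = (p%:R * sigma) `^ ('C(n, p))%:R.
Proof.
move=> p0 pn kP <-; set P := \prod_(I | _) _.
have P0 : 0 <= P by apply: prodr_ge0 => I /eqP pI; rewrite ltW// kP.
rewrite /fcurv -/P mulrA mulfV ?mul1r; last by rewrite pnatr_eq0 -lt0n.
rewrite -powRrM mulVf ?powRr1// pnatr_eq0 -lt0n bin_gt0 //.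
Qed.

Lemma trace_eigenvalues (R : realType) n (A : 'M[R]_n) (k : 'rV[R]_n) :
  A^T = A -> is_eigenvalues A k -> \tr A = \sum_i k 0 i.
Proof.
move=> symA /(spectral_theorem symA)[Q QQ QA].
have <- : \tr (diag_mx k) = \sum_i k 0 i.
  by apply: eq_bigr => i _; rewrite mxE eqxx.
by rewrite -QA mxtrace_mulC mulmxA (mulmx1C QQ) mul1mx.
Qed.

Definition mean_curv (R : realType) n (u : 'rV[R]_n -> R) x : R :=
  \tr (Amat (u x) (grad u x) (hess u x)).

Lemma divided_max (R : realFieldType) (a b w w1 : R) p : 0 < w -> 0 < w1 ->
  a * w ^+ p <= b * w1 ^+ p -> a * w1^-1 ^+ p <= b * w^-1 ^+ p.
Proof.
move=> w0 w10 h; rewrite !exprVn ler_pdivrMr ?exprn_gt0// mulrAC.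
by rewrite ler_pdivlMr ?exprn_gt0.
Qed.

Section InteriorMaximum.
Variables (R : realType) (n p : nat) (O : set 'rV[R]_n) (u : 'rV[R]_n -> R).
Variables (sigma : R) (x0 : 'rV[R]_n).
Hypothesis oO : open O.
Hypothesis u4 : Cd O 4 u.
Hypotheses (p2 : (2 <= p)%N) (pn : (p < n)%N).
Hypothesis sigma0 : 0 < sigma.
Hypothesis Ox0 : O x0.
Hypothesis ux0 : 0 < u x0.
Hypothesis adm : admissible p O u.
Hypothesis feq : forall x, O x -> fcurv p (kappa u x) = sigma.
Hypothesis nu_ge : forall x, O x -> sigma <= nu_vertical u x.
Hypothesis maxx : forall x, O x ->
  mean_curv u x ^+ p.-1 * wfun (grad u x) ^+ p <=
  mean_curv u x0 ^+ p.-1 * wfun (grad u x0) ^+ p.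

Let z := u x0.
Let q0 := grad u x0.
Let k := kappa u x0.
Let nu := (wfun q0)^-1.

Let symA x : O x -> (Amat (u x) (grad u x) (hess u x))^T = Amat (u x) (grad u x) (hess u x).
Proof. by move=> Ox; apply: Amat_sym; exact: (hess_sym oO (CdW (CdW u4)) Ox). Qed.

Let eigA x : O x -> is_eigenvalues (Amat (u x) (grad u x) (hess u x)) (kappa u x).
Proof. by move=> Ox; apply: eigenvaluesP; exact: symA. Qed.

Variable T : 'M[R]_n.
Hypothesis Tu : T \in unitmx.
Hypothesis Tg : T *m graph_metric q0 *m T^T = (z ^+ 2)%:M.
Hypothesis TT : T^T *m T = z ^+ 2 *: graph_metric_inv q0.
Hypothesis TV : T *m half_square_hess z q0 (hess u x0) *m T^T =
  (z ^+ 2 * wfun q0) *: diag_mx k.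

(** The frame stays constant along each line [X d], so iterated derivatives of [u] commute with no
    connection terms. Dividing by [z] gives [U d 0 = 1], which removes the height from every later
    formula. *)
Let tau i := row i T.
Let X d (s : R) := x0 + s *: tau d.
Let Q d s : 'rV[R]_n := z^-1 *: (grad u (X d s) *m T^T).
Let C d s : 'M[R]_n := z^-1 *: (T *m hess u (X d s) *m T^T).
Let G : 'M[R]_n := z ^- 2 *: (T *m T^T).
Let U d s := u (X d s) / z.
Let V d s := (wfun (grad u (X d s)))^-1.
Let B d s : 'M[R]_n := invmx T^T *m
  shape_mx (u (X d s)) (grad u (X d s)) (hess u (X d s)) *m T^T.

Let zN0 : z != 0. Proof. exact: lt0r_neq0. Qed.
Let wN0 (q : 'rV[R]_n) : wfun q != 0 :> R. Proof. exact: lt0r_neq0 (wfun_gt0 q). Qed.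

Let TTu : T^T \in unitmx. Proof. by rewrite unitmx_tr. Qed.

Let X0 d : X d 0 = x0.
Proof. by rewrite /X scale0r addr0. Qed.

Let GQ d s : G + (Q d s)^T *m Q d s =
  z ^- 2 *: (T *m graph_metric (grad u (X d s)) *m T^T).
Proof.
rewrite /G /Q /graph_metric mulmxDr mulmxDl mulmx1 scalerDr; congr (_ + _).
rewrite [(z^-1 *: _)^T]linearZ /= trmx_mul trmxK -scalemxAl -scalemxAr scalerA.
by rewrite !mulmxA -invfM expr2.
Qed.

Let GQC d s : G + (Q d s)^T *m Q d s + U d s *: C d s =
  z ^- 2 *: (T *m half_square_hess (u (X d s)) (grad u (X d s)) (hess u (X d s)) *m T^T).
Proof.
rewrite GQ /half_square_hess [X in _ = _ *: X](_ : _ =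
  T *m graph_metric (grad u (X d s)) *m T^T + u (X d s) *: (T *m hess u (X d s) *m T^T)).
  rewrite scalerDr; congr (_ + _); rewrite /U /C !scalerA; congr (_ *: _).
  by rewrite expr2 invfM; ring.
by rewrite mulmxDr mulmxDl -scalemxAr -scalemxAl.
Qed.

Let BE d s : (G + (Q d s)^T *m Q d s) *m B d s =
  V d s *: (G + (Q d s)^T *m Q d s + U d s *: C d s).
Proof.
rewrite GQC GQ /B -scalemxAl scalerA mulrC -scalerA; congr (_ *: _).
rewrite !mulmxA mulmxK// /shape_mx -scalemxAr -scalemxAl; congr (_ *: _).
by rewrite [T *m _ *m (_ *m _)]mulmxA -(mulmxA T) graph_metricV mulmx1.
Qed.

Let GQ0 d : G + (Q d 0)^T *m Q d 0 = 1%:M.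
Proof. by rewrite GQ X0 Tg scale_scalar_mx mulVf// expf_neq0. Qed.

Let GQC0 d : G + (Q d 0)^T *m Q d 0 + U d 0 *: C d 0 = wfun q0 *: diag_mx k.
Proof. by rewrite GQC X0 TV scalerA mulrA mulVf ?mul1r// expf_neq0. Qed.

Let U0 d : U d 0 = 1.
Proof. by rewrite /U X0 divff. Qed.

Let V0 d : V d 0 = nu.
Proof. by rewrite /V X0. Qed.

Let C0 d : C d 0 = wfun q0 *: diag_mx k - 1%:M.
Proof. by have := GQC0 d; rewrite GQ0 U0 scale1r => <-; rewrite addrC addKr. Qed.

Let B0 d : B d 0 = diag_mx k.
Proof.
have := BE d 0; rewrite GQC0 GQ0 mul1mx => ->.
by rewrite V0 scalerA mulVf ?scale1r.
Qed.

(** [TT] turns frame components back into Euclidean ones; the subtracted square comes from the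
    inverse metric at [x0]. *)
Let trQ d s : Q d s *m (Q d s)^T =
  (wfun (grad u (X d s)) ^+ 2 - 1 - wfun q0 ^- 2 * (grad u (X d s) *m q0^T) 0 0 ^+ 2)%:M.
Proof.
set r := grad u _; rewrite /Q -/r [(z^-1 *: _)^T]linearZ /= trmx_mul trmxK.
rewrite -scalemxAl -scalemxAr scalerA mulmxA -(mulmxA r) TT.
rewrite /graph_metric_inv -scalemxAr -scalemxAl scalerA.
have -> : z^-1 * z^-1 * z ^+ 2 = 1 by field.
rewrite scale1r mulmxBr mulmxBl mulmx1 row_dotE -scalemxAr -scalemxAl.
rewrite mulmxA -(mulmxA _ q0); set a := r *m q0^T.
have -> : q0 *m r^T = a^T by rewrite /a trmx_mul trmxK.
rewrite [a]mx11_scalar tr_scalar_mx mul_scalar_mx !scale_scalar_mx -scalar_mx_is_additive.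
by rewrite [(a 0 0)%:M 0 0]mxE eqxx mulr1n -expr2.
Qed.

Let trtQ d s : (Q d 0 *m (Q d s)^T) 0 0 =
  wfun q0 ^- 2 * (grad u (X d s) *m q0^T) 0 0.
Proof.
set r := grad u _; rewrite /Q X0 -/r -/q0 [(z^-1 *: _)^T]linearZ /= trmx_mul trmxK.
rewrite -scalemxAl -scalemxAr scalerA mulmxA -(mulmxA q0) TT.
rewrite /graph_metric_inv -scalemxAr -scalemxAl scalerA.
have -> : z^-1 * z^-1 * z ^+ 2 = 1 by field.
rewrite scale1r mulmxBr mulmxBl mulmx1 -scalemxAr -scalemxAl mulmxA row_dotE.
rewrite mul_scalar_mx -scalemxAl scalerA.
have -> : q0 *m r^T = (r *m q0^T)^T by rewrite trmx_mul trmxK.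
rewrite !mxE; field; exact: wN0.
Qed.

Let cu2 : Cd O 2 u. Proof. exact: CdW (CdW u4). Qed.
Let cu1 : Cd O 1 u. Proof. exact: CdW cu2. Qed.

Let Q_D d s i : O (X d s) -> Q d s 0 i = z^-1 * 'D_(tau i) u (X d s).
Proof.
move=> OX; rewrite /Q mxE; congr (_ * _).
apply: (etrans _ (esym (D_coord oO (tau i) cu1 OX))).
by rewrite mxE; apply: eq_bigr => a _; rewrite !mxE mulrC.
Qed.

Let C_D d s i j : O (X d s) ->
  C d s i j = z^-1 * 'D_(tau i) ('D_(tau j) u) (X d s).
Proof.
move=> OX; rewrite /C mxE; congr (_ * _).
apply: (etrans _ (esym (D2_coord oO (tau i) (tau j) cu2 OX))).
rewrite mxE exchange_big /=; apply: eq_bigr => b _; rewrite mxE mulr_suml.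
by apply: eq_bigr => a _; rewrite !mxE mulrAC.
Qed.

Let line_near : exists2 eps : R, 0 < eps & forall d s, `|s| < eps -> O (X d s).
Proof.
have [e e0 he] := open_ball oO Ox0.
pose M := 1 + \sum_d `|tau d|.
have M0 : 0 < M by rewrite ltr_wpDr ?sumr_ge0.
exists (e / M); first by rewrite divr_gt0.
move=> d s; rewrite ltr_pdivlMr// => hs; apply: he.
rewrite /X addrC addKr normrZ; apply: le_lt_trans hs; rewrite ler_wpM2l//.
by rewrite /M (bigD1 d)//= addrCA lerDl addr_ge0 ?sumr_ge0.
Qed.

Let kf i := k 0 i.
Let t i := Q i 0 0 i.
Let U3 i j d := z^-1 * 'D_(tau d) ('D_(tau i) ('D_(tau j) u)) x0.
Let U4 i d := z^-1 * 'D_(tau d) ('D_(tau d) ('D_(tau i) ('D_(tau i) u))) x0.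
Let Y d i j := z^-1 * 'D_(tau d) ('D_(tau d) ('D_(tau i) ('D_(tau j) u))) x0.
Let hc := hcoef kf nu.

Let tE d i : Q d 0 0 i = t i.
Proof. by rewrite /t /Q !X0. Qed.

Let nuN0 : nu != 0. Proof. by rewrite invr_eq0. Qed.

Let hcE i : hc i = wfun q0 * k 0 i - 1.
Proof. by rewrite /hc /hcoef /kf /nu; field. Qed.

Let C0E d i j : C d 0 i j = hc i * (i == j)%:R.
Proof.
by rewrite C0 !mxE hcE; case: (i == j); rewrite /= ?mulr1n ?mulr0n; ring.
Qed.

Let OX0 d : O (X d 0). Proof. by rewrite X0. Qed.

Let cD v : Cd O 3 ('D_v u). Proof. exact: Cd_D u4. Qed.
Let cDD v w : Cd O 2 ('D_v ('D_w u)). Proof. exact: Cd_D (cD w). Qed.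

Let jline f d (g : R -> R) a b c : Cd O 2 f ->
  (forall s, O (X d s) -> g s = z^-1 * f (X d s)) ->
  a = z^-1 * f x0 -> b = z^-1 * 'D_(tau d) f x0 ->
  c = z^-1 * 'D_(tau d) ('D_(tau d) f) x0 -> jet2 g a b (c / 2).
Proof.
move=> cf fg -> -> ->; rewrite -mulrA; have [eps eps0 heps] := line_near.
apply: (jet2_ext eps0 _ (jet2Z z^-1 (jet2_along oO (tau d) cf Ox0))).
by move=> s /(heps d)/fg ->.
Qed.

Let tD d : t d = z^-1 * 'D_(tau d) u x0.
Proof. by have := Q_D d (OX0 d); rewrite tE X0. Qed.

Let CD (d i j : 'I_n) : hc i * (i == j)%:R = z^-1 * 'D_(tau i) ('D_(tau j) u) x0.
Proof. by have := C_D i j (OX0 d); rewrite C0E X0. Qed.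

Let jU d : jet2 (U d) 1 (t d) (hc d / 2).
Proof.
apply: (jline cu2 _ _ (tD d)).
- by move=> s _; rewrite /U mulrC.
- by rewrite mulVf.
- by rewrite -(CD d) eqxx mulr1.
Qed.

Let jQ d i : jet2 (fun s => Q d s 0 i) (t i) (hc d * (i == d)%:R) (U3 i d d / 2).
Proof.
apply: (jline (CdW (cD (tau i))) _ (tD i)).
- by move=> s; exact: Q_D.
- by rewrite -(CD d) eq_sym.
- exact: (congr1 (fun r => z^-1 * r) (D3_swap23 oO (tau d) (tau i) (tau d) (CdW u4) Ox0)).
Qed.

Let jC d i j :
  jet2 (fun s => C d s i j) (hc i * (i == j)%:R) (U3 i j d) (Y d i j / 2).
Proof.
exact: (jline (cDD (tau i) (tau j)) (@C_D d ^~ i ^~ j) (CD d i j) erefl erefl).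
Qed.

Let U3C i j m : U3 i j m = U3 j i m.
Proof. exact: (congr1 (fun r => z^-1 * r) (D3_swap23 oO (tau m) (tau i) (tau j) (CdW u4) Ox0)). Qed.

Let U3R i j m : U3 i j m = U3 i m j.
Proof.
have e1 := D3_swap12 oO (tau m) (tau i) (tau j) (CdW u4) Ox0.
have e2 := D3_swap23 oO (tau i) (tau m) (tau j) (CdW u4) Ox0.
have e3 := D3_swap12 oO (tau i) (tau j) (tau m) (CdW u4) Ox0.
exact: (congr1 (fun r => z^-1 * r) (etrans e1 (etrans e2 e3))).
Qed.

Let U4C i j : U4 i j = U4 j i.
Proof. exact: (congr1 (fun r => z^-1 * r) (D4_comm oO (tau j) (tau i) u4 Ox0)). Qed.

Let jgrad d : hasjet_mx (fun s => grad u (X d s)).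
Proof.
move=> i j.
apply: (@eq_hasjet _ (fun s => pderiv j u (x0 + s *: tau d))).
  by move=> s; rewrite mxE.
exact: (jet2_hasjet (jet2_along oO (tau d) (CdW (cD _)) Ox0)).
Qed.

Let jhess d : hasjet_mx (fun s => hess u (X d s)).
Proof.
move=> i j; apply: (@eq_hasjet _ (fun s => pderiv i (pderiv j u) (x0 + s *: tau d))).
  by move=> s; rewrite mxE.
exact: (jet2_hasjet (jet2_along oO (tau d) (cDD _ _) Ox0)).
Qed.

Let jV d : hasjet (V d).
Proof. exact: (hasjet_wfunV (jgrad d)). Qed.

Let jB d i j : hasjet (fun s => B d s i j).
Proof.
apply: hasjet_mxM; last exact: hasjet_mx_cst.
apply: hasjet_mxM; first exact: hasjet_mx_cst.
apply: (hasjet_shape_mx (jgrad d) _ (jhess d)).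
exact: (jet2_hasjet (jet2_along oO (tau d) cu2 Ox0)).
Qed.

Let char_B d s : char_poly (B d s) =
  char_poly (Amat (u (X d s)) (grad u (X d s)) (hess u (X d s))).
Proof.
rewrite -char_poly_shape /B.
have Tvu : invmx T^T \in unitmx by rewrite unitmx_inv.
by rewrite -[X in _ *m X](invmxK T^T); exact: char_poly_conj.
Qed.

Let tr_B d s : \tr (B d s) = mean_curv u (X d s).
Proof.
rewrite /B mxtrace_mulC mulmxA mulmxV// mul1mx /mean_curv /shape_mx AmatE.
rewrite !linearZ /=; congr (_ * _).
by rewrite -gamma_sqr [RHS]mxtrace_mulC mulmxA.
Qed.

Let trk : mean_curv u x0 = \sum_i kf i.
Proof. exact: (trace_eigenvalues (symA Ox0) (eigA Ox0)). Qed.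

Lemma frame_interior_bound : 0 < mean_curv u x0 ->
  mean_curv u x0 <= 4 * n%:R ^+ 2 + 2 * n%:R ^+ 4 + 4 * n%:R / sigma.
Proof.
rewrite trk => H0; have [eps eps0 heps] := line_near.
have kP : forall I : {set 'I_n}, #|I| = p -> 0 < ssum kf I by exact: (adm Ox0).
have snu : sigma <= nu by exact: (nu_ge Ox0).
have t2 : \sum_i t i ^+ 2 = 1 - nu ^+ 2.
  have [i0] : exists i : 'I_n, true by exists (Ordinal (ltn_trans (ltnW p2) pn)).
  have := congr1 (fun M : 'M[R]_1 => M 0 0) (trQ i0 0); rewrite mxE => h _.
  transitivity (\sum_j Q i0 0 0 j * (Q i0 0)^T j 0).
    by apply: eq_bigr => j _; rewrite [(Q i0 0)^T _ _]mxE (tE i0 j) expr2.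
  rewrite h X0 -/q0 row_dotE !mxE eqxx !mulr1n /nu; field; exact: wN0.
have VE d s : V d s ^+ 2 * (1 + \sum_i Q d s 0 i ^+ 2 +
    (\sum_i t i * Q d s 0 i) ^+ 2 / nu ^+ 2) = 1.
  have Q2 : \sum_i Q d s 0 i ^+ 2 = (Q d s *m (Q d s)^T) 0 0.
    by rewrite [RHS]mxE; apply: eq_bigr => j _; rewrite [(Q d s)^T _ _]mxE expr2.
  have tQ : \sum_i t i * Q d s 0 i = (Q d 0 *m (Q d s)^T) 0 0.
    by rewrite [RHS]mxE; apply: eq_bigr => j _; rewrite [(Q d s)^T _ _]mxE (tE d).
  rewrite [X in 1 + X + _]Q2 [X in X ^+ 2 / _]tQ trQ trtQ.
  rewrite [(_)%:M 0 0]mxE eqxx mulr1n /V /nu.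
  have /eqP := wN0 (grad u (X d s)); have /eqP := wN0 q0.
  move: (wfun q0) (wfun (grad u (X d s))) ((grad u (X d s) *m q0^T) 0 0) => w1 w a.
  by move=> /eqP w1N /eqP wN; field; rewrite w1N wN.
apply: (@interior_trace_bound R n p kf t nu sigma U3 U4 kP p2 pn sigma0 snu H0
  U3C U3R U4C t2 U V (fun d i s => Q d s 0 i) (fun d i j s => C d s i j) B Y G eps
  jU jQ jC _ _ jV V0 jB _ VE _ eps0).
- exact: (fun d i => erefl).
- move=> i j; have := congr1 (fun M : 'M[R]_n => M i j) (GQ0 i).
  rewrite mxE [1%:M i j]mxE => <-.
  by rewrite [((Q i 0)^T *m _) i j]mxE big_ord1 [(Q i 0)^T _ _]mxE !(tE i).
- move=> d i j; by rewrite B0 mxE mulr_natr.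
- move=> d i j s; have := congr1 (fun M : 'M[R]_n => M i j) (BE d s).
  have GQm a c : (G + (Q d s)^T *m Q d s) a c = G a c + Q d s 0 a * Q d s 0 c.
    by rewrite mxE [((Q d s)^T *m _) a c]mxE big_ord1 [(Q d s)^T _ _]mxE.
  rewrite mxE => E1; transitivity (\sum_m (G + (Q d s)^T *m Q d s) i m * B d s m j).
    by apply: eq_bigr => m _; rewrite GQm.
  rewrite E1 [LHS]mxE [X in _ * X = _]mxE GQm.
  by congr (_ * (_ + _)); rewrite [LHS]mxE.
- move=> d s /(heps d) OX; exists (fun i => kappa u (X d s) 0 i).
    by rewrite char_B; exact: (eigA OX).
  have p0 : (0 < p)%N by exact: ltnW.
  exact: (etrans (fcurv_prod p0 (ltnW pn) (adm OX) (feq OX))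
     (esym (fcurv_prod p0 (ltnW pn) (adm Ox0) (feq Ox0)))).
- move=> d s /(heps d) OX; rewrite tr_B -trk.
  by apply: divided_max (maxx OX); exact: wfun_gt0.
Qed.

End InteriorMaximum.

Lemma interior_max_bound (R : realType) n p (O : set 'rV[R]_n) u (sigma : R) x0 :
  open O -> Ck 4 O u -> (2 <= p)%N -> (p < n)%N -> 0 < sigma -> O x0 -> 0 < u x0 ->
  admissible p O u ->
  (forall x, O x -> fcurv p (kappa u x) = sigma) ->
  (forall x, O x -> sigma <= nu_vertical u x) ->
  (forall x, O x -> mean_curv u x ^+ p.-1 * wfun (grad u x) ^+ p <=
     mean_curv u x0 ^+ p.-1 * wfun (grad u x0) ^+ p) ->
  0 < mean_curv u x0 ->
  mean_curv u x0 <= 4 * n%:R ^+ 2 + 2 * n%:R ^+ 4 + 4 * n%:R / sigma.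
Proof.
move=> oO ck4 p2 pn s0 Ox0 ux0 adm feq nuge maxx H0.
have u4 : Cd O 4 u by exact: (Ck_Cd oO (s := [::]) ck4).
have symH := hess_sym oO (CdW (CdW u4)) Ox0.
have eigA := eigenvaluesP (Amat_sym (u x0) (grad u x0) symH).
have [T [Tu Tg TT TV]] := frame_exists (lt0r_neq0 ux0) symH eigA.
exact: (frame_interior_bound oO u4 p2 pn s0 Ox0 ux0 adm feq nuge maxx Tu Tg TT TV H0).
Qed.

(** * The global estimate *)

Lemma exists_draw n p (i : 'I_n) : (0 < p <= n)%N ->
  exists2 I : {set 'I_n}, #|I| = p & i \in I.
Proof.
move=> /andP[p0 pn].
have : (0 < #|[set A : {set 'I_n} | #|A| == p]%SET|)%N by rewrite card_draws card_ord bin_gt0.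
move=> /card_gt0P[I]; rewrite inE => /eqP Ip.
have /card_gt0P[a aI] : (0 < #|I|)%N by rewrite Ip.
exists (tperm a i @: I); first by rewrite card_imset//; exact: perm_inj.
by apply/imsetP; exists a => //; rewrite tpermL.
Qed.

(** * Control of single curvatures by their sum in the cone *)

Section ConeBounds.
Variables (R : realType) (n p : nat) (k : 'rV[R]_n).
Hypotheses (p2 : (2 <= p)%N) (pn : (p < n)%N).
Hypothesis kP : Pcone p k.

Let p0 : (0 < p)%N. Proof. exact: ltnW. Qed.

(** Up to positive factors this is the sum of the positive numbers [lambda k I] over the p-sets
    containing [i]. *)
Lemma Pcone_lower i : 0 < (n%:R - p%:R) * k 0 i + (p%:R - 1) * \sum_j k 0 j.
Proof.
have [I0 I0p iI0] : exists2 I : {set 'I_n}, #|I| = p & i \in I.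
  by apply: exists_draw; rewrite p0 ltnW.
have := sum_ssum_mem (fun j => k 0 j) i p0.
set S := \sum_(I | _) _ => h.
have S0 : 0 < S.
  rewrite /S (bigD1 I0) ?I0p ?eqxx//= ltr_wpDr ?kP//.
  by apply: sumr_ge0 => I /andP[/andP[/eqP Ip _] _]; rewrite ltW// kP.
have n1 : 0 < n%:R - 1 :> R.
  by rewrite subr_gt0 ltr1n (leq_trans p2)// ltnW.
have : 0 < npsets R p i * ((n%:R - p%:R) * k 0 i + (p%:R - 1) * \sum_j k 0 j).
  by rewrite -h mulr_gt0.
by rewrite pmulr_rgt0// /npsets (bigD1 I0) ?I0p ?eqxx//= ltr_wpDr// sumr_ge0.
Qed.

Let np1 : 1 <= n%:R - p%:R :> R.
Proof. by rewrite lerBrDr addrC natr1 ler_nat. Qed.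

Lemma Pcone_sum_gt0 : 0 < \sum_j k 0 j.
Proof.
have n0 : (0 < n)%N by exact: leq_trans pn.
have : 0 < \sum_i ((n%:R - p%:R) * k 0 i + (p%:R - 1) * \sum_j k 0 j).
  rewrite (bigD1 (Ordinal n0))//= ltr_wpDr ?Pcone_lower//.
  by apply: sumr_ge0 => i _; rewrite ltW// Pcone_lower.
set H := \sum_j k 0 j; rewrite big_split/= sumr_const card_ord -mulr_sumr -/H -[(_ * H) *+ _]mulr_natl mulrA -mulrDl.
by rewrite pmulr_rgt0// ltr_wpDr ?mulr_ge0 ?subr_ge0 ?ler1n ?subr_gt0 ?ltr_nat.
Qed.

(** As [n - p >= 1], each entry is at least [- (p - 1)] times the sum; subtracting the other entries
    from the sum gives the upper bound. *)
Lemma Pcone_norm_le i : `|k 0 i| <= n%:R * p%:R * \sum_j k 0 j.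
Proof.
have H0 := Pcone_sum_gt0; set H := \sum_j _ in H0 *.
have p1 : 2 <= p%:R :> R by rewrite ler_nat.
have low j : - ((p%:R - 1) * H) <= k 0 j.
  have := Pcone_lower j; rewrite -/H => h; have := np1.
  have [k0|k0] := lerP 0 (k 0 j); nra.
have n1 : 1 <= n%:R :> R by rewrite ler1n (leq_trans _ pn).
rewrite ler_norml; apply/andP; split.
  by apply: le_trans (low i); rewrite lerN2 ler_wpM2r ?ltW//; nra.
have -> : k 0 i = H - \sum_(j | j != i) k 0 j by rewrite /H (bigD1 i)//= addrK.
have : \sum_(j | j != i) - ((p%:R - 1) * H) <= \sum_(j | j != i) k 0 j.
  by apply: ler_sum.
rewrite sumr_const cardC1 card_ord -[- _ *+ _]mulr_natl -subn1 natrB ?(leq_trans _ pn)// => h.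
nra.
Qed.

End ConeBounds.

(** * Passage to the limit in the curvature matrix *)

Section EntrywiseLimits.
Variables (R : realType) (T : Type) (F : set_system T).
Context {FF : ProperFilter F}.

Definition mxcvg m n (M : T -> 'M[R]_(m, n)) (L : 'M[R]_(m, n)) :=
  forall i j, M x i j @[x --> F] --> L i j.

Lemma cvg_sumr (I : Type) (r : seq I) (P : pred I) (f : I -> T -> R) (l : I -> R) :
  (forall i, P i -> f i x @[x --> F] --> l i) ->
  \sum_(i <- r | P i) f i x @[x --> F] --> \sum_(i <- r | P i) l i.
Proof. by move=> fl; apply: cvg_big => //; exact: add_continuous. Qed.

Lemma mxcvg_cvg m n (M : T -> 'M[R]_(m, n)) L : mxcvg M L -> M @ F --> L.
Proof.
move=> ML; apply/cvg_ballP => e e0.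
have : \forall x \near F, forall ij : 'I_m * 'I_n, ball (L ij.1 ij.2) e (M x ij.1 ij.2).
  by apply: filter_forall => -[i j]; exact: ((cvg_ballP _ _).1 (ML i j) e e0).
by apply: filterS => x h; split=> // i j; exact: (h (i, j)).
Qed.

Lemma mxcvg_mul m n l (M : T -> 'M[R]_(m, n)) (N : T -> 'M[R]_(n, l)) A B :
  mxcvg M A -> mxcvg N B -> mxcvg (fun x => M x *m N x) (A *m B).
Proof.
move=> MA NB i j; rewrite mxE; under eq_fun do rewrite mxE.
by apply: cvg_sumr => a _; apply: cvgM; [exact: MA|exact: NB].
Qed.

Lemma mxcvg_add m n (M N : T -> 'M[R]_(m, n)) A B :
  mxcvg M A -> mxcvg N B -> mxcvg (fun x => M x + N x) (A + B).
Proof.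
move=> MA NB i j; rewrite mxE; under eq_fun do rewrite mxE.
by apply: cvgD; [exact: MA|exact: NB].
Qed.

Lemma mxcvg_scale m n (f : T -> R) (M : T -> 'M[R]_(m, n)) (a : R) A :
  f @ F --> a -> mxcvg M A -> mxcvg (fun x => f x *: M x) (a *: A).
Proof.
move=> fa MA i j; rewrite mxE; under eq_fun do rewrite mxE.
by apply: cvgM => //; exact: MA.
Qed.

Lemma mxcvg_cst m n (A : 'M[R]_(m, n)) : mxcvg (fun=> A) A.
Proof. by move=> i j; exact: cvg_cst. Qed.

Lemma cvg_mxtrace n (M : T -> 'M[R]_n) A : mxcvg M A -> \tr (M x) @[x --> F] --> \tr A.
Proof. by move=> MA; apply: cvg_sumr => i _; exact: MA. Qed.

Lemma cvg_exprn (f : T -> R) (a : R) m : f @ F --> a -> f x ^+ m @[x --> F] --> a ^+ m.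
Proof.
exact: (@continuous_cvg _ _ _ _ _ f (fun y => y ^+ m) a (@exprn_continuous R m a)).
Qed.

Variable n : nat.
Implicit Types (q : T -> 'rV[R]_n) (l : 'rV[R]_n).

Lemma cvg_wfun q l : mxcvg q l -> wfun (q x) @[x --> F] --> wfun l.
Proof.
move=> ql; apply: (@continuous_cvg _ _ _ _ _ _ Num.sqrt); first exact: sqrt_continuous.
apply: cvgD; first exact: cvg_cst.
by apply: cvg_sumr => i _; apply: cvg_exprn; exact: ql.
Qed.

Lemma mxcvg_gamma q l : mxcvg q l -> mxcvg (fun x => gamma (q x)) (gamma l).
Proof.
move=> ql i j; rewrite mxE; under eq_fun do rewrite mxE.
apply: cvgB; first exact: cvg_cst.
have qw := cvg_wfun ql.
apply: cvgM; first by apply: cvgM; exact: ql.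
apply: cvgV; last by apply: cvgM => //; apply: cvgD => //; exact: cvg_cst.
by rewrite mulf_neq0// lt0r_neq0// ?addr_gt0// wfun_gt0.
Qed.

Lemma mxcvg_Amat (z : T -> R) q (H : T -> 'M[R]_n) (z0 : R) l H0 :
  z @ F --> z0 -> mxcvg q l -> mxcvg H H0 ->
  mxcvg (fun x => Amat (z x) (q x) (H x)) (Amat z0 l H0).
Proof.
move=> zz ql HH; have gg := mxcvg_gamma ql.
apply: mxcvg_scale; first by apply: cvgV; [exact: lt0r_neq0 (wfun_gt0 l)|exact: cvg_wfun].
apply: mxcvg_add; first exact: mxcvg_cst.
apply: mxcvg_scale => //; apply: mxcvg_mul => //; exact: mxcvg_mul.
Qed.

End EntrywiseLimits.

Section BoundedOpenSets.
Variables (R : realType) (n : nat) (O : set 'rV[R]_n).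
Hypothesis bO : bounded_set O.

Lemma bounded_closure : bounded_set (closure O).
Proof.
have [M [Mr hM]] := bO; exists M; split=> // e Me x cx.
have cl : closed [set y : 'rV[R]_n | `|y| <= e].
  by apply: (preimage_closed _ (@closed_le _ e)) => y _; exact: norm_continuous.
by rewrite ((closure_id _).1 cl); apply: closureS cx => y; exact: hM.
Qed.

Lemma compact_closure : compact (closure O).
Proof. by apply: bounded_closed_compact bounded_closure _; exact: closed_closure. Qed.

(** A coordinate function has a maximum on the compact closure, and never at an interior point. *)
Lemma boundary_nonempty (i : 'I_n) : O !=set0 -> boundary O !=set0.
Proof.
move=> [y Oy].
have [||c] := @compact_EVT_max _ R (fun x : 'rV[R]_n => x 0 i) _ _ compact_closure.
- by exists y; exact: subset_closure.
- by apply: continuous_subspaceT => x; exact: coord_continuous.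
rewrite inE => cc cmax; exists c; split=> // oc.
have /nbhs_ballP[e /= e0 he] := oc.
pose d : 'rV[R]_n := delta_mx 0 i.
have d1 : 0 < 1 + `|d| by rewrite ltr_wpDr.
have : O (c + (e / (1 + `|d|)) *: d).
  apply: he; rewrite -ball_normE /= opprD addrA subrr sub0r normrN normrZ.
  by rewrite gtr0_norm ?divr_gt0// mulrAC ltr_pdivrMr// mulrDr mulr1 ltrDr.
move=> /subset_closure/mem_set/cmax; rewrite !mxE !eqxx mulr1 gerDl.
by rewrite leNgt divr_gt0.
Qed.

End BoundedOpenSets.

Section ClosureExtension.
Variables (R : realType) (n : nat) (O : set 'rV[R]_n) (u : 'rV[R]_n -> R).
Hypothesis u2 : Ck_closure 2 O u.

Lemma second_order_extension : exists g h,
  [/\ forall x, closure O x -> mxcvg (within (closure O) (nbhs x)) g (g x),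
      forall x, closure O x -> mxcvg (within (closure O) (nbhs x)) h (h x),
      forall x, O x -> g x = grad u x & forall x, O x -> h x = hess u x].
Proof.
have [_ _ ext] := u2.
have /choice[g1 g1P] : forall i : 'I_n, exists g : 'rV[R]_n -> R,
    {within closure O, continuous g} /\ forall x, O x -> g x = pderiv i u x.
  by move=> i; exact: (ext [:: i]).
have /choice[g2 g2P] : forall ij : 'I_n * 'I_n, exists g : 'rV[R]_n -> R,
    {within closure O, continuous g} /\
    forall x, O x -> g x = pderiv ij.1 (pderiv ij.2 u) x.
  by move=> ij; exact: (ext [:: ij.1; ij.2]).
exists (fun x => \row_i g1 i x), (fun x => \matrix_(i, j) g2 (i, j) x); split.
- move=> x cx i j; rewrite mxE; under eq_fun do rewrite mxE.
  exact: ((subspace_continuousP _ _).1 (g1P j).1 x cx).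
- move=> x cx i j; rewrite mxE; under eq_fun do rewrite mxE.
  exact: ((subspace_continuousP _ _).1 (g2P (i, j)).1 x cx).
- by move=> x Ox; apply/rowP => i; rewrite !mxE (g1P i).2.
- by move=> x Ox; apply/matrixP => i j; rewrite !mxE (g2P (i, j)).2.
Qed.

Lemma extendE m k (h H : 'rV[R]_n -> 'M[R]_(m, k)) x : closure O x ->
  mxcvg (within (closure O) (nbhs x)) h (h x) -> (forall y, O y -> h y = H y) ->
  extend O H x = h x.
Proof.
move=> cx hx hH; apply: cvg_lim; first exact: norm_hausdorff.
apply: mxcvg_cvg => i j.
apply: cvg_trans (hx i j).
apply: (@cvg_trans _ ((fun y => h y i j) @ within O (nbhs x))).
  by apply: fmap_within_eq => y; rewrite inE => /hH ->.
apply: cvg_fmap2; apply: within_subset; exact: subset_closure.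
Qed.

End ClosureExtension.

Lemma closure_limit_closed (X V : topologicalType) (O : set X) (f : X -> V)
    (A : set V) x :
  closure O x -> f @ within (closure O) (nbhs x) --> f x -> closed A ->
  (forall y, O y -> A (f y)) -> A (f x).
Proof.
move=> cx fx cA fA; have PF : ProperFilter (within O (nbhs x)) by exact: within_nbhs_proper.
apply: (@closed_cvg _ _ (within O (nbhs x)) _ f A cA) => //.
  by rewrite near_withinE; near=> y => /fA.
by apply: cvg_trans fx; apply: cvg_fmap2; apply: within_subset; exact: subset_closure.
Unshelve. all: by end_near. Qed.

(** Since [w], [s] and [p - 1] are at least 1, [H ^+ p.-1] is at most [M ^+ p.-1 * s ^+ p], which is
    at most [(M * s ^+ p) ^+ p.-1]. *)
Lemma power_ratio_le (R : realFieldType) (H M w w0 s : R) p : (2 <= p)%N ->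
  0 <= H -> 0 <= M -> 1 <= w -> 0 <= w0 <= s -> 1 <= s ->
  H ^+ p.-1 * w ^+ p <= M ^+ p.-1 * w0 ^+ p -> H <= M * s ^+ p.
Proof.
move=> p2 H0 M0 w1 /andP[w00 w0s] s1 h; rewrite leNgt; apply/negP => MH.
have s0 : 0 <= s by exact: le_trans s1.
have p1 : (0 < p.-1)%N by rewrite -subn1 subn_gt0.
have : (M * s ^+ p) ^+ p.-1 < H ^+ p.-1.
  by rewrite ltr_pXn2r// nnegrE// mulr_ge0// exprn_ge0.
apply/negP; rewrite -leNgt; apply: (@le_trans _ _ (H ^+ p.-1 * w ^+ p)).
  by rewrite ler_peMr ?exprn_ge0// exprn_ege1.
apply: le_trans h _; rewrite exprMn ler_wpM2l ?exprn_ge0//.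
apply: (@le_trans _ _ (s ^+ p)); first by rewrite lerXn2r// nnegrE.
by rewrite -{1}[s ^+ p]expr1 ler_weXn2l// exprn_ege1.
Qed.

(** * The maximum over the closure, in the interior or on the boundary *)

Section CurvatureBound.
Variables (R : realType) (n p : nat) (O : set 'rV[R]_n) (u : 'rV[R]_n -> R).
Variable sigma : R.
Hypotheses (p2 : (2 <= p)%N) (pn : (p < n)%N) (sigma0 : 0 < sigma).
Hypotheses (oO : open O) (bO : bounded_set O).
Hypotheses (u4 : Ck 4 O u) (u2 : Ck_closure 2 O u).
Hypothesis u0 : forall x, O x -> 0 < u x.
Hypothesis adm : admissible p O u.
Hypothesis feq : forall x, O x -> fcurv p (kappa u x) = sigma.
Hypothesis nu_ge : forall x, O x -> sigma <= nu_vertical u x.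

Lemma hess_sym_on x : O x -> (hess u x)^T = hess u x.
Proof. by apply: hess_sym => //; apply: (Ck_Cd oO (s := [::]) u4). Qed.

Lemma mean_curvE x : O x -> mean_curv u x = \sum_i kappa u x 0 i.
Proof.
move=> /hess_sym_on Hs; apply: trace_eigenvalues; first exact: Amat_sym.
by apply: eigenvaluesP; exact: Amat_sym.
Qed.

Lemma mean_curv_gt0 x : O x -> 0 < mean_curv u x.
Proof. by move=> Ox; rewrite mean_curvE//; exact: (Pcone_sum_gt0 p2 pn (adm Ox)). Qed.

Lemma wfun_le x : O x -> wfun (grad u x) <= sigma^-1.
Proof.
move=> Ox; rewrite -[leLHS]invrK lef_pV2 ?posrE ?invr_gt0 ?wfun_gt0//.
exact: nu_ge.
Qed.

Lemma mean_curv_bound x : O x ->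
  mean_curv u x <= (4 * n%:R ^+ 2 + 2 * n%:R ^+ 4 + 4 * n%:R / sigma) * sigma^-1 ^+ p \/
  exists2 y, boundary O y &
    mean_curv u x <= (\sum_i kappa_boundary O u y 0 i) * sigma^-1 ^+ p.
Proof.
move=> Ox; have [g [h [gc hc gE hE]]] := second_order_extension u2.
have uc y : closure O y -> u @ within (closure O) (nbhs y) --> u y.
  by have [_ cu _] := u2; exact: (subspace_continuousP _ _).1 cu y.
pose H y := \tr (Amat (u y) (g y) (h y)).
have PF y : closure O y -> ProperFilter (within (closure O) (nbhs y)).
  by move=> cy; apply: within_nbhs_proper; exact: subset_closure.
have Hc y : closure O y -> H @ within (closure O) (nbhs y) --> H y.
  move=> cy; have := PF y cy => PFy.
  by apply: cvg_mxtrace; apply: mxcvg_Amat; [exact: uc|exact: gc|exact: hc].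
have wc y : closure O y -> wfun (g z) @[z --> within (closure O) (nbhs y)] --> wfun (g y).
  by move=> cy; have := PF y cy => PFy; apply: cvg_wfun; exact: gc.
have [||y] := @compact_EVT_max _ R (fun z => H z ^+ p.-1 * wfun (g z) ^+ p) _ _
  (compact_closure bO).
- by exists x; exact: subset_closure.
- apply/subspace_continuousP => y cy; have := PF y cy => PFy.
  by apply: cvgM; apply: cvg_exprn; [exact: Hc|exact: wc].
rewrite inE => cy ymax.
have HE z : O z -> H z = mean_curv u z by move=> Oz; rewrite /H gE// hE.
have max z : O z -> mean_curv u z ^+ p.-1 * wfun (grad u z) ^+ p <=
    H y ^+ p.-1 * wfun (g y) ^+ p.
  by move=> Oz; rewrite -HE// -gE//; apply: ymax; rewrite inE; exact: subset_closure.
have Hy0 : 0 <= H y.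
  apply: (closure_limit_closed cy (Hc y cy) (@closed_ge _ 0)) => z Oz /=.
  by rewrite HE// ltW// mean_curv_gt0.
have wy : wfun (g y) <= sigma^-1.
  apply: (closure_limit_closed (f := fun z => wfun (g z)) cy (wc y cy)
    (@closed_le _ sigma^-1)) => z Oz /=.
  by rewrite gE// wfun_le.
have xy : mean_curv u x <= H y * sigma^-1 ^+ p.
  apply: (power_ratio_le p2 _ Hy0 (wfun_ge1 (grad u x)) _ _ (max x Ox)).
  - by rewrite ltW// mean_curv_gt0.
  - by rewrite wy ltW// wfun_gt0.
  - exact: le_trans (wfun_ge1 (g y)) wy.
have sp0 : 0 <= sigma^-1 ^+ p by rewrite exprn_ge0// invr_ge0 ltW.
have [Oy|nOy] := pselect (O y); [left|right].
  apply: le_trans xy _; rewrite ler_wpM2r// HE//.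
  apply: (interior_max_bound oO u4 p2 pn sigma0 Oy (u0 Oy) adm feq nu_ge _ (mean_curv_gt0 Oy)).
  by move=> z Oz; have := max z Oz; rewrite (HE y Oy) (gE y Oy).
exists y; first by split=> // /interior_subset.
suff <- : H y = \sum_i kappa_boundary O u y 0 i by [].
(* Symmetry of the extended Hessian is a closed condition inherited from [O]; with it the boundary
   curvatures are true eigenvalues and add up to the trace. *)
have hs : (h y)^T = h y.
  apply/matrixP => i j; rewrite mxE; apply/eqP; rewrite -subr_eq0; apply/eqP.
  apply: (closure_limit_closed (f := fun z => h z j i - h z i j) (A := [set 0]) cy).
  - by apply: cvgB; exact: hc.
  - exact: closed_eq.
  - by move=> z Oz /=; rewrite hE// -[in X in X - _]hess_sym_on// mxE subrr.
rewrite /kappa_boundary (extendE cy (gc y cy) gE) (extendE cy (hc y cy) hE).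
by apply: trace_eigenvalues; [|apply: eigenvaluesP]; exact: Amat_sym.
Qed.

End CurvatureBound.

Theorem theorem1p2 (R : realType) (n p : nat) (hn : (3 <= n)%N)
    (hp2 : (2 <= p)%N) (hpn : (p <= n - 1)%N) (sigma : R) (hsigma : 0 < sigma) :
  exists C : R, forall (O : set 'rV[R]_n) (u : 'rV[R]_n -> R),
    bounded_smooth_domain O ->
    Ck 4 O u ->
    Ck_closure 2 O u ->
    (forall x, closure O x -> 0 < u x) ->
    admissible p O u ->
    (forall x, O x -> fcurv p (kappa u x) = sigma) ->
    (forall x, O x -> sigma <= nu_vertical u x) ->
    (ereal_sup [set (`|kappa u x 0 i|)%:E | x in O & i in [set: 'I_n]]
     <= C%:E * (1 + ereal_sup [set (`|kappa_boundary O u x 0 i|)%:E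
                              | x in boundary O & i in [set: 'I_n]]))%E.
Proof.
have pn : (p < n)%N by apply: leq_ltn_trans hpn _; rewrite subn1 ltn_predL (leq_trans _ hn).
pose C0 : R := 4 * n%:R ^+ 2 + 2 * n%:R ^+ 4 + 4 * n%:R / sigma.
pose a : R := n%:R * p%:R.
pose b : R := sigma^-1 ^+ p.
(* [a] passes from the trace to a single curvature, [b] from the maximum point to any point; [C0]
   serves an interior maximum, and [n] boundary curvatures are summed otherwise. *)
exists (a * b * (C0 + n%:R)).
move=> O u [[neO oO _] bO _] u4 u2 u0 adm feq nu_ge.
have a0 : 0 < a by rewrite mulr_gt0// ltr0n ?(leq_trans _ hn)// ltnW.
have b0 : 0 < b by rewrite exprn_gt0// invr_gt0.
have n0 : 0 < n%:R :> R by rewrite ltr0n (leq_trans _ hn).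
have C00 : 0 < C0 by rewrite addr_gt0 ?addr_gt0 ?mulr_gt0 ?exprn_gt0 ?invr_gt0.
pose i0 : 'I_n := Ordinal (leq_trans (isT : (0 < 3)%N) hn).
set S := (X in (_ <= _ * (_ + X))%E).
have Sge y i : boundary O y -> (`|kappa_boundary O u y 0 i|%:E <= S)%E.
  by move=> By; apply: ereal_sup_ubound; exists y => //; exists i.
have [y0 By0] := boundary_nonempty bO i0 neO.
(* The supremum of the empty set is [-oo]; a boundary point excludes this value. *)
have S0 : (0 <= S)%E by apply: le_trans (Sge y0 i0 By0); rewrite lee_fin.
case: S S0 Sge => [s| |//].
  rewrite lee_fin => s0 Sge; rewrite -EFinD -EFinM.
  apply: ge_ereal_sup => _ [x Ox [i _ <-]]; rewrite lee_fin.
  have u0O y : O y -> 0 < u y by move=> /subset_closure; exact: u0.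
  have := Pcone_norm_le hp2 pn (adm x Ox) i.
  rewrite -(mean_curvE oO u4 Ox) -/a => /le_trans; apply.
  have -> : a * b * (C0 + n%:R) * (1 + s) = a * ((C0 + n%:R) * (1 + s) * b) by ring.
  apply: (ler_wpM2l (ltW a0)).
  have [h|[y By h]] := mean_curv_bound hp2 pn hsigma oO bO u4 u2 u0O adm feq nu_ge Ox.
    apply: (le_trans h); apply: (ler_wpM2r (ltW b0)); rewrite -/C0; nra.
  apply: (le_trans h); apply: (ler_wpM2r (ltW b0)).
  have : \sum_i kappa_boundary O u y 0 i <= \sum_(i < n) s.
    apply: ler_sum => j _; have := Sge y j By; rewrite lee_fin.
    exact: le_trans (ler_norm _).
  rewrite sumr_const card_ord -mulr_natl; nra.
(* For an infinite boundary supremum the positive constant makes the right side [+oo]. *)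
move=> _ _; rewrite addey// gt0_muley ?leey// lte_fin.
exact: mulr_gt0 (mulr_gt0 a0 b0) (addr_gt0 C00 n0).
Qed.
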